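(* Let $D$ be a positive squarefree integer with $N(\varepsilon)=-1$. The Dirichlet series $Z_D^{\mathrm{even}}(s)$ (convergent for $\operatorname{Re}s>0$) has meromorphic continuation to $\mathbb{C}$, described as follows. For $1<\operatorname{Re}s<2$, \[ \begin{aligned} Z_D^{\mathrm{even}}(s)={}&\frac{q^{s/2}\zeta(s)}{(4\log\varepsilon)^s}+\frac{q^{s/2}\Gamma(1-s)\Gamma(\frac s2)}{4\,\Gamma(1-\frac s2)\log\varepsilon}\\ &+q^{s/2}\sum_{m\ne0}\left(\frac{\Gamma(1-s)\Gamma\big(\frac s2-\frac{\pi i m}{2\log\varepsilon}\big)}{4\,\Gamma\big(1-\frac s2-\frac{\pi i m}{2\log\varepsilon}\big)\log\varepsilon}-\frac{\Gamma(1-s)\,e^{\frac{\pi i}{2}(1-s)\operatorname{sgn}(m)}}{(2\pi|m|)^{1-s}(4\log\varepsilon)^s}\right), \] and the right-hand side converges absolutely away from its poles for all $\operatorname{Re}s<2$, giving the continuation there. For $\operatorname{Re}s<0$ the continuation equals \[ Z_D^{\mathrm{even}}(s)=\frac{q^{s/2}\Gamma(1-s)}{4\log\varepsilon}\sum_{m\in\mathbb{Z}}\frac{\Gamma\big(\frac s2-\frac{\pi i m}{2\log\varepsilon}\big)}{\Gamma\big(1-\frac s2-\frac{\pi i m}{2\log\varepsilon}\big)}. \] $Z_D^{\mathrm{even}}$ has simple poles at $s=\frac{\pi i m}{\log\varepsilon}-2k$ for all $m\in\mathbb{Z}$ and integers $k\ge0$.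
   Context: $D$ positive squarefree, $\mathcal{O}_D$ the ring of integers of $\mathbb{Q}(\sqrt D)\subset\mathbb{R}$, $\varepsilon>1$ its fundamental unit, $\overline{\varepsilon}$ its conjugate, $N$ the norm. $q=D$ if $D\equiv1\bmod4$, else $q=4D$. $F_D(n)=(\varepsilon^n-\overline{\varepsilon}^{\,n})/\sqrt q$, and $Z_D^{\mathrm{even}}(s)=\sum_{n\ge1}F_D(2n)^{-s}$ for $\operatorname{Re}s>0$. $\zeta$ is the Riemann zeta function and $\operatorname{sgn}(m)=\pm1$ is the sign of $m\neq0$. *)

(* Defs.v *)
From Stdlib Require Import Reals ZArith Znumtheory.
From Coquelicot Require Import Coquelicot.
Open Scope R_scope.

Notation CC := Complex.C.

Definition squarefree (D : Z) : Prop :=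
  forall k : Z, (k * k | D)%Z -> (k * k = 1)%Z.

Definition omega (D : Z) : R :=
  if Z.eqb (D mod 4) 1 then (1 + sqrt (IZR D)) / 2 else sqrt (IZR D).
Definition omega_bar (D : Z) : R :=
  if Z.eqb (D mod 4) 1 then (1 - sqrt (IZR D)) / 2 else - sqrt (IZR D).

Definition in_OD (D : Z) (x : R) : Prop :=
  exists a b : Z, x = IZR a + IZR b * omega D.

Definition is_unit_OD (D : Z) (x : R) : Prop :=
  x <> 0 /\ in_OD D x /\ in_OD D (/ x).

Definition fundamental_unit (D : Z) (eps : R) : Prop :=
  1 < eps /\ is_unit_OD D eps /\
  forall u : R, is_unit_OD D u -> 1 < u -> eps <= u.

Definition OD_conj (D : Z) (x y : R) : Prop :=
  exists a b : Z, x = IZR a + IZR b * omega D /\ y = IZR a + IZR b * omega_bar D.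

Definition qD (D : Z) : R :=
  if Z.eqb (D mod 4) 1 then IZR D else 4 * IZR D.

Definition FD (D : Z) (eps epsb : R) (n : nat) : R :=
  (eps ^ n - epsb ^ n) / sqrt (qD D).

Definition cexp (z : CC) : CC :=
  (exp (fst z) * cos (snd z), exp (fst z) * sin (snd z)).

Definition cpow (a : R) (z : CC) : CC := cexp (Cmult (RtoC (ln a)) z).

Fixpoint csum (a : nat -> CC) (n : nat) : CC :=
  match n with
  | O => RtoC 0
  | S n' => Cplus (csum a n') (a n')
  end.

Definition cseries_to (a : nat -> CC) (l : CC) : Prop :=
  forall e : R, 0 < e -> exists N : nat, forall n : nat, (N <= n)%nat ->
    Cmod (Cminus (csum a n) l) < e.

Definition holo_at (f : CC -> CC) (z : CC) : Prop :=
  exists l : CC, forall e : R, 0 < e -> exists d : R, 0 < d /\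
    forall h : CC, h <> RtoC 0 -> Cmod h < d ->
      Cmod (Cminus (Cdiv (Cminus (f (Cplus z h)) (f z)) h) l) < e.

Definition simple_pole (f : CC -> CC) (a : CC) : Prop :=
  exists r : R, 0 < r /\ exists g : CC -> CC,
    (forall z, Cmod (Cminus z a) < r -> holo_at g z) /\ g a <> RtoC 0 /\
    forall z, 0 < Cmod (Cminus z a) < r -> f z = Cdiv (g z) (Cminus z a).

Fixpoint poch (z : CC) (n : nat) : CC :=
  match n with
  | O => RtoC 1
  | S n' => Cmult (poch z n') (Cplus z (RtoC (INR n')))
  end.

(* 1/Gamma(z) = lim_n z(z+1)...(z+n) / (n! n^z), an entire function *)
Definition gauss_seq (z : CC) (n : nat) : CC :=
  Cdiv (poch z (S n)) (Cmult (RtoC (INR (fact n))) (cpow (INR n) z)).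

Definition rgamma (z : CC) : CC :=
  (real (Lim_seq (fun n => fst (gauss_seq z n))),
   real (Lim_seq (fun n => snd (gauss_seq z n)))).

Definition Gamma (z : CC) : CC := Cinv (rgamma z).

Definition is_riemann_zeta (zeta : CC -> CC) : Prop :=
  (forall s : CC, s <> RtoC 1 -> holo_at zeta s) /\
  (forall s : CC, 1 < Re s ->
     cseries_to (fun k => cpow (INR (S k)) (Copp s)) (zeta s)).

Definition sgnZ (m : Z) : R := if Z.ltb 0 m then 1 else -1.

Definition pole_set (L : R) (s : CC) : Prop :=
  exists (m : Z) (k : nat), s = (- 2 * INR k, IZR m * PI / L).

Definition gterm (L : R) (s : CC) (m : Z) : CC :=
  let w := Cmult Ci (RtoC (PI * IZR m / (2 * L))) in
  Cdiv (Cmult (Gamma (Cminus (RtoC 1) s))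
              (Gamma (Cminus (Cdiv s (RtoC 2)) w)))
       (Cmult (Cmult (RtoC 4) (Gamma (Cminus (Cminus (RtoC 1) (Cdiv s (RtoC 2))) w)))
              (RtoC L)).

(* summand for m <> 0 in the formula valid for Re s < 2 *)
Definition T1 (L : R) (s : CC) (m : Z) : CC :=
  Cminus (gterm L s m)
    (Cdiv (Cmult (Gamma (Cminus (RtoC 1) s))
                 (cexp (Cmult (Cmult (Cmult Ci (RtoC (PI / 2))) (Cminus (RtoC 1) s))
                              (RtoC (sgnZ m)))))
          (Cmult (cpow (2 * PI * IZR (Z.abs m)) (Cminus (RtoC 1) s))
                 (cpow (4 * L) s))).

Definition T2 (L : R) (s : CC) (m : Z) : CC :=
  Cdiv (Gamma (Cdiv s (RtoC 2) - Cmult Ci (RtoC (PI * IZR m / (2 * L)))))%C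
       (Gamma (Cminus (Cminus (RtoC 1) (Cdiv s (RtoC 2)))
                      (Cmult Ci (RtoC (PI * IZR m / (2 * L)))))).

(* Main.v *)
(** Write L = log eps and c_j = (s)_j / j!. The binomial series turns q^{-s/2} Z(s) into
    S_L(s) = sum_j c_j / (e^{4L(j+s/2)} - 1), which converges off the poles and displays them.

    For Re s < 0, insert 1/(e^u-1) = -1/2 + 1/u + sum_{m>0} 2u/(u^2+4 pi^2 m^2) and exchange the sums. Since
    sum_j c_j = 0 and sum_j c_j/(j+z) = Gamma(1-s) Gamma(z) / Gamma(z+1-s), this is the formula for Re s < 0.

    The ratio of Gamma(s/2-iy) / Gamma(1-s/2-iy) to (-iy)^{s-1} is 1 + O(y^{-2}), locally uniformly in s, so the
    subtracted series converges for Re s < 2. Let G_L(s) be the value that the formula for Re s < 2 forces on zeta(s).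
    For Re s < 0 it does not depend on L, so by the identity theorem G_L = G_{L/n} on the strip -1 < Re s < 2. Letting
    n tend to infinity identifies it with the zeta series on 1 < Re s < 2, and the identity theorem then with the
    continuation of zeta. In this way the functional equation of zeta is a by-product.

    The complex analysis (bounded pointwise limits of holomorphic functions, identity theorem) rests on a discrete
    Cauchy formula over roots of unity. *)

(* The sums over j and m are exchanged where sum |c_j| converges, for Re s < 0, while the series of
   zeta is at hand only for Re s > 1; the strip -1 < Re s < 2 bridges the gap. Accordingly zeta is
   built from two pieces overlapping in -1 < Re s < 0: the trapezoidal rule, which reaches Re s >
   -1, and the dual series of the functional equation.

   Independence of L for Re s < 0 is a scaling: at y = pi m / (2L) the leading term (-iy)^{s-1} is
   (4L)^{1-s} times a quantity without L. The scale is divided by integers because the poles for L/n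
   are among those for L, so one strip serves all n. The terms (4L/n)^s (2 sinh(2Lk/n))^{-s} tend to
   k^{-s}, and the corrections are O(n^{1 - Re s}) and O(n^{-2}).

   The error O(y^{-2}) rests on the symmetry of s/2 and 1 - s/2 about 1/2: with v = k + 1/2 - iy and
   a = (1-s)/2, the k-th factor of the quotient is (v+a)/(v-a), whose terms of first and second
   order are matched by the midpoint rule for the logarithm. *)
Require Import Defs.
From Stdlib Require Import Reals ZArith Znumtheory Lra Lia Psatz Classical ClassicalEpsilon.
From Coquelicot Require Import Coquelicot.
Open Scope R_scope.
Set Bullet Behavior "Strict Subproofs".

(** * Limits and series of complex numbers *)

(** Reduced to a real sequence, so that the squeeze lemmas of Coquelicot apply; [Clim_components]
    and [Clim_eps] translate it to coordinates and to the form of [cseries_to]. *)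
Definition Clim (u : nat -> CC) (l : CC) : Prop :=
  is_lim_seq (fun n => Cmod (u n - l)) 0.

Lemma Cmod_fst_le (z : CC) : Rabs (fst z) <= Cmod z.
Proof. apply Rle_trans with (2 := Rmax_Cmod z). apply Rmax_l. Qed.

Lemma Cmod_snd_le (z : CC) : Rabs (snd z) <= Cmod z.
Proof. apply Rle_trans with (2 := Rmax_Cmod z). apply Rmax_r. Qed.

Lemma Cmod_le_abs (z : CC) : Cmod z <= Rabs (fst z) + Rabs (snd z).
Proof.
  unfold Cmod. apply Rsqr_incr_0_var.
  - rewrite Rsqr_sqrt by nra. unfold Rsqr.
    generalize (Rabs_pos (fst z)) (Rabs_pos (snd z)).
    rewrite <- (pow2_abs (fst z)), <- (pow2_abs (snd z)). nra.
  - generalize (Rabs_pos (fst z)) (Rabs_pos (snd z)); lra.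
Qed.

Lemma Cmod_minus_sym (a b : CC) : Cmod (a - b) = Cmod (b - a).
Proof. rewrite <- Cmod_opp. f_equal. ring. Qed.

Lemma Cmod_triangle_sub (a b : CC) : Cmod a - Cmod b <= Cmod (a - b).
Proof.
  generalize (Cmod_triangle (a - b) b). replace (a - b + b)%C with a by ring. lra.
Qed.

Lemma Cmod_triangle_plus (a b : CC) : Cmod a - Cmod b <= Cmod (a + b).
Proof.
  generalize (Cmod_triangle_sub a (- b)). rewrite Cmod_opp.
  replace (a - - b)%C with (a + b)%C by ring. lra.
Qed.

Lemma Cmod_triangle_minus (a b : CC) : Cmod (a - b) <= Cmod a + Cmod b.
Proof. generalize (Cmod_triangle a (- b)). now rewrite Cmod_opp. Qed.

Lemma Clim_squeeze (u : nat -> CC) l (v : nat -> R) :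
  (exists N, forall n, (N <= n)%nat -> Cmod (u n - l) <= v n) -> is_lim_seq v 0 -> Clim u l.
Proof.
  intros [N HN] Hv. unfold Clim.
  apply is_lim_seq_le_le_loc with (fun _ => 0) v; auto using is_lim_seq_const.
  exists N; intros n Hn; split; auto using Cmod_ge_0.
Qed.

Lemma is_lim_seq_abs_0' (u : nat -> R) (l : R) :
  is_lim_seq u l <-> is_lim_seq (fun n => Rabs (u n - l)) 0.
Proof.
  split; intros H.
  - apply -> is_lim_seq_abs_0. replace (Finite 0) with (Finite (l - l)) by (f_equal; ring).
    apply is_lim_seq_minus'; [exact H|apply is_lim_seq_const].
  - apply is_lim_seq_abs_0 in H.
    apply is_lim_seq_ext with (fun n => (u n - l) + l). intros; ring.
    replace (Finite l) with (Finite (0 + l)) by (f_equal; ring).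
    apply is_lim_seq_plus'; auto using is_lim_seq_const.
Qed.

Lemma Clim_components (u : nat -> CC) (l : CC) :
  Clim u l <-> is_lim_seq (fun n => fst (u n)) (fst l) /\ is_lim_seq (fun n => snd (u n)) (snd l).
Proof.
  split.
  - intros H; split; apply is_lim_seq_abs_0'.
    + apply is_lim_seq_le_le with (fun _ => 0) (fun n => Cmod (u n - l)); auto using is_lim_seq_const.
      intros n; split; [apply Rabs_pos|]. apply (Cmod_fst_le (u n - l)).
    + apply is_lim_seq_le_le with (fun _ => 0) (fun n => Cmod (u n - l)); auto using is_lim_seq_const.
      intros n; split; [apply Rabs_pos|]. apply (Cmod_snd_le (u n - l)).
  - intros [H1 H2]. apply Clim_squeeze with (fun n => Rabs (fst (u n) - fst l) + Rabs (snd (u n) - snd l)).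
    + exists O; intros n _. apply (Cmod_le_abs (u n - l)).
    + replace 0 with (0 + 0) by ring. apply is_lim_seq_plus'; now apply -> is_lim_seq_abs_0'.
Qed.

Lemma Clim_ext_loc u v l : (exists N, forall n, (N <= n)%nat -> u n = v n) -> Clim u l -> Clim v l.
Proof.
  intros [N H] Hu. apply Clim_squeeze with (fun n => Cmod (u n - l)); auto.
  exists N; intros n Hn. rewrite H by auto. lra.
Qed.

Lemma Clim_eq u (l m : CC) : Clim u l -> l = m -> Clim u m.
Proof. now intros H <-. Qed.

Lemma Clim_ext u v l : (forall n, u n = v n) -> Clim u l -> Clim v l.
Proof. intros H; apply Clim_ext_loc; exists O; auto. Qed.

Lemma Clim_const l : Clim (fun _ => l) l.
Proof. apply Clim_components; split; apply is_lim_seq_const. Qed.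

Lemma Clim_plus u v l m : Clim u l -> Clim v m -> Clim (fun n => u n + v n)%C (l + m)%C.
Proof.
  rewrite !Clim_components; intros [A B] [A' B']; split; now apply is_lim_seq_plus'.
Qed.

Lemma Clim_mult u v l m : Clim u l -> Clim v m -> Clim (fun n => u n * v n)%C (l * m)%C.
Proof.
  rewrite !Clim_components; intros [A B] [A' B']; split; simpl.
  - apply is_lim_seq_minus'; now apply is_lim_seq_mult'.
  - apply is_lim_seq_plus'; now apply is_lim_seq_mult'.
Qed.

Lemma Clim_opp u l : Clim u l -> Clim (fun n => - u n)%C (- l)%C.
Proof.
  rewrite !Clim_components; intros [A B]; split; simpl;
  [generalize (proj1 (is_lim_seq_opp _ _) A)|generalize (proj1 (is_lim_seq_opp _ _) B)]; auto.
Qed.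

Lemma Clim_minus u v l m : Clim u l -> Clim v m -> Clim (fun n => u n - v n)%C (l - m)%C.
Proof. intros; apply Clim_plus; auto using Clim_opp. Qed.

Lemma Clim_scal c u l : Clim u l -> Clim (fun n => c * u n)%C (c * l)%C.
Proof. intros; apply Clim_mult; auto using Clim_const. Qed.

Lemma Clim_unique u l m : Clim u l -> Clim u m -> l = m.
Proof.
  rewrite !Clim_components; intros [A B] [A' B'].
  apply is_lim_seq_unique in A, B, A', B'. rewrite A in A'; rewrite B in B'.
  apply injective_projections; congruence.
Qed.

Lemma Clim_Cmod u l : Clim u l -> is_lim_seq (fun n => Cmod (u n)) (Cmod l).
Proof.
  intros H. apply is_lim_seq_abs_0'.
  apply is_lim_seq_le_le with (fun _ => 0) (fun n => Cmod (u n - l)); auto using is_lim_seq_const.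
  intros n; split; [apply Rabs_pos|]. apply Rabs_le. split.
  - generalize (Cmod_triangle_sub l (u n)). rewrite Cmod_minus_sym. lra.
  - apply Cmod_triangle_sub.
Qed.

Lemma Clim_le u l M : (exists N, forall n, (N <= n)%nat -> Cmod (u n) <= M) -> Clim u l -> Cmod l <= M.
Proof.
  intros [N HN] H. apply Clim_Cmod in H.
  apply (is_lim_seq_le_loc (fun n => Cmod (u n)) (fun _ => M) (Cmod l) M); auto using is_lim_seq_const. exists N; auto.
Qed.

Lemma Clim_inv (u : nat -> CC) (l : CC) : l <> 0%C -> Clim u l -> Clim (fun n => / u n)%C (/ l)%C.
Proof.
  intros Hl H.
  assert (Hl2 : fst l ^ 2 + snd l ^ 2 <> 0).
  { intros E. apply Hl. apply injective_projections; simpl; nra. }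
  apply Clim_components in H as [A B].
  assert (HD : is_lim_seq (fun n => fst (u n) ^ 2 + snd (u n) ^ 2) (fst l ^ 2 + snd l ^ 2)).
  { apply is_lim_seq_ext with (fun n => fst (u n) * fst (u n) + snd (u n) * snd (u n)). intros; ring.
    replace (fst l ^ 2 + snd l ^ 2) with (fst l * fst l + snd l * snd l) by ring.
    apply is_lim_seq_plus'; apply is_lim_seq_mult'; assumption. }
  apply Clim_components; split; unfold Cinv; cbn [fst snd];
  apply is_lim_seq_div'; auto.
  generalize (proj1 (is_lim_seq_opp _ _) B); auto.
Qed.

Lemma Clim_incr u l k : Clim u l -> Clim (fun n => u (n + k)%nat) l.
Proof.
  intros H. unfold Clim. apply (is_lim_seq_incr_n (fun n => Cmod (u n - l)) k). exact H.
Qed.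

Lemma Clim_decr u l k : Clim (fun n => u (n + k)%nat) l -> Clim u l.
Proof.
  intros H. unfold Clim. apply (is_lim_seq_incr_n (fun n => Cmod (u n - l)) k). exact H.
Qed.

Lemma Clim_eps u l : Clim u l <->
  forall e : R, 0 < e -> exists N : nat, forall n : nat, (N <= n)%nat -> Cmod (u n - l) < e.
Proof.
  unfold Clim. split.
  - intros H e He. apply is_lim_seq_spec in H. destruct (H (mkposreal e He)) as [N HN]. exists N; intros n Hn.
    generalize (HN n Hn); simpl. rewrite Rminus_0_r, Rabs_pos_eq; auto using Cmod_ge_0.
  - intros H. apply is_lim_seq_spec. intros [e He]. destruct (H e He) as [N HN]. exists N; intros n Hn; simpl.
    rewrite Rminus_0_r, Rabs_pos_eq; auto using Cmod_ge_0.
Qed.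

Lemma Clim_bounded u l : Clim u l -> exists M, forall n, Cmod (u n) <= M.
Proof.
  intros H. apply Clim_Cmod in H.
  assert (E : ex_finite_lim_seq (fun n => Cmod (u n))) by (eexists; eauto).
  apply ex_finite_lim_seq_correct in E as [E _].
  destruct (filterlim_bounded (fun n => Cmod (u n))) as [M HM].
  - eexists; exact H.
  - exists M. intros n. generalize (HM n). unfold norm; simpl. unfold abs; simpl.
    rewrite Rabs_pos_eq; auto using Cmod_ge_0.
Qed.

Lemma cseries_to_Clim a l : cseries_to a l <-> Clim (csum a) l.
Proof. rewrite Clim_eps. reflexivity. Qed.

Lemma csum_ext a b n : (forall k, (k < n)%nat -> a k = b k) -> csum a n = csum b n.
Proof.
  induction n; intros H; simpl; auto. rewrite IHn, H; auto.
Qed.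

Lemma csum_plus a b n : csum (fun k => a k + b k)%C n = (csum a n + csum b n)%C.
Proof. induction n; simpl; [ring|rewrite IHn; ring]. Qed.

Lemma csum_scal c a n : csum (fun k => c * a k)%C n = (c * csum a n)%C.
Proof. induction n; simpl; [ring|rewrite IHn; ring]. Qed.

Lemma csum_opp a n : csum (fun k => - a k)%C n = (- csum a n)%C.
Proof. induction n; simpl; [ring|rewrite IHn; ring]. Qed.

Lemma csum_minus a b n : csum (fun k => a k - b k)%C n = (csum a n - csum b n)%C.
Proof. induction n; simpl; [ring|rewrite IHn; ring]. Qed.

Lemma csum_0 (a : nat -> CC) n : (forall k, (k < n)%nat -> a k = 0%C) -> csum a n = 0%C.
Proof. induction n; intros H; simpl; auto. rewrite IHn, H; auto. ring. Qed.

Lemma csum_const c n : csum (fun _ => c) n = (INR n * c)%C.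
Proof. induction n. simpl; ring. simpl csum. rewrite IHn, S_INR, RtoC_plus. ring. Qed.

Lemma csum_split a n m : csum a (n + m) = (csum a n + csum (fun k => a (n + k)%nat) m)%C.
Proof.
  induction m; simpl. rewrite Nat.add_0_r; ring. rewrite Nat.add_succ_r; simpl. rewrite IHm; ring.
Qed.

Lemma csum_S_l a n : csum a (S n) = (a O + csum (fun k => a (S k)) n)%C.
Proof. change (S n) with (1 + n)%nat. rewrite csum_split. simpl. ring. Qed.

Lemma csum_swap (a : nat -> nat -> CC) n m :
  csum (fun i => csum (fun j => a i j) m) n = csum (fun j => csum (fun i => a i j) n) m.
Proof.
  induction n; simpl. symmetry; apply csum_0; auto.
  rewrite IHn, <- csum_plus. auto.
Qed.

Fixpoint rsum (a : nat -> R) (n : nat) : R :=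
  match n with O => 0 | S n' => rsum a n' + a n' end.

Lemma rsum_sum_n a n : rsum a (S n) = sum_n a n.
Proof.
  induction n. rewrite sum_O. simpl; ring.
  rewrite sum_Sn. rewrite <- IHn. reflexivity.
Qed.

Lemma rsum_le a b n : (forall k, (k < n)%nat -> a k <= b k) -> rsum a n <= rsum b n.
Proof.
  induction n; intros H; simpl. lra.
  apply Rplus_le_compat; auto.
Qed.

Lemma rsum_nonneg a n : (forall k, (k < n)%nat -> 0 <= a k) -> 0 <= rsum a n.
Proof.
  induction n; intros H; simpl. lra.
  apply Rplus_le_le_0_compat; auto.
Qed.

Lemma rsum_scal c a n : rsum (fun k => c * a k) n = c * rsum a n.
Proof. induction n; simpl; [ring|rewrite IHn; ring]. Qed.

Lemma rsum_const c n : rsum (fun _ => c) n = INR n * c.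
Proof. induction n. simpl; ring. simpl rsum. rewrite IHn, S_INR. ring. Qed.

Lemma csum_mod_le a n : Cmod (csum a n) <= rsum (fun k => Cmod (a k)) n.
Proof.
  induction n; simpl. rewrite Cmod_0; lra.
  eapply Rle_trans; [apply Cmod_triangle|]. lra.
Qed.

Lemma rsum_split a n m : rsum a (n + m) = rsum a n + rsum (fun k => a (n + k)%nat) m.
Proof.
  induction m; simpl. rewrite Nat.add_0_r; ring. rewrite Nat.add_succ_r; simpl. rewrite IHm; ring.
Qed.

Lemma is_series_rsum a (l : R) : is_series a l <-> is_lim_seq (rsum a) l.
Proof.
  split; intros H.
  - apply is_lim_seq_incr_1. apply is_lim_seq_ext with (sum_n a). intros; symmetry; apply rsum_sum_n. exact H.
  - apply is_lim_seq_incr_1 in H. apply is_lim_seq_ext with (v := sum_n a) in H. exact H. intros; apply rsum_sum_n.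
Qed.

Lemma ex_series_Series_lim a : ex_series a -> is_lim_seq (rsum a) (Series a).
Proof. intros H. apply is_series_rsum. now apply Series_correct. Qed.

Lemma rsum_le_Series a n : (forall k, 0 <= a k) -> ex_series a -> rsum a n <= Series a.
Proof.
  intros Hp H. apply ex_series_Series_lim in H.
  apply (is_lim_seq_le_loc (fun _ => rsum a n) (rsum a) (rsum a n) (Series a)); auto using is_lim_seq_const.
  exists n; intros m Hm. replace m with (n + (m - n))%nat by lia. rewrite rsum_split.
  generalize (rsum_nonneg (fun k => a (n + k)%nat) (m - n) (fun k _ => Hp _)). lra.
Qed.

Lemma ex_series_of_bounded a M : (forall k, 0 <= a k) -> (forall n, rsum a n <= M) -> ex_series a.
Proof.
  intros Hp HM. destruct (ex_finite_lim_seq_incr (rsum a) M) as [l Hl].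
  - intros n; simpl. generalize (Hp n); lra.
  - auto.
  - exists l. now apply is_series_rsum.
Qed.

Lemma fst_csum a n : fst (csum a n) = rsum (fun k => fst (a k)) n.
Proof. induction n; simpl; auto. now rewrite IHn. Qed.

Lemma snd_csum a n : snd (csum a n) = rsum (fun k => snd (a k)) n.
Proof. induction n; simpl; auto. now rewrite IHn. Qed.

(** Total, like [Series]: on a divergent series the value carries no meaning, and convergence has to
    be supplied separately. Totality allows a sum of functions to be named before its domain is
    known. *)
Definition CSer (a : nat -> CC) : CC :=
  (Series (fun k => fst (a k)), Series (fun k => snd (a k))).

Lemma ex_series_le_nonneg (a b : nat -> R) : (forall n, 0 <= a n <= b n) -> ex_series b -> ex_series a.
Proof.
  intros H Hb. apply (@ex_series_le R_AbsRing R_CompleteNormedModule a b); auto. intros n. unfold norm; simpl. unfold abs; simpl.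
  rewrite Rabs_pos_eq; apply H.
Qed.

Lemma CSer_correct a : ex_series (fun k => Cmod (a k)) -> Clim (csum a) (CSer a).
Proof.
  intros H. apply Clim_components; split; unfold CSer; cbn [fst snd].
  - apply is_lim_seq_ext with (rsum (fun k => fst (a k))). intros; now rewrite fst_csum.
    apply ex_series_Series_lim. apply ex_series_Rabs.
    apply ex_series_le_nonneg with (2 := H). split; auto using Rabs_pos, Cmod_fst_le.
  - apply is_lim_seq_ext with (rsum (fun k => snd (a k))). intros; now rewrite snd_csum.
    apply ex_series_Series_lim. apply ex_series_Rabs.
    apply ex_series_le_nonneg with (2 := H). split; auto using Rabs_pos, Cmod_snd_le.
Qed.

Lemma CSer_unique a l : Clim (csum a) l -> CSer a = l.
Proof.
  intros H. apply Clim_components in H as [A B].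
  apply injective_projections; unfold CSer; cbn [fst snd]; apply is_series_unique; apply is_series_rsum.
  - apply is_lim_seq_ext with (2 := A). intros; apply fst_csum.
  - apply is_lim_seq_ext with (2 := B). intros; apply snd_csum.
Qed.

Lemma csum_le_Series a b n : (forall k, Cmod (a k) <= b k) -> ex_series b -> Cmod (csum a n) <= Series b.
Proof.
  intros H Hb. eapply Rle_trans; [apply csum_mod_le|].
  eapply Rle_trans; [apply (rsum_le _ b); auto|]. apply rsum_le_Series; auto.
  intros k; eapply Rle_trans; [apply Cmod_ge_0|apply H].
Qed.

Lemma ex_series_Cmod_le a b : (forall k, Cmod (a k) <= b k) -> ex_series b -> ex_series (fun k => Cmod (a k)).
Proof. intros H Hb. apply ex_series_le_nonneg with (2 := Hb). auto using Cmod_ge_0. Qed.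

Lemma csum_tail a b n l :
  (forall k, Cmod (a k) <= b k) -> ex_series b -> Clim (csum a) l -> Cmod (l - csum a n) <= Series b - rsum b n.
Proof.
  intros H Hb Hl. apply Clim_le with (u := fun m => (csum a m - csum a n)%C).
  - exists n. intros m Hm. replace m with (n + (m - n))%nat by lia. rewrite csum_split.
    replace (_ - _)%C with (csum (fun k => a (n + k)%nat) (m - n)) by ring.
    eapply Rle_trans; [apply csum_mod_le|].
    eapply Rle_trans; [apply (rsum_le _ (fun k => b (n + k)%nat)); auto|].
    assert (Hp : forall k, 0 <= b k) by (intros k; eapply Rle_trans; [apply Cmod_ge_0|apply H]).
    generalize (rsum_le_Series b (n + (m - n)) Hp Hb). rewrite rsum_split. lra.
  - apply Clim_minus; auto using Clim_const.
Qed.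

(** Dominated convergence for series. Beyond a fixed [J] the tails of [A N] and of the limit are
    below e/4 uniformly in [N], by the tail of [b]; the first [J] terms form a finite sum, which
    converges. Every exchange of two infinite sums below is an instance, with partial sums of one of
    them as the parameter. *)
Lemma Tannery (a : nat -> nat -> CC) (l : nat -> CC) (A : nat -> CC) (b : nat -> R) :
  (forall N j, Cmod (a N j) <= b j) -> ex_series b ->
  (forall j, Clim (fun N => a N j) (l j)) ->
  (forall N, Clim (csum (a N)) (A N)) ->
  Clim A (CSer l).
Proof.
  intros Hb Eb Hl HA.
  assert (Hlb : forall j, Cmod (l j) <= b j).
  { intros j. apply Clim_le with (2 := Hl j). exists O; auto. }
  assert (HL : Clim (csum l) (CSer l)) by (apply CSer_correct; eapply ex_series_Cmod_le; eauto).
  assert (HS := ex_series_Series_lim b Eb).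
  apply Clim_eps. intros e He.
  apply is_lim_seq_spec in HS. destruct (HS (mkposreal (e/4) ltac:(lra))) as [J HJ].
  specialize (HJ J (Nat.le_refl _)). simpl in HJ.
  apply Rabs_def2 in HJ.
  assert (HF : Clim (fun N => csum (a N) J) (csum l J)).
  { clear - Hl. induction J; simpl. apply Clim_const. apply Clim_plus; auto. }
  apply Clim_eps with (e := e/4) in HF; [|lra]. destruct HF as [N HN].
  exists N; intros n Hn. specialize (HN n Hn).
  generalize (csum_tail _ _ J _ (Hb n) Eb (HA n)) (csum_tail _ _ J _ Hlb Eb HL). intros T1 T2.
  replace (A n - CSer l)%C with ((A n - csum (a n) J) + (csum (a n) J - csum l J) - (CSer l - csum l J))%C by ring.
  generalize (Cmod_triangle_minus (A n - csum (a n) J + (csum (a n) J - csum l J)) (CSer l - csum l J)).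
  generalize (Cmod_triangle (A n - csum (a n) J) (csum (a n) J - csum l J)). lra.
Qed.

Lemma CSer_ext a b : (forall k, a k = b k) -> CSer a = CSer b.
Proof. intros H; unfold CSer; f_equal; apply Series_ext; intros; now rewrite H. Qed.

Lemma csum_finite_lim (a : nat -> CC) N :
  (forall k, (N <= k)%nat -> a k = 0%C) -> Clim (csum a) (csum a N).
Proof.
  intros H. apply Clim_ext_loc with (fun _ => csum a N); [|apply Clim_const].
  exists N; intros n Hn. replace n with (N + (n - N))%nat by lia. rewrite csum_split.
  rewrite (csum_0 (fun k => a (N + k)%nat)). ring. intros; apply H; lia.
Qed.

(** * Curves in the complex plane and the exponential *)

Definition Cder (g : R -> CC) (t : R) (l : CC) : Prop :=
  is_derive (fun u => fst (g u)) t (fst l) /\ is_derive (fun u => snd (g u)) t (snd l).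

Lemma C_eq (a b : CC) : fst a = fst b -> snd a = snd b -> a = b.
Proof. destruct a, b; simpl; congruence. Qed.

(** Goals left by the derivative lemmas may be stated in the carrier of an algebraic structure;
    retyping the equality at [R] or [CC] lets [ring] and [field] recognize it. *)
Ltac eqbeta := cbv beta; match goal with |- @eq _ ?a ?b => first [change (@eq R a b) | change (@eq CC a b)] end.
Ltac bring := eqbeta; ring.

Lemma Cder_eq g t (l m : CC) : Cder g t l -> l = m -> Cder g t m.
Proof. now intros H <-. Qed.

Lemma Cder_ext f g t l : (forall u, f u = g u) -> Cder f t l -> Cder g t l.
Proof.
  intros H [A B]; split; [apply is_derive_ext with (2 := A)|apply is_derive_ext with (2 := B)];
  intros; now rewrite H.
Qed.

Lemma Cder_const (c : CC) t : Cder (fun _ => c) t (RtoC 0).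
Proof. split; apply @is_derive_const. Qed.

Lemma Cder_R (f : R -> R) t d : is_derive f t d -> Cder (fun u => RtoC (f u)) t (RtoC d).
Proof. intros H; split; simpl; auto. apply @is_derive_const. Qed.

Lemma Cder_plus f g t (l m : CC) : Cder f t l -> Cder g t m -> Cder (fun u => f u + g u)%C t (l + m)%C.
Proof. intros [A B] [A' B']; split; simpl; now apply @is_derive_plus. Qed.

Lemma Cder_opp f t (l : CC) : Cder f t l -> Cder (fun u => - f u)%C t (- l)%C.
Proof. intros [A B]; split; simpl; now apply @is_derive_opp. Qed.

Lemma Cder_minus f g t (l m : CC) : Cder f t l -> Cder g t m -> Cder (fun u => f u - g u)%C t (l - m)%C.
Proof. intros; apply Cder_plus; auto using Cder_opp. Qed.

Lemma is_derive_Rmult (f g : R -> R) t df dg :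
  is_derive f t df -> is_derive g t dg -> is_derive (fun u => f u * g u) t (df * g t + f t * dg).
Proof. intros A B. apply (is_derive_mult f g t df dg A B). intros; apply Rmult_comm. Qed.

Lemma is_derive_eqR (f : R -> R) t a b : is_derive f t a -> a = b -> is_derive f t b.
Proof. now intros H <-. Qed.

Lemma Cder_mult f g t (l m : CC) : Cder f t l -> Cder g t m ->
  Cder (fun u => f u * g u)%C t (l * g t + f t * m)%C.
Proof.
  intros [A B] [A' B']; split; simpl.
  - eapply is_derive_eqR. apply @is_derive_minus; apply is_derive_Rmult; eassumption.
    unfold minus, plus, opp; simpl. ring.
  - eapply is_derive_eqR. apply @is_derive_plus; apply is_derive_Rmult; eassumption.
    unfold plus; simpl. ring.
Qed.

Lemma Cder_scal (c : CC) f t (l : CC) : Cder f t l -> Cder (fun u => c * f u)%C t (c * l)%C.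
Proof.
  intros H. eapply Cder_eq. apply Cder_mult; [apply Cder_const|exact H]. bring.
Qed.

Lemma is_derive_compR (f g : R -> R) t df dg :
  is_derive f (g t) df -> is_derive g t dg -> is_derive (fun u => f (g u)) t (dg * df).
Proof. intros A B. exact (is_derive_comp f g t df dg A B). Qed.

Lemma Cder_cexp f t (l : CC) : Cder f t l -> Cder (fun u => cexp (f u)) t (l * cexp (f t))%C.
Proof.
  assert (E : is_derive exp (fst (f t)) (exp (fst (f t)))) by (apply is_derive_Reals, derivable_pt_lim_exp).
  assert (S : is_derive sin (snd (f t)) (cos (snd (f t)))) by (apply is_derive_Reals, derivable_pt_lim_sin).
  assert (K : is_derive cos (snd (f t)) (- sin (snd (f t)))) by (apply is_derive_Reals, derivable_pt_lim_cos).
  intros [A B]; split; simpl.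
  - eapply is_derive_eqR. apply is_derive_Rmult.
    apply (is_derive_compR exp (fun u => fst (f u)) t _ _ E A). apply (is_derive_compR cos (fun u => snd (f u)) t _ _ K B).
    bring.
  - eapply is_derive_eqR. apply is_derive_Rmult.
    apply (is_derive_compR exp (fun u => fst (f u)) t _ _ E A). apply (is_derive_compR sin (fun u => snd (f u)) t _ _ S B).
    bring.
Qed.

Lemma is_derive_nonneg_le (h cderiv : R -> R) a b : a <= b ->
  (forall t, a <= t <= b -> is_derive h t (cderiv t)) -> (forall t, a <= t <= b -> 0 <= cderiv t) -> h a <= h b.
Proof.
  intros Hab Hd Hp. destruct (MVT_gen h a b cderiv) as [c [Hc E]].
  - intros x. rewrite Rmin_left, Rmax_right by lra. intros; apply Hd; lra.
  - intros x. rewrite Rmin_left, Rmax_right by lra. intros.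
    apply derivable_continuous_pt. exists (cderiv x). apply is_derive_Reals. apply Hd; lra.
  - rewrite Rmin_left, Rmax_right in Hc by lra. specialize (Hp c Hc). nra.
Qed.

(* The curve is projected on the direction of its total displacement. *)
Lemma Cmvt (f f' : R -> CC) (g g' : R -> R) a b : a <= b ->
  (forall t, a <= t <= b -> Cder f t (f' t)) ->
  (forall t, a <= t <= b -> is_derive g t (g' t)) ->
  (forall t, a <= t <= b -> Cmod (f' t) <= g' t) ->
  Cmod (f b - f a) <= g b - g a.
Proof.
  intros Hab Hf Hg Hle. set (D := (f b - f a)%C). set (m := Cmod D).
  assert (Hm : 0 <= m) by apply Cmod_ge_0.
  assert (Hg0 : g a <= g b).
  { apply is_derive_nonneg_le with g'; auto. intros t Ht.
    apply Rle_trans with (2 := Hle t Ht). apply Cmod_ge_0. }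
  set (h := fun t => m * g t - (fst D * fst (f t) + snd D * snd (f t))).
  assert (Hh : h a <= h b).
  { apply is_derive_nonneg_le with (fun t => m * g' t - (fst D * fst (f' t) + snd D * snd (f' t))); auto.
    - intros t Ht. destruct (Hf t Ht) as [A B]. unfold h.
      apply @is_derive_minus; [apply is_derive_scal; auto|].
      apply @is_derive_plus; apply is_derive_scal; auto.
    - intros t Ht. specialize (Hle t Ht).
      assert (E : fst D * fst (f' t) + snd D * snd (f' t) = fst (Cconj D * f' t)%C) by (simpl; ring).
      rewrite E. generalize (Cmod_fst_le (Cconj D * f' t)). rewrite Cmod_mult, Cmod_conj. fold m.
      intros H. generalize (Rle_abs (fst (Cconj D * f' t)%C)). nra. }
  assert (E : m * m = fst D * fst D + snd D * snd D).
  { generalize (Cmod2_alt D). fold m. unfold Re, Im. simpl. intros; lra. }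
  unfold h in Hh. assert (D1 : fst D = fst (f b) - fst (f a)) by reflexivity.
  assert (D2 : snd D = snd (f b) - snd (f a)) by reflexivity.
  assert (m * m <= m * (g b - g a)).
  { rewrite E. replace (fst D * fst D) with (fst D * (fst (f b) - fst (f a))) by (rewrite D1; ring).
    replace (snd D * snd D) with (snd D * (snd (f b) - snd (f a))) by (rewrite D2; ring). lra. }
  destruct (Req_dec m 0) as [E0|E0]. lra. nra.
Qed.

Lemma cexp_plus (a b : CC) : cexp (a + b) = (cexp a * cexp b)%C.
Proof.
  apply C_eq; simpl; rewrite exp_plus; [rewrite cos_plus|rewrite sin_plus]; ring.
Qed.

Lemma cexp_0 : cexp 0 = 1%C.
Proof. apply C_eq; simpl; rewrite exp_0; [rewrite cos_0|rewrite sin_0]; ring. Qed.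

Lemma Cmod_cexp (a : CC) : Cmod (cexp a) = exp (fst a).
Proof.
  unfold Cmod, cexp; cbn [fst snd].
  replace (_ + _) with (exp (fst a) ^ 2 * (Rsqr (sin (snd a)) + Rsqr (cos (snd a)))) by (unfold Rsqr; ring).
  rewrite sin2_cos2, Rmult_1_r. apply sqrt_pow2. left; apply exp_pos.
Qed.

Lemma cexp_neq_0 (a : CC) : cexp a <> 0%C.
Proof. apply Cmod_gt_0. rewrite Cmod_cexp. apply exp_pos. Qed.

Lemma cexp_opp (a : CC) : cexp (- a) = (/ cexp a)%C.
Proof.
  assert (E : (cexp (- a) * cexp a)%C = 1%C).
  { rewrite <- cexp_plus. replace (- a + a)%C with (RtoC 0) by ring. apply cexp_0. }
  rewrite <- (Cmult_1_l (/ cexp a)), <- E. field. apply cexp_neq_0.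
Qed.

Lemma cexp_minus (a b : CC) : cexp (a - b) = (cexp a / cexp b)%C.
Proof. unfold Cminus. now rewrite cexp_plus, cexp_opp. Qed.

Lemma cexp_R (x : R) : cexp x = RtoC (exp x).
Proof. apply C_eq; simpl; [rewrite cos_0|rewrite sin_0]; ring. Qed.

Lemma cexp_pow (a : CC) n : (cexp a ^ n)%C = cexp (INR n * a).
Proof.
  induction n.
  - simpl. replace (0 * a)%C with (RtoC 0) by ring. now rewrite cexp_0.
  - rewrite S_INR, RtoC_plus. simpl Cpow. rewrite IHn, <- cexp_plus. f_equal. ring.
Qed.

Lemma fst_RC_mult (x : R) (z : CC) : fst (x * z)%C = x * fst z.
Proof. simpl; ring. Qed.

Lemma Cder_line (h : CC) t : Cder (fun t => (t * h)%C) t h.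
Proof.
  eapply Cder_eq. apply Cder_mult; [apply Cder_R; apply @is_derive_id|apply Cder_const].
  unfold one; simpl. bring.
Qed.

Lemma exp_1_le_3 : exp 1 <= 3.
Proof. apply exp_le_3. Qed.

Lemma cexp_bound (h : CC) t : Cmod h <= 1 -> 0 <= t <= 1 -> Cmod (cexp (t * h)) <= 3.
Proof.
  intros H Ht. rewrite Cmod_cexp, fst_RC_mult. apply Rle_trans with (2 := exp_1_le_3).
  generalize (Cmod_fst_le h) (Rle_abs (fst h)). intros A B.
  destruct (Rle_lt_or_eq_dec (t * fst h) 1) as [E|E].
  - nra.
  - left; now apply exp_increasing.
  - rewrite E; lra.
Qed.

Lemma is_derive_pow_const (c : R) (n : nat) t :
  is_derive (fun t => c * t ^ S n) t (INR (S n) * c * t ^ n).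
Proof.
  auto_derive; auto. change (match n with O => 1 | S _ => INR n + 1 end) with (INR (S n)). ring.
Qed.

(** The first of three Taylor remainders along the segment from 0 to h. Each has h times the
    previous one as its derivative in t, so [Cmvt] passes from one to the next; the constants are
    3/n!, where 3 bounds exp 1. *)
Lemma cexp_taylor0 (h : CC) t : Cmod h <= 1 -> 0 <= t <= 1 -> Cmod (cexp (t * h) - 1) <= 3 * Cmod h * t.
Proof.
  intros H Ht.
  generalize (Cmvt (fun t => cexp (t * h) - 1)%C (fun t => h * cexp (t * h))%C
     (fun t => 3 * Cmod h * t ^ 1) (fun t => INR 1 * (3 * Cmod h) * t ^ 0) 0 t (proj1 Ht)).
  intros K. assert (E : (cexp (0 * h) = 1)%C) by (rewrite Cmult_0_l; apply cexp_0).
  rewrite E in K.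
  replace (cexp (t * h) - 1 - (1 - 1))%C with (cexp (t * h) - 1)%C in K by ring.
  eapply Rle_trans; [apply K|simpl; lra].
  - intros u Hu. eapply Cder_eq. apply Cder_minus. apply Cder_cexp, Cder_line. apply Cder_const. bring.
  - intros u Hu. apply is_derive_pow_const.
  - intros u Hu. rewrite Cmod_mult. simpl.
    generalize (cexp_bound h u H ltac:(lra)) (Cmod_ge_0 h). nra.
Qed.

Lemma cexp_taylor1 (h : CC) t : Cmod h <= 1 -> 0 <= t <= 1 ->
  Cmod (cexp (t * h) - 1 - t * h) <= 3/2 * Cmod h ^ 2 * t ^ 2.
Proof.
  intros H Ht.
  generalize (Cmvt (fun t => cexp (t * h) - 1 - t * h)%C (fun t => h * (cexp (t * h) - 1))%C
     (fun t => 3/2 * Cmod h ^ 2 * t ^ 2) (fun t => INR 2 * (3/2 * Cmod h ^ 2) * t ^ 1) 0 t (proj1 Ht)).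
  intros K. assert (E : (cexp (0 * h) = 1)%C) by (rewrite Cmult_0_l; apply cexp_0).
  rewrite E in K.
  replace (cexp (t * h) - 1 - t * h - (1 - 1 - 0 * h))%C with (cexp (t * h) - 1 - t * h)%C in K by ring.
  eapply Rle_trans; [apply K|simpl; lra].
  - intros u Hu. eapply Cder_eq. apply Cder_minus. apply Cder_minus. apply Cder_cexp, Cder_line. apply Cder_const.
    apply Cder_line. bring.
  - intros u Hu. apply is_derive_pow_const.
  - intros u Hu. rewrite Cmod_mult. simpl.
    generalize (cexp_taylor0 h u H ltac:(lra)) (Cmod_ge_0 h). nra.
Qed.

Lemma cexp_taylor2 (h : CC) t : Cmod h <= 1 -> 0 <= t <= 1 ->
  Cmod (cexp (t * h) - 1 - t * h - (t * h) * (t * h) / 2) <= 1/2 * Cmod h ^ 3 * t ^ 3.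
Proof.
  intros H Ht.
  generalize (Cmvt (fun t => cexp (t * h) - 1 - t * h - (1/2) * ((t * h) * (t * h)))%C (fun t => h * (cexp (t * h) - 1 - t * h))%C
     (fun t => 1/2 * Cmod h ^ 3 * t ^ 3) (fun t => INR 3 * (1/2 * Cmod h ^ 3) * t ^ 2) 0 t (proj1 Ht)).
  intros K. assert (E : (cexp (0 * h) = 1)%C) by (rewrite Cmult_0_l; apply cexp_0).
  rewrite E in K.
  replace (cexp (t * h) - 1 - t * h - (1 / 2) * (t * h * (t * h)) - (1 - 1 - 0 * h - 1 / 2 * (0 * h * (0 * h))))%C
   with (cexp (t * h) - 1 - t * h - t * h * (t * h) / 2)%C in K by (field; intros E2; injection E2; lra).
  eapply Rle_trans; [apply K|simpl; lra].
  - intros u Hu. eapply Cder_eq. apply Cder_minus. apply Cder_minus. apply Cder_minus. apply Cder_cexp, Cder_line. apply Cder_const.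
    apply Cder_line. apply Cder_scal. apply Cder_mult; apply Cder_line. eqbeta; field.
  - intros u Hu. apply is_derive_pow_const.
  - intros u Hu. rewrite Cmod_mult.
    generalize (cexp_taylor1 h u H ltac:(lra)) (Cmod_ge_0 h). simpl. nra.
Qed.

Lemma cexp_sub1 (h : CC) : Cmod h <= 1 -> Cmod (cexp h - 1) <= 3 * Cmod h.
Proof.
  intros H. generalize (cexp_taylor0 h 1 H ltac:(lra)). now rewrite Cmult_1_l, Rmult_1_r.
Qed.

Lemma cexp_sub1h (h : CC) : Cmod h <= 1 -> Cmod (cexp h - 1 - h) <= 3/2 * Cmod h ^ 2.
Proof.
  intros H. generalize (cexp_taylor1 h 1 H ltac:(lra)). now rewrite Cmult_1_l, pow1, Rmult_1_r.
Qed.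

Lemma cexp_sub2 (h : CC) : Cmod h <= 1 -> Cmod (cexp h - 1 - h - h * h / 2) <= 1/2 * Cmod h ^ 3.
Proof.
  intros H. generalize (cexp_taylor2 h 1 H ltac:(lra)). now rewrite !Cmult_1_l, pow1, Rmult_1_r.
Qed.

(** * Holomorphic functions *)

Definition isder (f : CC -> CC) (z l : CC) : Prop :=
  exists r K : R, 0 < r /\ forall h : CC, Cmod h < r -> Cmod (f (z + h)%C - f z - h * l) <= K * Cmod h ^ 2.

(** Choosing the derivative makes it a total operation, so that sequences of functions need not
    carry their derivatives as data; by [isder_unique] the choice is forced wherever a derivative
    exists. *)
Definition cderiv (f : CC -> CC) (z : CC) : CC := epsilon (inhabits (RtoC 0)) (isder f z).

(** If the two values were at distance d > 0, a real step t would give t d <= (K + K') t^2, which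
    fails as soon as t < d / [K2]. *)
Lemma isder_unique f z (l m : CC) : isder f z l -> isder f z m -> l = m.
Proof.
  intros [r [K [Hr H]]] [r' [K' [Hr' H']]].
  destruct (Ceq_dec (l - m) 0) as [E|E].
  { replace l with (l - m + m)%C by ring. rewrite E. ring. }
  exfalso. apply Cmod_gt_0 in E. set (d := Cmod (l - m)) in *.
  set (K2 := Rabs K + Rabs K' + 1).
  assert (HK2 : 0 < K2) by (unfold K2; generalize (Rabs_pos K) (Rabs_pos K'); lra).
  set (t := Rmin (Rmin r r') (d / K2) / 2).
  assert (Ht : 0 < t).
  { unfold t. apply Rdiv_lt_0_compat; [|lra]. repeat apply Rmin_glb_lt; auto. now apply Rdiv_lt_0_compat. }
  assert (A1 : t < Rmin (Rmin r r') (d / K2)) by (unfold t in *; lra).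
  assert (A2 := Rlt_le_trans _ _ _ A1 (Rmin_l _ _)). assert (A3 := Rlt_le_trans _ _ _ A1 (Rmin_r _ _)).
  assert (A4 := Rlt_le_trans _ _ _ A2 (Rmin_l _ _)). assert (A5 := Rlt_le_trans _ _ _ A2 (Rmin_r _ _)).
  assert (Hm : Cmod t = t) by (rewrite Cmod_R, Rabs_pos_eq; lra).
  specialize (H t). specialize (H' t). rewrite Hm in H, H'. specialize (H A4). specialize (H' A5).
  assert (T : t * d <= (K + K') * t ^ 2).
  { unfold d. rewrite <- Hm at 1. rewrite <- Cmod_mult.
    replace (t * (l - m))%C with ((f (z + t)%C - f z - t * m) - (f (z + t)%C - f z - t * l))%C by ring.
    generalize (Cmod_triangle_minus (f (z + t)%C - f z - t * m) (f (z + t)%C - f z - t * l)). lra. }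
  assert (d <= K2 * t).
  { generalize (Rle_abs K) (Rle_abs K'). intros. apply Rmult_le_reg_l with t; auto. unfold K2. simpl in T. nra. }
  assert (t * K2 < d). { apply Rmult_lt_compat_r with (r := K2) in A3; auto. unfold Rdiv in A3. rewrite Rmult_assoc, Rinv_l in A3 by lra. lra. }
  lra.
Qed.

Lemma isder_cderiv f z l : isder f z l -> cderiv f z = l.
Proof.
  intros H. apply isder_unique with f z; auto. unfold cderiv. apply epsilon_spec. eauto.
Qed.

Definition quadr (f f' : CC -> CC) (a : CC) (r K : R) : Prop :=
  forall z h : CC, Cmod (z - a) < r -> Cmod (z + h - a) < r ->
  Cmod (f (z + h)%C - f z - h * f' z) <= K * Cmod h ^ 2.

(* A locally uniform quadratic remainder, rather than an o(h) one, is what survives bounded pointwise limits. *)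
Definition hol (f : CC -> CC) (a : CC) : Prop :=
  exists f' r K, 0 < r /\ 0 <= K /\ quadr f f' a r K.

Lemma quadr_isder f f' a r K z : quadr f f' a r K -> Cmod (z - a) < r -> isder f z (f' z).
Proof.
  intros H Hz. exists (r - Cmod (z - a)), K. split. lra. intros h Hh. apply H; auto.
  replace (z + h - a)%C with (z - a + h)%C by ring. generalize (Cmod_triangle (z - a) h). lra.
Qed.

Lemma hol_cderiv f a : hol f a -> exists r K, 0 < r /\ 0 <= K /\ quadr f (cderiv f) a r K.
Proof.
  intros [f' [r [K [Hr [HK H]]]]]. exists r, K. repeat split; auto.
  intros z h Hz Hh. rewrite (isder_cderiv f z (f' z)). apply H; auto. eapply quadr_isder; eauto.
Qed.

Lemma hol_holo_at f a : hol f a -> holo_at f a.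
Proof.
  intros [f' [r [K [Hr [HK H]]]]]. exists (f' a). intros e He.
  exists (Rmin r (e / (K + 1))). split.
  - apply Rmin_glb_lt; auto. apply Rdiv_lt_0_compat; lra.
  - intros h Hh0 Hh.
    assert (A1 := Rlt_le_trans _ _ _ Hh (Rmin_l _ _)). assert (A2 := Rlt_le_trans _ _ _ Hh (Rmin_r _ _)).
    replace (_ - _)%C with ((f (a + h)%C - f a - h * f' a) / h)%C by (field; auto).
    rewrite Cmod_div by auto. assert (Hp : 0 < Cmod h) by now apply Cmod_gt_0.
    assert (Q : Cmod (f (a + h)%C - f a - h * f' a) <= K * Cmod h ^ 2).
    { apply H. replace (a - a)%C with (RtoC 0) by ring. rewrite Cmod_0; auto.
      replace (a + h - a)%C with h by ring. auto. }
    apply Rmult_lt_reg_r with (Cmod h); auto. unfold Rdiv. rewrite Rmult_assoc, Rinv_l by lra.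
    apply Rmult_lt_compat_r with (r := K + 1) in A2; [|lra]. unfold Rdiv in A2. rewrite Rmult_assoc, Rinv_l in A2 by lra.
    simpl in Q. nra.
Qed.

Lemma quadr_shrink f f' a r K r2 K2 : quadr f f' a r K -> r2 <= r -> K <= K2 -> quadr f f' a r2 K2.
Proof.
  intros H Hr HK z h Hz Hh. eapply Rle_trans. apply H; lra.
  apply Rmult_le_compat_r; auto. apply pow2_ge_0.
Qed.

Lemma hol_ext_loc f g a : (exists r, 0 < r /\ forall z, Cmod (z - a) < r -> f z = g z) -> hol f a -> hol g a.
Proof.
  intros [r0 [Hr0 E]] [f' [r [K [Hr [HK H]]]]]. exists f', (Rmin r0 r), K.
  split; [now apply Rmin_glb_lt|split; auto]. intros z h Hz Hh.
  assert (A := Rlt_le_trans _ _ _ Hz (Rmin_l _ _)). assert (A' := Rlt_le_trans _ _ _ Hz (Rmin_r _ _)).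
  assert (B := Rlt_le_trans _ _ _ Hh (Rmin_l _ _)). assert (B' := Rlt_le_trans _ _ _ Hh (Rmin_r _ _)).
  rewrite <- !E by auto. auto.
Qed.

Lemma hol_ext f g a : (forall z, f z = g z) -> hol f a -> hol g a.
Proof. intros E. apply hol_ext_loc. exists 1; split; auto; lra. Qed.

Lemma hol_const c a : hol (fun _ => c) a.
Proof.
  exists (fun _ => RtoC 0), 1, 0. split; [lra|split; [lra|]]. intros z h _ _.
  replace (_ - _)%C with (RtoC 0) by ring. rewrite Cmod_0. lra.
Qed.

Lemma hol_id a : hol (fun z => z) a.
Proof.
  exists (fun _ => RtoC 1), 1, 0. split; [lra|split; [lra|]]. intros z h _ _.
  replace (_ - _)%C with (RtoC 0) by ring. rewrite Cmod_0. lra.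
Qed.

Lemma hol_plus f g a : hol f a -> hol g a -> hol (fun z => f z + g z)%C a.
Proof.
  intros [f' [r [K [Hr [HK H]]]]] [g' [r2 [K2 [Hr2 [HK2 H2]]]]].
  exists (fun z => f' z + g' z)%C, (Rmin r r2), (K + K2).
  split; [now apply Rmin_glb_lt|split; [lra|]]. intros z h Hz Hh.
  assert (A := Rlt_le_trans _ _ _ Hz (Rmin_l _ _)). assert (A' := Rlt_le_trans _ _ _ Hz (Rmin_r _ _)).
  assert (B := Rlt_le_trans _ _ _ Hh (Rmin_l _ _)). assert (B' := Rlt_le_trans _ _ _ Hh (Rmin_r _ _)).
  specialize (H z h A B). specialize (H2 z h A' B').
  replace (_ - _)%C with ((f (z + h)%C - f z - h * f' z) + (g (z + h)%C - g z - h * g' z))%C by ring.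
  eapply Rle_trans; [apply Cmod_triangle|]. lra.
Qed.

(** Everything that products and compositions need, with one radius and one constant. The remainder
    at the centre bounds [f]; solving the remainder inequality at the step r/2 for the derivative
    bounds [cderiv f], at the price of half the radius; both together give the Lipschitz bound. *)
Lemma hol_bounds f a : hol f a -> exists r K, 0 < r /\ 0 <= K /\ quadr f (cderiv f) a r K /\
  (forall z, Cmod (z - a) < r -> Cmod (f z) <= K /\ Cmod (cderiv f z) <= K) /\
  (forall z h, Cmod (z - a) < r -> Cmod (z + h - a) < r -> Cmod (f (z + h)%C - f z) <= K * Cmod h).
Proof.
  intros Hf. destruct (hol_cderiv f a Hf) as [r [K [Hr [HK H]]]].
  set (M := Cmod (f a) + r * Cmod (cderiv f a) + K * r ^ 2).
  assert (HM : forall z, Cmod (z - a) < r -> Cmod (f z) <= M).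
  { intros z Hz. generalize (H a (z - a)%C). replace (a - a)%C with (RtoC 0) by ring.
    rewrite Cmod_0. replace (a + (z - a))%C with z by ring. intros Q. specialize (Q Hr Hz).
    replace (f z) with ((f z - f a - (z - a) * cderiv f a) + (f a + (z - a) * cderiv f a))%C by ring.
    eapply Rle_trans; [apply Cmod_triangle|].
    generalize (Cmod_triangle (f a) ((z - a) * cderiv f a)). rewrite Cmod_mult.
    unfold M. generalize (Cmod_ge_0 (z - a)) (Cmod_ge_0 (cderiv f a)). intros A B C.
    assert (Cmod (z - a) * Cmod (cderiv f a) <= r * Cmod (cderiv f a)) by nra.
    assert (Cmod (z - a) ^ 2 <= r ^ 2) by (apply pow_incr; lra). nra. }
  assert (HM0 : 0 <= M).
  { apply Rle_trans with (Cmod (f a)). apply Cmod_ge_0. apply HM.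
    replace (a - a)%C with (RtoC 0) by ring. now rewrite Cmod_0. }
  set (B := 2 * (2 * M + K * r ^ 2) / r).
  assert (HB : forall z, Cmod (z - a) < r / 2 -> Cmod (cderiv f z) <= B).
  { intros z Hz. set (h := RtoC (r / 2)).
    assert (Eh : Cmod h = r / 2) by (unfold h; rewrite Cmod_R, Rabs_pos_eq; lra).
    assert (Hzh : Cmod (z + h - a) < r).
    { replace (z + h - a)%C with (z - a + h)%C by ring. generalize (Cmod_triangle (z - a) h). lra. }
    generalize (H z h ltac:(lra) Hzh) (HM z ltac:(lra)) (HM (z + h)%C Hzh). rewrite Eh. intros Q M1 M2.
    assert (T : r / 2 * Cmod (cderiv f z) <= 2 * M + K * r ^ 2).
    { rewrite <- Eh, <- Cmod_mult.
      replace (h * cderiv f z)%C with (f (z + h)%C - f z - (f (z + h)%C - f z - h * cderiv f z))%C by ring.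
      generalize (Cmod_triangle_minus (f (z + h)%C - f z) (f (z + h)%C - f z - h * cderiv f z)).
      generalize (Cmod_triangle_minus (f (z + h)%C) (f z)). 
      assert (K * (r / 2) ^ 2 <= K * r ^ 2) by (apply Rmult_le_compat_l; auto; apply pow_incr; lra). lra. }
    unfold B. apply Rmult_le_reg_l with (r / 2); [lra|]. replace (r / 2 * (2 * (2 * M + K * r ^ 2) / r)) with (2 * M + K * r ^ 2) by (field; lra). exact T. }
  assert (HB0 : 0 <= B).
  { apply Rle_trans with (Cmod (cderiv f a)). apply Cmod_ge_0. apply HB.
    replace (a - a)%C with (RtoC 0) by ring. rewrite Cmod_0; lra. }
  exists (r / 2), (M + B + K + K * r). assert (0 <= K * r) by nra.
  split; [lra|split; [lra|split; [|split]]].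
  - eapply quadr_shrink; eauto; lra.
  - intros z Hz. generalize (HM z ltac:(lra)) (HB z Hz). lra.
  - intros z h Hz Hh. generalize (H z h ltac:(lra) ltac:(lra)) (HB z Hz). intros Q D.
    replace (f (z + h)%C - f z)%C with ((f (z + h)%C - f z - h * cderiv f z) + h * cderiv f z)%C by ring.
    eapply Rle_trans; [apply Cmod_triangle|]. rewrite Cmod_mult.
    assert (Cmod h <= r).
    { replace h with ((z + h - a) - (z - a))%C by ring. generalize (Cmod_triangle_minus (z + h - a) (z - a)). lra. }
    generalize (Cmod_ge_0 h). intros P0.
    assert (K * Cmod h ^ 2 <= K * r * Cmod h) by (simpl; rewrite Rmult_1_r, <- Rmult_assoc; apply Rmult_le_compat_r; auto; nra).
    assert (Cmod h * Cmod (cderiv f z) <= B * Cmod h) by nra.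
    nra.
Qed.

Lemma hol_mult f g a : hol f a -> hol g a -> hol (fun z => f z * g z)%C a.
Proof.
  intros Hf Hg.
  destruct (hol_bounds f a Hf) as [r [K [Hr [HK [H [HM HL]]]]]].
  destruct (hol_bounds g a Hg) as [r2 [K2 [Hr2 [HK2 [H2 [HM2 HL2]]]]]].
  exists (fun z => cderiv f z * g z + f z * cderiv g z)%C, (Rmin r r2), (3 * K * K2).
  split; [now apply Rmin_glb_lt|split; [nra|]]. intros z h Hz Hh.
  assert (A := Rlt_le_trans _ _ _ Hz (Rmin_l _ _)). assert (A' := Rlt_le_trans _ _ _ Hz (Rmin_r _ _)).
  assert (B := Rlt_le_trans _ _ _ Hh (Rmin_l _ _)). assert (B' := Rlt_le_trans _ _ _ Hh (Rmin_r _ _)).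
  specialize (H z h A B). specialize (H2 z h A' B').
  destruct (HM (z + h)%C B) as [M1 _]. destruct (HM2 z A') as [M2 M3]. specialize (HL z h A B).
  replace (_ - _)%C with (f (z + h)%C * (g (z + h)%C - g z - h * cderiv g z) + (f (z + h)%C - f z) * (h * cderiv g z)
     + g z * (f (z + h)%C - f z - h * cderiv f z))%C by ring.
  eapply Rle_trans; [apply Cmod_triangle|]. eapply Rle_trans; [apply Rplus_le_compat_r, Cmod_triangle|].
  rewrite !Cmod_mult. generalize (Cmod_ge_0 h). intros P0.
  assert (Cmod (f (z + h)%C) * Cmod (g (z + h)%C - g z - h * cderiv g z) <= K * (K2 * Cmod h ^ 2))
   by (apply Rmult_le_compat; auto using Cmod_ge_0).
  assert (Cmod (f (z + h)%C - f z) * (Cmod h * Cmod (cderiv g z)) <= (K * Cmod h) * (Cmod h * K2)).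
  { apply Rmult_le_compat; auto using Cmod_ge_0. apply Rmult_le_pos; apply Cmod_ge_0. apply Rmult_le_compat_l; auto. }
  assert (Cmod (g z) * Cmod (f (z + h)%C - f z - h * cderiv f z) <= K2 * (K * Cmod h ^ 2))
   by (apply Rmult_le_compat; auto using Cmod_ge_0).
  simpl in *. lra.
Qed.

Lemma hol_comp f g a : hol g a -> hol f (g a) -> hol (fun z => f (g z)) a.
Proof.
  intros Hg Hf.
  destruct (hol_bounds f (g a) Hf) as [r [K [Hr [HK [H [HM HL]]]]]].
  destruct (hol_bounds g a Hg) as [r2 [K2 [Hr2 [HK2 [H2 [HM2 HL2]]]]]].
  set (r3 := Rmin r2 (r / (K2 + 1))).
  assert (H3 : 0 < r3) by (apply Rmin_glb_lt; auto; apply Rdiv_lt_0_compat; lra).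
  assert (G : forall z, Cmod (z - a) < r3 -> Cmod (z - a) < r2 /\ Cmod (g z - g a) < r).
  { intros z Hz. assert (A := Rlt_le_trans _ _ _ Hz (Rmin_l _ _)). split; auto.
    assert (A' := Rlt_le_trans _ _ _ Hz (Rmin_r _ _)).
    generalize (HL2 a (z - a)%C). replace (a - a)%C with (RtoC 0) by ring. rewrite Cmod_0.
    replace (a + (z - a))%C with z by ring. intros Q. specialize (Q Hr2 A).
    apply Rmult_lt_compat_r with (r := K2 + 1) in A'; [|lra]. unfold Rdiv in A'. rewrite Rmult_assoc, Rinv_l in A' by lra.
    generalize (Cmod_ge_0 (z - a)). nra. }
  exists (fun z => cderiv f (g z) * cderiv g z)%C, r3, (K * K2 ^ 2 + K * K2).
  split; auto. split; [simpl; nra|]. intros z h Hz Hh.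
  destruct (G z Hz) as [Z1 Z2]. destruct (G (z + h)%C Hh) as [Z3 Z4].
  set (k := (g (z + h)%C - g z)%C).
  assert (Ek : (g (z + h)%C = g z + k)%C) by (unfold k; ring).
  specialize (H2 z h Z1 Z3). specialize (HL2 z h Z1 Z3). fold k in H2, HL2.
  rewrite Ek in Z4 |- *. specialize (H (g z) k Z2 Z4). destruct (HM (g z) Z2) as [_ M].
  replace (_ - _)%C with ((f (g z + k) - f (g z) - k * cderiv f (g z)) + cderiv f (g z) * (k - h * cderiv g z))%C by ring.
  eapply Rle_trans; [apply Cmod_triangle|]. rewrite Cmod_mult.
  assert (Cmod k ^ 2 <= (K2 * Cmod h) ^ 2) by (apply pow_incr; split; auto using Cmod_ge_0).
  assert (Cmod (cderiv f (g z)) * Cmod (k - h * cderiv g z) <= K * (K2 * Cmod h ^ 2)) by (apply Rmult_le_compat; auto using Cmod_ge_0).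
  assert (K * Cmod k ^ 2 <= K * (K2 * Cmod h) ^ 2) by (apply Rmult_le_compat_l; auto).
  rewrite Rpow_mult_distr in *. nra.
Qed.

Lemma hol_inv_id (a : CC) : a <> 0%C -> hol (fun z => / z)%C a.
Proof.
  intros Ha. assert (Hp : 0 < Cmod a) by now apply Cmod_gt_0. set (r := Cmod a / 2).
  assert (Hr : 0 < r) by (unfold r; lra).
  assert (G : forall z, Cmod (z - a) < r -> r <= Cmod z /\ z <> 0%C).
  { intros z Hz. assert (r <= Cmod z).
    { generalize (Cmod_triangle_sub a z). rewrite Cmod_minus_sym. unfold r in *. lra. }
    split; auto. apply Cmod_gt_0. lra. }
  exists (fun z => - / (z * z))%C, r, (/ r ^ 3).
  split; auto. split; [left; apply Rinv_0_lt_compat, pow_lt; auto|].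
  intros z h Hz Hh. destruct (G z Hz) as [A1 A2]. destruct (G _ Hh) as [B1 B2].
  replace (_ - _)%C with (h * h / (z * z * (z + h)))%C by (field; auto).
  rewrite Cmod_div by (repeat apply Cmult_neq_0; auto). rewrite !Cmod_mult.
  replace (/ r ^ 3 * Cmod h ^ 2) with (Cmod h * Cmod h * / (r * r * r)) by (field; lra).
  apply Rmult_le_compat_l. apply Rmult_le_pos; apply Cmod_ge_0.
  apply Rinv_le_contravar. apply Rmult_lt_0_compat; [apply Rmult_lt_0_compat|]; auto.
  repeat apply Rmult_le_compat; try apply Rmult_le_pos; lra.
Qed.

Lemma hol_inv f a : hol f a -> f a <> 0%C -> hol (fun z => / f z)%C a.
Proof. intros Hf H0. apply (hol_comp (fun z => / z)%C f); auto using hol_inv_id. Qed.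

Lemma hol_opp f a : hol f a -> hol (fun z => - f z)%C a.
Proof.
  intros H. apply hol_ext with (fun z => (-(1)) * f z)%C. intros; ring.
  apply hol_mult; auto using hol_const.
Qed.

Lemma hol_minus f g a : hol f a -> hol g a -> hol (fun z => f z - g z)%C a.
Proof. intros; apply hol_plus; auto using hol_opp. Qed.

Lemma hol_div f g a : hol f a -> hol g a -> g a <> 0%C -> hol (fun z => f z / g z)%C a.
Proof. intros; apply hol_mult; auto using hol_inv. Qed.

Lemma hol_cexp_id a : hol cexp a.
Proof.
  exists cexp, (1/2), (exp (fst a + 1) * (3/2)). assert (E0 := exp_pos (fst a + 1)).
  split; [lra|split; [nra|]]. intros z h Hz Hh.
  assert (Hh1 : Cmod h <= 1).
  { replace h with ((z + h - a) - (z - a))%C by ring. generalize (Cmod_triangle_minus (z + h - a) (z - a)). lra. }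
  rewrite cexp_plus. replace (_ - _)%C with (cexp z * (cexp h - 1 - h))%C by ring.
  rewrite Cmod_mult, Cmod_cexp, Rmult_assoc. apply Rmult_le_compat; auto using Cmod_ge_0, cexp_sub1h.
  - left; apply exp_pos.
  - left. apply exp_increasing. generalize (Cmod_fst_le (z - a)) (Rle_abs (fst (z - a)%C)). simpl. lra.
Qed.

Lemma hol_cexp f a : hol f a -> hol (fun z => cexp (f z)) a.
Proof. intros. apply (hol_comp cexp f); auto using hol_cexp_id. Qed.

Lemma hol_csum (F : nat -> CC -> CC) n a : (forall k, (k < n)%nat -> hol (F k) a) -> hol (fun z => csum (fun k => F k z) n) a.
Proof.
  induction n; intros H; simpl. apply hol_const. apply hol_plus; auto.
Qed.

Lemma hol_pow f n a : hol f a -> hol (fun z => f z ^ n)%C a.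
Proof. induction n; intros; simpl. apply hol_const. apply hol_mult; auto. Qed.

(** The number [d] is both the admissible step and, through [/ d], the constant of the remainder, so
    that compactness has a single quantity to bound from below. *)
Definition unif_quadr (f : CC -> CC) (z : CC) (r d : R) : Prop :=
  forall p k : CC, Cmod (p - z) <= r -> Cmod k < d ->
  Cmod (f (p + k)%C - f p - k * cderiv f p) <= / d * Cmod k ^ 2.

Lemma hol_rho f c : hol f c -> exists rho : posreal, forall p k : CC,
  Cmod (p - c) < 2 * rho -> Cmod k < rho -> Cmod (f (p + k)%C - f p - k * cderiv f p) <= / rho * Cmod k ^ 2.
Proof.
  intros Hf. destruct (hol_cderiv f c Hf) as [r [K [Hr [HK H]]]].
  assert (Hp : 0 < Rmin (r / 3) (/ (K + 1))) by (apply Rmin_glb_lt; [lra|apply Rinv_0_lt_compat; lra]).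
  assert (B1 := Rmin_l (r / 3) (/ (K + 1))). assert (B2 := Rmin_r (r / 3) (/ (K + 1))).
  exists (mkposreal _ Hp). simpl pos. set (rho := Rmin _ _) in *. intros p k H1 H2.
  eapply Rle_trans; [apply H|].
  - lra.
  - replace (p + k - c)%C with (p - c + k)%C by ring. generalize (Cmod_triangle (p - c) k). lra.
  - apply Rmult_le_compat_r. apply pow2_ge_0. apply Rle_trans with (K + 1); [lra|].
    rewrite <- (Rinv_inv (K + 1)). apply Rinv_le_contravar; auto.
Qed.

Lemma Cmod_pair_le (x y u v e : R) : Rabs (x - u) < e -> Rabs (y - v) < e -> Cmod ((x, y) - (u, v)) < 2 * e.
Proof.
  intros A B. eapply Rle_lt_trans; [apply Cmod_le_abs|]. simpl. unfold Rminus in *. lra.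
Qed.

(** Compactness of a rectangle for gauges, applied to the square circumscribed about the disc. Its
    points are within 2r of [z], the sum of the two coordinates, which is why [P] is assumed on a
    disc of twice the radius. The library statement is doubly negated, whence [NNPP]. *)
Lemma disc_compact (P : CC -> posreal -> Prop) z r : 0 < r ->
  (forall w, Cmod (w - z) <= 2 * r -> exists rho, P w rho) ->
  exists d, 0 < d /\ forall p, Cmod (p - z) <= r -> exists c rho, P c rho /\ Cmod (p - c) < 2 * rho /\ d <= rho.
Proof.
  intros Hr H.
  set (delta := fun u v => epsilon (inhabits (mkposreal 1 Rlt_0_1)) (P (u, v))).
  destruct (compactness_value_2d (fst z - r) (fst z + r) (snd z - r) (snd z + r) delta) as [d Hd].
  exists d. split. apply cond_pos. intros p Hp.
  assert (A1 := Rle_trans _ _ _ (Cmod_fst_le (p - z)) Hp). assert (A2 := Rle_trans _ _ _ (Cmod_snd_le (p - z)) Hp).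
  simpl in A1, A2. apply Rabs_le_between in A1, A2.
  apply NNPP; intros Hn. apply (Hd (fst p) (snd p)); [lra|lra|]. intros [u [v [Hu [Hv [H1 [H2 H3]]]]]].
  apply Hn. exists (u, v), (delta u v). split; [|split; auto].
  - apply epsilon_spec, H.
    assert (B1 : Rabs (u - fst z) <= r) by (apply Rabs_le; lra).
    assert (B2 : Rabs (v - snd z) <= r) by (apply Rabs_le; lra).
    generalize (Cmod_le_abs ((u, v) - z)%C). simpl. unfold Rminus in *. lra.
  - destruct p. now apply Cmod_pair_le.
Qed.

Lemma hol_uniform f z r : 0 < r -> (forall w, Cmod (w - z) <= 2 * r -> hol f w) ->
  exists d, 0 < d /\ unif_quadr f z r d.
Proof.
  intros Hr H. destruct (disc_compact _ z r Hr (fun w Hw => hol_rho f w (H w Hw))) as [d [Hd Hc]].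
  exists d; split; auto. intros p k Hp Hk. destruct (Hc p Hp) as [c [rho [Q [H1 H2]]]].
  eapply Rle_trans. apply Q; lra. apply Rmult_le_compat_r. apply pow2_ge_0. now apply Rinv_le_contravar.
Qed.

Lemma hol_bounded_disc f z r : 0 < r -> (forall w, Cmod (w - z) <= 2 * r -> hol f w) ->
  exists M, forall w, Cmod (w - z) <= r -> Cmod (f w) <= M.
Proof.
  intros Hr H.
  destruct (disc_compact (fun c rho => forall p, Cmod (p - c) < 2 * rho -> Cmod (f p) <= / rho) z r Hr) as [d [Hd Hc]].
  - intros w Hw. destruct (hol_bounds f w (H w Hw)) as [r0 [K [Hr0 [HK [_ [HM _]]]]]].
    assert (Hp : 0 < Rmin (r0 / 3) (/ (K + 1))) by (apply Rmin_glb_lt; [lra|apply Rinv_0_lt_compat; lra]).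
    exists (mkposreal _ Hp). simpl pos. intros p Hpw.
    assert (B1 := Rmin_l (r0 / 3) (/ (K + 1))). assert (B2 := Rmin_r (r0 / 3) (/ (K + 1))).
    set (rho := Rmin _ _) in *. destruct (HM p) as [B3 _]. lra. apply Rle_trans with (K + 1); [lra|].
    rewrite <- (Rinv_inv (K + 1)). apply Rinv_le_contravar; auto.
  - exists (/ d). intros w Hw. destruct (Hc w Hw) as [c [rho [Q [H1 H2]]]].
    eapply Rle_trans. apply Q; auto. now apply Rinv_le_contravar.
Qed.

(** * Roots of unity and the discrete Cauchy formula *)

Definition im (x : R) : CC := (0, x).

Lemma im_scale (a x : R) : im (a * x) = (a * im x)%C.
Proof. apply C_eq; simpl; ring. Qed.

Lemma im_pow (x : R) n : (cexp (im x) ^ n)%C = cexp (im (INR n * x)).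
Proof. now rewrite cexp_pow, im_scale. Qed.

Lemma cexp_2PI : cexp (im (2 * PI)) = 1%C.
Proof. apply C_eq; simpl; rewrite exp_0; [rewrite cos_2PI|rewrite sin_2PI]; ring. Qed.

Lemma cexp_2PI_nat n : cexp (im (INR n * (2 * PI))) = 1%C.
Proof. rewrite <- im_pow, cexp_2PI. apply Cpow_1_l. Qed.

Lemma Cmod_im x : Cmod (im x) = Rabs x.
Proof.
  unfold Cmod, im; cbn [fst snd]. replace (0 ^ 2 + x ^ 2) with (Rsqr x) by (unfold Rsqr; ring). apply sqrt_Rsqr_abs.
Qed.

Definition rt (N k : nat) : CC := cexp (im (2 * PI * INR k / INR N)).

Lemma Cmod_rt N k : Cmod (rt N k) = 1.
Proof. unfold rt. rewrite Cmod_cexp. apply exp_0. Qed.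

Lemma rt_neq_0 N k : rt N k <> 0%C.
Proof. apply cexp_neq_0. Qed.

Lemma rt_S N k : (0 < N)%nat -> rt N (S k) = (rt N k * rt N 1)%C.
Proof.
  intros HN. unfold rt. rewrite <- cexp_plus. f_equal. assert (INR N <> 0) by (apply not_0_INR; lia).
  unfold im. apply C_eq; cbn [fst snd Cplus]. ring. rewrite S_INR. simpl INR. field; auto.
Qed.

Lemma rt_0 N : rt N 0 = 1%C.
Proof.
  unfold rt. rewrite <- cexp_0. f_equal. unfold im. apply C_eq; cbn [fst snd]; auto. simpl. unfold Rdiv. ring.
Qed.

Lemma rt_N N : (0 < N)%nat -> rt N N = 1%C.
Proof.
  intros HN. unfold rt. assert (INR N <> 0) by (apply not_0_INR; lia).
  replace (2 * PI * INR N / INR N) with (2 * PI) by (field; auto).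
  apply C_eq; simpl; rewrite exp_0; [rewrite cos_2PI|rewrite sin_2PI]; ring.
Qed.

(** From N = 7 on the angle 2 pi / N is at most 1, the range of [cexp_sub1], whose constant 3 turns
    2 pi into 6 pi. *)
Lemma rt_near_1 N : (7 <= N)%nat -> Cmod (rt N 1 - 1) <= 6 * PI / INR N.
Proof.
  intros HN. assert (7 <= INR N) by (apply (le_INR 7) in HN; simpl in HN; lra).
  generalize PI_RGT_0. intros P0. unfold rt. set (x := 2 * PI * INR 1 / INR N).
  assert (Hx : x = 2 * PI / INR N) by (unfold x; simpl; field; lra).
  assert (Hx0 : 0 < x) by (rewrite Hx; apply Rdiv_lt_0_compat; lra).
  generalize (cexp_sub1 (im x)). rewrite Cmod_im, Rabs_pos_eq by lra. intros Q. eapply Rle_trans. apply Q.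
  - rewrite Hx. apply Rmult_le_reg_r with (INR N); [lra|]. unfold Rdiv. rewrite Rmult_assoc, Rinv_l by lra.
    assert (PI <= 3.5) by (assert (G := PI_ineq 1); unfold tg_alt, PI_tg in G; simpl in G; lra). lra.
  - rewrite Hx. right. field. lra.
Qed.

Lemma cos_sin_1 x : 0 < x < 2 * PI -> cexp (im x) <> 1%C.
Proof.
  intros [H1 H2] E. assert (E1 := f_equal fst E). assert (E2 := f_equal snd E). simpl in E1, E2.
  rewrite exp_0, Rmult_1_l in E1, E2.
  destruct (Rtotal_order x PI) as [H|[H|H]].
  - generalize (sin_gt_0 x H1 H). lra.
  - subst. rewrite cos_PI in E1. lra.
  - generalize (sin_lt_0 x H H2). lra.
Qed.

Lemma geom_sum (x : CC) n : ((1 - x) * csum (fun k => x ^ k) n)%C = (1 - x ^ n)%C.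
Proof. induction n; simpl. ring. rewrite Cmult_plus_distr_l, IHn. ring. Qed.

Lemma rt_as_pow N k i : INR N <> 0 -> (rt N k ^ i)%C = (cexp (im (2 * PI * INR i / INR N)) ^ k)%C.
Proof. intros HN. unfold rt. rewrite !im_pow. do 2 f_equal. field. auto. Qed.

Lemma RtoC_neq_0 (x : R) : x <> 0 -> RtoC x <> 0%C.
Proof. intros H E. injection E. auto. Qed.

(** The terms are the powers of one number x with x^N = 1, and x <> 1 because 0 < i < N; the
    geometric sum therefore vanishes. *)
Lemma rt_inv_sum N i : (0 < i < N)%nat -> csum (fun k => / (rt N k) ^ i)%C N = 0%C.
Proof.
  intros Hi. assert (HN : INR N <> 0) by (apply not_0_INR; lia).
  assert (HN0 : 0 < INR N) by (apply (lt_INR 0); lia).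
  set (w := cexp (im (2 * PI * INR i / INR N))). set (x := (/ w)%C).
  assert (Hw0 : w <> 0%C) by apply cexp_neq_0.
  rewrite (csum_ext _ (fun k => x ^ k)%C).
  - assert (Hx : x <> 1%C).
    { intros E. apply (cos_sin_1 (2 * PI * INR i / INR N)).
      - assert (0 < INR i) by (apply (lt_INR 0); lia). assert (INR i < INR N) by (apply lt_INR; lia).
        generalize PI_RGT_0; intros. split. apply Rdiv_lt_0_compat; nra.
        apply Rmult_lt_reg_r with (INR N); auto. unfold Rdiv. rewrite (Rmult_assoc (_ * _) (/ _)), Rinv_l by auto. nra.
      - fold w. replace w with (w * x / x)%C by (field; rewrite E; apply RtoC_neq_0; lra). unfold x at 1. rewrite Cinv_r, E by auto.
        field. }
    assert (E : (x ^ N = 1)%C).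
    { unfold x. rewrite Cpow_inv by auto. unfold w. rewrite im_pow.
      replace (INR N * (2 * PI * INR i / INR N)) with (INR i * (2 * PI)) by (field; auto).
      rewrite cexp_2PI_nat. field. }
    generalize (geom_sum x N). rewrite E. intros G.
    destruct (Ceq_dec (csum (fun k => x ^ k)%C N) 0) as [Z|Z]; auto.
    exfalso. apply (Cmult_neq_0 (1 - x) (csum (fun k => x ^ k)%C N)); auto.
    + intros E2. apply Hx. replace x with (1 - (1 - x))%C by ring. rewrite E2. ring.
    + rewrite G. ring.
  - intros k _. rewrite rt_as_pow by auto. fold w. unfold x. now rewrite Cpow_inv.
Qed.

Lemma Cpow_inv_mult (a b : CC) n : b <> 0%C -> ((a / b) ^ n)%C = (a ^ n * / b ^ n)%C.
Proof.
  intros Hb. induction n; simpl. field. rewrite IHn. field. split; auto. now apply Cpow_nz.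
Qed.

Lemma rt_pow_N N k : (0 < N)%nat -> (rt N k ^ N)%C = 1%C.
Proof.
  intros HN. assert (INR N <> 0) by (apply not_0_INR; lia).
  unfold rt. rewrite im_pow. replace (INR N * _) with (INR k * (2 * PI)) by (field; auto). apply cexp_2PI_nat.
Qed.

Lemma one_minus_neq_0 (x : CC) : Cmod x < 1 -> (1 - x)%C <> 0%C.
Proof.
  intros H E. assert (x = 1%C) by (replace x with (1 - (1 - x))%C by ring; rewrite E; ring).
  subst. rewrite Cmod_1 in H. lra.
Qed.

Lemma Cmod_pow_lt_1 (q : CC) n : Cmod q < 1 -> (0 < n)%nat -> Cmod (q ^ n) < 1.
Proof.
  intros H Hn. rewrite Cmod_pow. destruct n as [|n]; [lia|]. 
  apply Rle_lt_trans with (Cmod q); auto. simpl.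
  assert (Cmod q ^ n <= 1 ^ n) by (apply pow_incr; split; [apply Cmod_ge_0|lra]). rewrite pow1 in *.
  generalize (Cmod_ge_0 q). nra.
Qed.

(** Since w^N = 1 for a root w, the kernel 1/(1 - q/w) is the finite geometric sum of (q/w)^i over i
    < N, divided by 1 - q^N. Summing over the roots, [rt_inv_sum] kills all i except 0. The identity
    is used twice: for the Cauchy formula and for the partial fractions of the exponential. *)
Lemma rt_kernel_sum N (q : CC) : (0 < N)%nat -> (1 - q ^ N)%C <> 0%C ->
  csum (fun k => / (1 - q / rt N k))%C N = (INR N / (1 - q ^ N))%C.
Proof.
  intros HN HqN.
  rewrite (csum_ext _ (fun k => / (1 - q ^ N) * csum (fun i => q ^ i * / (rt N k) ^ i) N)%C).
  - rewrite csum_scal, csum_swap. rewrite (csum_ext _ (fun i => q ^ i * csum (fun k => / (rt N k) ^ i) N)%C).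
    2:{ intros; now rewrite csum_scal. }
    destruct N as [|n]; [lia|]. rewrite csum_S_l. rewrite (csum_0 _ n).
    + rewrite (csum_ext (fun k => / rt (S n) k ^ 0)%C (fun _ => RtoC 1)).
      rewrite csum_const. simpl (q ^ 0)%C. unfold Cdiv. ring. intros; simpl. field.
    + intros i Hi. rewrite rt_inv_sum by lia. ring.
  - intros k _. set (x := (q / rt N k)%C).
    rewrite (csum_ext _ (fun i => x ^ i)%C) by (intros; unfold x; rewrite Cpow_inv_mult; auto using rt_neq_0).
    assert (E : (q ^ N = x ^ N)%C).
    { unfold x. rewrite Cpow_inv_mult, rt_pow_N by auto using rt_neq_0. field. }
    rewrite E in *. generalize (geom_sum x N). intros G.
    rewrite <- G in *. assert (H1 : (1 - x)%C <> 0%C) by (intros E0; apply HqN; rewrite E0; ring).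
    assert (csum (fun k0 => x ^ k0)%C N <> 0%C) by (intros E0; apply HqN; rewrite E0; ring).
    field. auto.
Qed.

Lemma csum_telescope (g : nat -> CC) n : csum (fun k => g (S k) - g k)%C n = (g n - g O)%C.
Proof. induction n; simpl. ring. rewrite IHn. ring. Qed.

Lemma csum_bound (a : nat -> CC) n M : (forall k, (k < n)%nat -> Cmod (a k) <= M) -> Cmod (csum a n) <= INR n * M.
Proof.
  intros H. eapply Rle_trans; [apply csum_mod_le|]. rewrite <- rsum_const. now apply rsum_le.
Qed.

Lemma rt_minus_1_pos N : (2 <= N)%nat -> 0 < Cmod (rt N 1 - 1).
Proof.
  intros HN. apply Cmod_gt_0. intros E.
  assert (2 <= INR N) by (apply (le_INR 2) in HN; simpl in HN; lra).
  apply (cos_sin_1 (2 * PI * INR 1 / INR N)).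
  - generalize PI_RGT_0; intros. simpl. split. apply Rdiv_lt_0_compat; nra.
    apply Rmult_lt_reg_r with (INR N); [lra|]. unfold Rdiv. rewrite (Rmult_assoc (_ * _) (/ _)), Rinv_l by lra. nra.
  - fold (rt N 1). replace (rt N 1) with (rt N 1 - 1 + 1)%C by ring. rewrite E. ring.
Qed.

Definition path (z h : CC) (r lam : R) (w : CC) : CC := (z + h + lam * (r * w - h))%C.

Lemma path_in_disc z h r lam (w : CC) : 0 <= lam <= 1 -> 0 < r -> Cmod h < r -> Cmod w = 1 ->
  Cmod (path z h r lam w - z) <= r.
Proof.
  intros Hl Hr Hh Hw. unfold path.
  replace (z + h + lam * (r * w - h) - z)%C with ((1 - lam)%R * h + lam * (r * w))%C by (rewrite RtoC_minus; ring).
  eapply Rle_trans; [apply Cmod_triangle|]. rewrite !Cmod_mult, !Cmod_R, Hw, !Rabs_pos_eq by lra. nra.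
Qed.

(** The discrete form of the vanishing of the integral of f' over a closed curve. Consecutive
    vertices differ by lam r w_k v with v = [rt N 1 - 1], so lam v times the sum is, up to quadratic
    remainders, the sum of the increments of [f] around a closed polygon, which telescopes to 0.
    Division by lam v needs lam > 0. *)
Lemma path_mean_derivative f z h r d N lam : (2 <= N)%nat -> 0 < r -> Cmod h < r -> 0 < d ->
  unif_quadr f z r d -> r * Cmod (rt N 1 - 1) < d -> 0 < lam <= 1 ->
  Cmod (csum (fun k => cderiv f (path z h r lam (rt N k)) * (r * rt N k)) N)%C
   <= INR N * (r ^ 2 * Cmod (rt N 1 - 1) / d).
Proof.
  intros HN Hr Hh Hd Hf Hw Hl. set (v := (rt N 1 - 1)%C) in *. assert (Hv : 0 < Cmod v) by now apply rt_minus_1_pos.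
  set (P := fun k => path z h r lam (rt N k)).
  assert (HP : forall k, (P (S k) = P k + lam * r * rt N k * v)%C).
  { intros k. unfold P, path. rewrite rt_S by lia. unfold v. ring. }
  set (S0 := csum _ N).
  assert (E : (lam * v * S0)%C = csum (fun k => - (f (P (S k)) - f (P k) - (lam * r * rt N k * v) * cderiv f (P k)))%C N).
  { rewrite csum_opp, !csum_minus.
    assert (T := csum_telescope (fun k => f (P k)) N). rewrite csum_minus in T. rewrite T.
    assert (E0 : P N = P O) by (unfold P; rewrite rt_N, rt_0 by lia; auto). rewrite E0.
    unfold S0. rewrite <- csum_scal. match goal with |- _ = (- (_ - ?x))%C => replace (- (f (P O) - f (P O) - x))%C with x by ring end.
    apply csum_ext. intros k _. fold (P k). ring. }
  assert (B : Cmod (lam * v * S0) <= INR N * (/ d * (lam * r * Cmod v) ^ 2)).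
  { rewrite E. apply csum_bound. intros k _. rewrite Cmod_opp, HP.
    assert (Em : Cmod (lam * r * rt N k * v) = lam * r * Cmod v).
    { rewrite !Cmod_mult, Cmod_rt, !Cmod_R, !Rabs_pos_eq by lra. ring. }
    rewrite <- Em. apply Hf.
    - apply path_in_disc; auto. lra. apply Cmod_rt.
    - rewrite Em. apply Rle_lt_trans with (2 := Hw). assert (0 < r * Cmod v) by nra. nra. }
  rewrite !Cmod_mult, Cmod_R, Rabs_pos_eq in B by lra.
  apply Rmult_le_reg_l with (lam * Cmod v). nra.
  eapply Rle_trans; [exact B|].
  replace (lam * Cmod v * (INR N * (r ^ 2 * Cmod v / d))) with (INR N * (/ d * (lam * r ^ 2 * Cmod v ^ 2))) by (field; lra).
  apply Rmult_le_compat_l. apply pos_INR. apply Rmult_le_compat_l. left; now apply Rinv_0_lt_compat.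
  replace ((lam * r * Cmod v) ^ 2) with (lam * (lam * r ^ 2 * Cmod v ^ 2)) by ring.
  assert (0 <= lam * r ^ 2 * Cmod v ^ 2) by (repeat apply Rmult_le_pos; try apply pow2_ge_0; lra). nra.
Qed.

(** The weight is the Cauchy kernel of the full circle and does not move with [lam]. At [lam] = 0
    every value of [f] is f(z + h); and since the path has velocity r w - h in [lam], the
    denominator of the weight cancels in the derivative, which leaves exactly the sum of
    [path_mean_derivative]. *)
Definition path_mean (f : CC -> CC) (z h : CC) (r : R) (N : nat) (lam : R) : CC :=
  csum (fun k => f (path z h r lam (rt N k)) * (r * rt N k / (r * rt N k - h)))%C N.

Lemma kernel_den (r : R) (w h : CC) : 0 < r -> Cmod w = 1 -> Cmod h < r ->
  (r * w - h)%C <> 0%C /\ r - Cmod h <= Cmod (r * w - h) <= 2 * r.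
Proof.
  intros Hr Hw Hh. assert (E : Cmod (r * w) = r) by (rewrite Cmod_mult, Cmod_R, Hw, Rabs_pos_eq; lra).
  assert (A := Cmod_triangle_sub (r * w) h). assert (B := Cmod_triangle_minus (r * w) h). split; [|lra].
  apply Cmod_gt_0. lra.
Qed.

Lemma path_mean_step f z h r d N lam delta : (2 <= N)%nat -> 0 < r -> Cmod h < r -> 0 < d ->
  unif_quadr f z r d -> r * Cmod (rt N 1 - 1) < d -> 0 < lam <= 1 -> 0 <= delta <= lam -> 2 * r * delta < d ->
  Cmod (path_mean f z h r N (lam - delta) - path_mean f z h r N lam)
   <= delta * (INR N * (r ^ 2 * Cmod (rt N 1 - 1) / d)) + INR N * (r / (r - Cmod h) * (/ d * (2 * r * delta) ^ 2)).
Proof.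
  intros HN Hr Hh Hd Hf Hw Hl Hdel Hdd.
  set (P := fun k => path z h r lam (rt N k)).
  set (K := fun k => (- delta * (r * rt N k - h))%C).
  set (W := fun k => (r * rt N k / (r * rt N k - h))%C).
  assert (E : (path_mean f z h r N (lam - delta) - path_mean f z h r N lam)%C =
    (csum (fun k => W k * (f (P k + K k)%C - f (P k) - K k * cderiv f (P k))) N
      - delta * csum (fun k => cderiv f (P k) * (r * rt N k)) N)%C).
  { unfold path_mean. rewrite <- csum_scal, <- !csum_minus. apply csum_ext. intros k _.
    replace (path z h r (lam - delta) (rt N k)) with (P k + K k)%C by (unfold P, K, path; rewrite RtoC_minus; ring).
    fold (P k). unfold W, K. field. apply kernel_den; auto using Cmod_rt. }
  rewrite E. eapply Rle_trans; [apply Cmod_triangle_minus|]. rewrite Rplus_comm. apply Rplus_le_compat.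
  - rewrite Cmod_mult, Cmod_R, Rabs_pos_eq by lra. apply Rmult_le_compat_l; [lra|].
    apply path_mean_derivative; auto.
  - apply csum_bound. intros k _. destruct (kernel_den r (rt N k) h Hr (Cmod_rt N k) Hh) as [D1 D2].
    rewrite Cmod_mult. apply Rmult_le_compat; try apply Cmod_ge_0.
    + unfold W. rewrite Cmod_div, Cmod_mult, Cmod_R, Cmod_rt, Rabs_pos_eq by (auto; lra).
      rewrite Rmult_1_r. apply Rmult_le_compat_l; [lra|]. apply Rinv_le_contravar; lra.
    + assert (EK : Cmod (K k) <= 2 * r * delta).
      { unfold K. rewrite Cmod_mult, Cmod_opp, Cmod_R, Rabs_pos_eq by lra. nra. }
      eapply Rle_trans; [apply Hf|].
      * apply path_in_disc; auto. lra. apply Cmod_rt.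
      * lra.
      * apply Rmult_le_compat_l. left; now apply Rinv_0_lt_compat. apply pow_incr. split; auto using Cmod_ge_0.
Qed.

(** The interval is crossed downwards from 1 in K equal steps. Their linear parts add up to at most
    A and their quadratic remainders to B/K; with [N] fixed, K may grow without bound, and only A is
    left. *)
Lemma path_mean_homotopy f z h r d N : (2 <= N)%nat -> 0 < r -> Cmod h < r -> 0 < d ->
  unif_quadr f z r d -> r * Cmod (rt N 1 - 1) < d ->
  Cmod (path_mean f z h r N 0 - path_mean f z h r N 1) <= INR N * (r ^ 2 * Cmod (rt N 1 - 1) / d).
Proof.
  intros HN Hr Hh Hd Hf Hw. set (A := INR N * (r ^ 2 * Cmod (rt N 1 - 1) / d)).
  set (B := INR N * (r / (r - Cmod h) * (/ d * (2 * r) ^ 2))).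
  assert (HA : forall K, (0 < K)%nat -> 2 * r / INR K < d ->
    Cmod (path_mean f z h r N 0 - path_mean f z h r N 1) <= A + B / INR K).
  { intros K HK HKd. assert (HK0 : 0 < INR K) by (apply (lt_INR 0); lia).
    assert (HI : forall i, (i <= K)%nat -> Cmod (path_mean f z h r N (1 - INR i / INR K) - path_mean f z h r N 1)
       <= INR i * (A / INR K + B / INR K ^ 2)).
    { induction i; intros Hi.
      - simpl INR. replace (1 - 0 / INR K) with 1 by (field; lra).
        replace (_ - _)%C with (RtoC 0) by ring. rewrite Cmod_0. lra.
      - assert (HiK : INR (S i) <= INR K) by (apply le_INR; auto).
        replace (1 - INR (S i) / INR K) with ((1 - INR i / INR K) - / INR K) by (rewrite S_INR; field; lra).
        rewrite S_INR in HiK |- *. specialize (IHi ltac:(lia)).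
        assert (P1 : INR i / INR K + / INR K <= 1).
        { apply Rmult_le_reg_r with (INR K); auto. field_simplify; lra. }
        assert (P2 : 0 <= INR i / INR K) by (apply Rmult_le_pos; [apply pos_INR|left; now apply Rinv_0_lt_compat]).
        assert (P3 : 0 < / INR K) by now apply Rinv_0_lt_compat.
        generalize (path_mean_step f z h r d N (1 - INR i / INR K) (/ INR K) HN Hr Hh Hd Hf Hw ltac:(lra) ltac:(lra) HKd).
        fold A. set (X := path_mean f z h r N (1 - INR i / INR K - / INR K)).
        set (Y := path_mean f z h r N (1 - INR i / INR K)) in *. set (Z := path_mean f z h r N 1) in *. intros Q.
        replace (X - Z)%C with ((X - Y) + (Y - Z))%C by ring. eapply Rle_trans; [apply Cmod_triangle|].
        replace (INR N * (r / (r - Cmod h) * (/ d * (2 * r * / INR K) ^ 2))) with (B / INR K ^ 2) in Q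
          by (unfold B; field; repeat split; lra).
        unfold Rdiv in *. lra. }
    specialize (HI K (Nat.le_refl K)). replace (1 - INR K / INR K) with 0 in HI by (field; lra).
    eapply Rle_trans; [exact HI|]. right. field. lra. }
  apply Rnot_lt_le; intros Hlt. set (X := Cmod (path_mean f z h r N 0 - path_mean f z h r N 1)) in *.
  assert (HB : 0 <= B).
  { unfold B. apply Rmult_le_pos. apply pos_INR. apply Rmult_le_pos.
    apply Rmult_le_pos; [lra|left; apply Rinv_0_lt_compat; lra].
    apply Rmult_le_pos; [left; now apply Rinv_0_lt_compat|apply pow2_ge_0]. }
  destruct (nfloor_ex (Rmax (2 * r / d) (B / (X - A))) ) as [K [_ HK]].
  { apply Rle_trans with (2 := Rmax_l _ _). apply Rlt_le, Rdiv_lt_0_compat; lra. }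
  rewrite <- S_INR in HK. assert (K1 := Rle_lt_trans _ _ _ (Rmax_l _ _) HK). assert (K2 := Rle_lt_trans _ _ _ (Rmax_r _ _) HK).
  assert (HS : 0 < INR (S K)) by (apply (lt_INR 0); lia).
  assert (K3 : 2 * r / INR (S K) < d).
  { apply Rmult_lt_reg_r with (INR (S K)); auto. clear HA. unfold Rdiv in K1, K2 |- *. rewrite Rmult_assoc, Rinv_l by lra.
    apply Rmult_lt_compat_r with (r := d) in K1; auto. rewrite Rmult_assoc, Rinv_l in K1 by lra. lra. }
  assert (K4 : B / INR (S K) < X - A).
  { apply Rmult_lt_reg_r with (INR (S K)); auto. clear HA. unfold Rdiv in K1, K2 |- *. rewrite Rmult_assoc, Rinv_l by lra.
    apply Rmult_lt_compat_r with (r := X - A) in K2; [|lra]. rewrite Rmult_assoc, Rinv_l in K2 by lra. lra. }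
  specialize (HA (S K) ltac:(lia) K3). lra.
Qed.

Definition circ_mean (f : CC -> CC) (z h : CC) (r : R) (N : nat) : CC :=
  (/ INR N * csum (fun k => f (z + r * rt N k)%C * / (1 - h / (r * rt N k))) N)%C.

Lemma is_lim_seq_inv_INR (c : R) : is_lim_seq (fun n => c / INR n) 0.
Proof.
  replace (Finite 0) with (Finite (c * 0)) by (f_equal; ring).
  apply is_lim_seq_mult'. apply is_lim_seq_const.
  replace (Finite 0) with (Rbar_inv p_infty) by reflexivity.
  apply is_lim_seq_inv. apply is_lim_seq_INR. discriminate.
Qed.

(* The mean of [f] over the images of the [N]-th roots of unity changes by O(1/N) while the circle is contracted to
   [z + h], because the increments along the polygon telescope; this replaces contour integration. *)
Lemma Cauchy_circ f z h r : 0 < r -> Cmod h < r -> (forall w, Cmod (w - z) <= 2 * r -> hol f w) ->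
  Clim (circ_mean f z h r) (f (z + h)%C).
Proof.
  intros Hr Hh Hf. destruct (hol_uniform f z r Hr Hf) as [d [Hd Hu]].
  set (q := (h / r)%C).
  assert (Hr0 : RtoC r <> 0%C) by (intros E; injection E; lra).
  assert (Hq : Cmod q < 1).
  { unfold q. rewrite Cmod_div, Cmod_R, Rabs_pos_eq by (auto; lra).
    apply Rmult_lt_reg_r with r; auto. unfold Rdiv. rewrite Rmult_assoc, Rinv_l; lra. }
  (* The discrete kernel has mean 1/(1 - q^N) rather than 1, a factor that tends to 1 and is removed
     by [H2]. The homotopy bound is N times O(1/N); division by N in the mean makes it O(1/N). *)
  assert (H1 : Clim (fun N => circ_mean f z h r N - f (z + h)%C * / (1 - q ^ N))%C 0).
  { apply Clim_squeeze with (fun N => 6 * PI * r ^ 2 / d / INR N).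
    2:{ apply is_lim_seq_inv_INR. }
    destruct (nfloor_ex (6 * PI * r / d)) as [K [_ HK]].
    { generalize PI_RGT_0; intros. apply Rlt_le, Rdiv_lt_0_compat; nra. }
    exists (K + 8)%nat. intros N HN. assert (HN0 : 0 < INR N) by (apply (lt_INR 0); lia).
    assert (HNc : RtoC (INR N) <> 0%C) by (intros E; injection E; lra).
    assert (HNK : 6 * PI * r / d < INR N).
    { apply Rlt_le_trans with (1 := HK). rewrite <- S_INR. apply le_INR. lia. }
    assert (Hw := rt_near_1 N ltac:(lia)).
    assert (Hwd : r * Cmod (rt N 1 - 1) < d).
    { apply Rle_lt_trans with (r * (6 * PI / INR N)). apply Rmult_le_compat_l; lra.
      apply Rmult_lt_compat_r with (r := d) in HNK; auto. unfold Rdiv in *. rewrite Rmult_assoc, Rinv_l in HNK by lra.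
      apply Rmult_lt_reg_r with (INR N); auto. rewrite !Rmult_assoc, Rinv_l by lra. lra. }
    generalize (path_mean_homotopy f z h r d N ltac:(lia) Hr Hh Hd Hu Hwd). intros Q.
    assert (E0 : path_mean f z h r N 0 = (INR N * (f (z + h)%C * / (1 - q ^ N)))%C).
    { unfold path_mean. rewrite (csum_ext _ (fun k => f (z + h)%C * / (1 - q / rt N k))%C).
      - rewrite csum_scal, rt_kernel_sum by (try lia; apply one_minus_neq_0, Cmod_pow_lt_1; auto; lia). field.
        apply one_minus_neq_0, Cmod_pow_lt_1; auto; lia.
      - intros k _. unfold path. replace (z + h + 0 * (r * rt N k - h))%C with (z + h)%C by ring.
        f_equal. unfold q. field. destruct (kernel_den r (rt N k) h Hr (Cmod_rt N k) Hh) as [D _].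
        repeat split; auto using rt_neq_0. }
    assert (E1 : path_mean f z h r N 1 = (INR N * circ_mean f z h r N)%C).
    { unfold path_mean, circ_mean. rewrite Cmult_assoc, Cinv_r, Cmult_1_l by auto. apply csum_ext.
      intros k _. unfold path. replace (z + h + 1 * (r * rt N k - h))%C with (z + r * rt N k)%C by ring.
      f_equal. destruct (kernel_den r (rt N k) h Hr (Cmod_rt N k) Hh) as [D _].
      field. repeat split; auto using rt_neq_0. }
    rewrite E0, E1 in Q.
    replace (_ - 0)%C with (- / INR N * (INR N * (f (z + h)%C * / (1 - q ^ N)) - INR N * circ_mean f z h r N))%C.
    2:{ field. split; auto. apply one_minus_neq_0, Cmod_pow_lt_1; auto; lia. }
    rewrite Cmod_mult, Cmod_opp, <- RtoC_inv, Cmod_R, Rabs_pos_eq by (try lra; left; now apply Rinv_0_lt_compat).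
    apply Rle_trans with (/ INR N * (INR N * (r ^ 2 * Cmod (rt N 1 - 1) / d))).
    { apply Rmult_le_compat_l; auto. left; now apply Rinv_0_lt_compat. }
    rewrite <- Rmult_assoc, Rinv_l, Rmult_1_l by lra. 
    replace (6 * PI * r ^ 2 / d / INR N) with (r ^ 2 * (6 * PI / INR N) / d) by (field; lra).
    apply Rmult_le_compat_r. left; now apply Rinv_0_lt_compat. apply Rmult_le_compat_l; auto. apply pow2_ge_0. }
  assert (H2 : Clim (fun N => f (z + h)%C * / (1 - q ^ N))%C (f (z + h)%C * / (1 - 0))%C).
  { apply Clim_scal. apply Clim_inv. intros E; injection E; lra. apply Clim_minus. apply Clim_const.
    apply Clim_squeeze with (fun n => Cmod q ^ n). exists O; intros n _. replace (q ^ n - 0)%C with (q ^ n)%C by ring. rewrite Cmod_pow. lra.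
    apply is_lim_seq_geom. rewrite Rabs_pos_eq; auto using Cmod_ge_0. }
  generalize (Clim_plus _ _ _ _ H1 H2).
  intros H3. replace (f (z + h)%C) with (0 + f (z + h)%C * / (1 - 0))%C.
  - apply Clim_ext with (2 := H3). intros n. ring.
  - field.
Qed.

(** * Consequences of the Cauchy formula: Taylor bounds, limits, identity theorem *)

Lemma Cmod_inv_le (a : CC) m : 0 < m -> m <= Cmod a -> Cmod (/ a) <= / m.
Proof.
  intros Hm Ha. rewrite Cmod_inv by (apply Cmod_gt_0; lra). now apply Rinv_le_contravar.
Qed.

Lemma Cmod_one_minus_ge (q : CC) : 1 - Cmod q <= Cmod (1 - q).
Proof. generalize (Cmod_triangle_sub 1 q). rewrite Cmod_1. lra. Qed.

Lemma circ_point (z w : CC) (r : R) : 0 < r -> Cmod w = 1 -> Cmod (z + r * w - z) = r.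
Proof.
  intros Hr Hw. replace (z + r * w - z)%C with (r * w)%C by ring.
  rewrite Cmod_mult, Hw, Cmod_R, Rabs_pos_eq; lra.
Qed.

Lemma circ_q (h w : CC) (r : R) : 0 < r -> Cmod w = 1 -> Cmod (h / (r * w)) = Cmod h / r.
Proof.
  intros Hr Hw. assert (w <> 0%C) by (apply Cmod_gt_0; lra).
  rewrite Cmod_div, Cmod_mult, Hw, Cmod_R, Rabs_pos_eq by (try lra; apply Cmult_neq_0; auto; apply RtoC_neq_0; lra).
  f_equal. ring.
Qed.

Lemma mean_bound (a : nat -> CC) N M : (0 < N)%nat -> (forall k, (k < N)%nat -> Cmod (a k) <= M) ->
  Cmod (/ INR N * csum a N) <= M.
Proof.
  intros HN H. assert (HN0 : 0 < INR N) by (apply (lt_INR 0); lia).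
  rewrite Cmod_mult, <- RtoC_inv, Cmod_R, Rabs_pos_eq by (try lra; left; now apply Rinv_0_lt_compat).
  apply Rmult_le_reg_l with (INR N); auto. rewrite <- Rmult_assoc, Rinv_r, Rmult_1_l by lra. now apply csum_bound.
Qed.

(** The extra factor r / (r - |h|) bounds the kernel 1/(1 - h/(r w)). It does not depend on [f], so
    it is harmless when the bound is applied to a whole family f(w)/(w - a)^n. *)
Lemma weak_max f z h r M : 0 < r -> Cmod h < r -> (forall w, Cmod (w - z) <= 2 * r -> hol f w) ->
  (forall w, Cmod (w - z) = r -> Cmod (f w) <= M) -> Cmod (f (z + h)%C) <= M * (r / (r - Cmod h)).
Proof.
  intros Hr Hh Hf HM. apply Clim_le with (2 := Cauchy_circ f z h r Hr Hh Hf).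
  exists 1%nat. intros N HN. apply mean_bound; [lia|]. intros k _.
  rewrite Cmod_mult. apply Rmult_le_compat; try apply Cmod_ge_0.
  - apply HM. apply circ_point; auto using Cmod_rt.
  - replace (r / (r - Cmod h)) with (/ (1 - Cmod h / r)) by (field; lra).
    assert (Cmod h / r < 1) by (apply Rmult_lt_reg_r with r; auto; unfold Rdiv; rewrite Rmult_assoc, Rinv_l; lra).
    apply Cmod_inv_le; [lra|].
    rewrite <- (circ_q h (rt N k) r) by auto using Cmod_rt. apply Cmod_one_minus_ge.
Qed.

(** A Taylor bound in which the difference quotient at t h stands for the derivative, so that only
    values of [f] enter. With Q = h/(r w), the kernels of the Cauchy formula at h, t h and 0 combine
    to Q^2 (1 - t) / ((1 - Q)(1 - t Q)): quadratic in h and bounded uniformly in t. The 4 comes from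
    the two denominators, each at least 1/2. *)
Lemma second_difference f z h r M t : 0 < r -> Cmod h <= r / 2 -> 0 < t < 1 ->
  (forall w, Cmod (w - z) <= 2 * r -> hol f w) ->
  (forall w, Cmod (w - z) <= r -> Cmod (f w) <= M) ->
  Cmod (f (z + h)%C - f z - (f (z + t * h)%C - f z) / t) <= 4 * M / r ^ 2 * Cmod h ^ 2.
Proof.
  intros Hr Hh Ht Hf HM. assert (Ht0 : RtoC t <> 0%C) by (apply RtoC_neq_0; lra).
  assert (Hth : Cmod (t * h) = t * Cmod h) by (rewrite Cmod_mult, Cmod_R, Rabs_pos_eq; lra).
  generalize (Cmod_ge_0 h); intros P0.
  assert (C1 := Cauchy_circ f z h r Hr ltac:(lra) Hf).
  assert (C2 := Cauchy_circ f z (t * h)%C r Hr ltac:(rewrite Hth; nra) Hf).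
  assert (C0 := Cauchy_circ f z 0 r Hr ltac:(rewrite Cmod_0; lra) Hf).
  replace (z + 0)%C with z in C0 by ring.
  assert (CC := Clim_minus _ _ _ _ (Clim_minus _ _ _ _ C1 C0) (Clim_scal (/ t) _ _ (Clim_minus _ _ _ _ C2 C0))).
  replace (f (z + h)%C - f z - (f (z + t * h)%C - f z) / t)%C with (f (z + h)%C - f z - / t * (f (z + t * h)%C - f z))%C by (unfold Cdiv; ring).
  apply Clim_le with (2 := CC). clear CC C0 C1 C2.
  exists 1%nat. intros N HN.
  assert (HN0 : RtoC (INR N) <> 0%C) by (apply RtoC_neq_0, not_0_INR; lia).
  set (Q := fun k => (h / (r * rt N k))%C).
  assert (HQ : forall k, Cmod (Q k) <= / 2).
  { intros k. unfold Q. rewrite circ_q by auto using Cmod_rt. apply Rmult_le_reg_r with r; auto.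
    unfold Rdiv; rewrite Rmult_assoc, Rinv_l; lra. }
  assert (HQ1 : forall k, (1 - Q k)%C <> 0%C) by (intros k; apply one_minus_neq_0; generalize (HQ k); lra).
  assert (HtQ : forall k, Cmod (t * Q k) <= / 2).
  { intros k. rewrite Cmod_mult, Cmod_R, Rabs_pos_eq by lra. generalize (HQ k) (Cmod_ge_0 (Q k)); nra. }
  assert (HQ2 : forall k, (1 - t * Q k)%C <> 0%C) by (intros k; apply one_minus_neq_0; generalize (HtQ k); lra).
  replace (_ - _)%C with (/ INR N * csum (fun k => f (z + r * rt N k)%C * (Q k * Q k * (1 - t) / ((1 - Q k) * (1 - t * Q k)))) N)%C.
  - apply mean_bound; [lia|]. intros k _. rewrite Cmod_mult.
    replace (4 * M / r ^ 2 * Cmod h ^ 2) with (M * (4 * (Cmod h / r) ^ 2)) by (field; lra).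
    apply Rmult_le_compat; try apply Cmod_ge_0.
    + apply HM. rewrite circ_point; auto using Cmod_rt. lra.
    + rewrite <- (circ_q h (rt N k) r) by auto using Cmod_rt. fold (Q k).
      unfold Cdiv. rewrite !Cmod_mult, Cmod_inv by (apply Cmult_neq_0; auto). rewrite Cmod_mult.
      rewrite <- RtoC_minus, Cmod_R, Rabs_pos_eq by lra.
      assert (A1 : / 2 <= Cmod (1 - Q k)) by (generalize (Cmod_one_minus_ge (Q k)) (HQ k); lra).
      assert (A2 : / 2 <= Cmod (1 - t * Q k)) by (generalize (Cmod_one_minus_ge (t * Q k)) (HtQ k); lra).
      assert (A3 : / (Cmod (1 - Q k) * Cmod (1 - t * Q k)) <= 4).
      { replace 4 with (/ (/ 2 * / 2)) by field. apply Rinv_le_contravar; nra. }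
      generalize (Cmod_ge_0 (Q k)); intros P1.
      apply Rle_trans with (Cmod (Q k) * Cmod (Q k) * 1 * 4); [|simpl; lra].
      assert (P2 : 0 <= Cmod (Q k) * Cmod (Q k)) by nra.
      apply Rmult_le_compat; auto. nra. left; apply Rinv_0_lt_compat; nra. nra.
  - unfold circ_mean.
    transitivity (/ INR N * (csum (fun k => f (z + r * rt N k)%C * / (1 - h / (r * rt N k))) N
      - csum (fun k => f (z + r * rt N k)%C * / (1 - 0 / (r * rt N k))) N
      - / t * (csum (fun k => f (z + r * rt N k)%C * / (1 - t * h / (r * rt N k))) N
      - csum (fun k => f (z + r * rt N k)%C * / (1 - 0 / (r * rt N k))) N)))%C; [|ring].
    f_equal. rewrite <- !csum_minus, <- csum_scal, <- csum_minus. apply csum_ext. intros k _.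
    replace (t * h / (r * rt N k))%C with (t * Q k)%C by (unfold Q, Cdiv; ring). fold (Q k).
    replace (0 / (r * rt N k))%C with (RtoC 0) by (unfold Cdiv; ring).
    replace (1 - 0)%C with (RtoC 1) by ring. field. repeat split; auto.
Qed.

Lemma hol_isder f z : hol f z -> isder f z (cderiv f z).
Proof.
  intros [f' [r [K [Hr [HK H]]]]]. unfold cderiv. apply epsilon_spec. exists (f' z).
  eapply quadr_isder; eauto. replace (z - z)%C with (RtoC 0) by ring. now rewrite Cmod_0.
Qed.

Lemma Rle_eps (x y : R) : (forall e, 0 < e -> x <= y + e) -> x <= y.
Proof. intros H. apply Rnot_lt_le; intros Hlt. specialize (H ((x - y) / 2)). lra. Qed.

(** The limit t -> 0 of [second_difference]. The constant depends on [M] and [r] alone and not on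
    the constants that witness [hol f], hence it is common to all members of a bounded sequence. *)
Lemma taylor_bound f z h r M : 0 < r -> Cmod h <= r / 2 ->
  (forall w, Cmod (w - z) <= 2 * r -> hol f w) ->
  (forall w, Cmod (w - z) <= r -> Cmod (f w) <= M) ->
  Cmod (f (z + h)%C - f z - h * cderiv f z) <= 4 * M / r ^ 2 * Cmod h ^ 2.
Proof.
  intros Hr Hh Hf HM.
  destruct (hol_isder f z) as [d [K [Hd HK]]].
  { apply Hf. replace (z - z)%C with (RtoC 0) by ring. rewrite Cmod_0; lra. }
  apply Rle_eps. intros e He. generalize (Cmod_ge_0 h); intros P0.
  set (B := Rabs K * Cmod h ^ 2 + 1).
  assert (HB : 0 < B).
  { unfold B. generalize (Rabs_pos K) (pow2_ge_0 (Cmod h)). nra. }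
  set (t := Rmin (/ 2) (Rmin (d / (Cmod h + 1)) (e / B)) / 2).
  assert (H3 : 0 < Rmin (/ 2) (Rmin (d / (Cmod h + 1)) (e / B))).
  { repeat apply Rmin_glb_lt; try lra; apply Rdiv_lt_0_compat; lra. }
  assert (Ht0 : 0 < t) by (unfold t; lra).
  assert (Ht1 : t < Rmin (/ 2) (Rmin (d / (Cmod h + 1)) (e / B))) by (unfold t; lra).
  assert (T1 := Rlt_le_trans _ _ _ Ht1 (Rmin_l _ _)). assert (T2 := Rlt_le_trans _ _ _ Ht1 (Rmin_r _ _)).
  assert (T3 := Rlt_le_trans _ _ _ T2 (Rmin_l _ _)). assert (T4 := Rlt_le_trans _ _ _ T2 (Rmin_r _ _)).
  assert (Hth : Cmod (t * h) = t * Cmod h) by (rewrite Cmod_mult, Cmod_R, Rabs_pos_eq; lra).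
  assert (T5 : t * (Cmod h + 1) < d).
  { apply Rmult_lt_compat_r with (r := Cmod h + 1) in T3; [|lra]. unfold Rdiv in T3. rewrite Rmult_assoc, Rinv_l in T3 by lra. lra. }
  assert (T6 : t * B < e).
  { apply Rmult_lt_compat_r with (r := B) in T4; [|lra]. unfold Rdiv in T4. rewrite Rmult_assoc, Rinv_l in T4 by lra. lra. }
  assert (Q := HK (t * h)%C). rewrite Hth in Q. specialize (Q ltac:(nra)).
  assert (S := second_difference f z h r M t Hr Hh ltac:(lra) Hf HM).
  assert (Htc : RtoC t <> 0%C) by (apply RtoC_neq_0; lra).
  replace (f (z + h)%C - f z - h * cderiv f z)%C with
    ((f (z + h)%C - f z - (f (z + t * h)%C - f z) / t) + / t * (f (z + t * h)%C - f z - t * h * cderiv f z))%C by (field; auto).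
  eapply Rle_trans; [apply Cmod_triangle|]. apply Rplus_le_compat; auto.
  rewrite Cmod_mult, <- RtoC_inv, Cmod_R, Rabs_pos_eq by (try lra; left; now apply Rinv_0_lt_compat).
  apply Rmult_le_reg_l with t; auto. rewrite <- Rmult_assoc, Rinv_r, Rmult_1_l by lra.
  eapply Rle_trans; [exact Q|].
  assert (K <= Rabs K) by apply Rle_abs.
  assert (Z : K * (t * Cmod h) ^ 2 <= t * (t * B)).
  { unfold B. replace (K * (t * Cmod h) ^ 2) with (t * (t * (K * Cmod h ^ 2))) by ring.
    apply Rmult_le_compat_l; [lra|]. apply Rmult_le_compat_l; [lra|]. generalize (pow2_ge_0 (Cmod h)). nra. }
  nra.
Qed.

Lemma Clim_Cauchy (u : nat -> CC) :
  (forall e, 0 < e -> exists N, forall n m, (N <= n)%nat -> (N <= m)%nat -> Cmod (u n - u m) < e) ->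
  exists l, Clim u l.
Proof.
  intros H.
  assert (A : ex_finite_lim_seq (fun n => fst (u n))).
  { apply ex_lim_seq_cauchy_corr. intros e. destruct (H e (cond_pos e)) as [N HN]. exists N. intros n m Hn Hm.
    eapply Rle_lt_trans; [|apply (HN n m Hn Hm)]. apply (Cmod_fst_le (u n - u m)). }
  assert (B : ex_finite_lim_seq (fun n => snd (u n))).
  { apply ex_lim_seq_cauchy_corr. intros e. destruct (H e (cond_pos e)) as [N HN]. exists N. intros n m Hn Hm.
    eapply Rle_lt_trans; [|apply (HN n m Hn Hm)]. apply (Cmod_snd_le (u n - u m)). }
  destruct A as [x Hx], B as [y Hy]. exists (x, y). apply Clim_components. split; auto.
Qed.

(** Pointwise convergence and a uniform bound suffice. By [taylor_bound] all [F k] share one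
    quadratic remainder; it forces the derivatives to converge, and then the remainder inequality
    itself passes to the limit. *)
Lemma hol_limit (F : nat -> CC -> CC) (f : CC -> CC) a R0 M : 0 < R0 ->
  (forall k w, Cmod (w - a) < R0 -> hol (F k) w) ->
  (forall k w, Cmod (w - a) < R0 -> Cmod (F k w) <= M) ->
  (forall w, Cmod (w - a) < R0 -> Clim (fun k => F k w) (f w)) -> hol f a.
Proof.
  intros HR Hh HM Hl. set (K := 4 * M / (R0 / 4) ^ 2).
  assert (HM0 : 0 <= M).
  { apply Rle_trans with (Cmod (F O a)); [apply Cmod_ge_0|]. apply HM. replace (a - a)%C with (RtoC 0) by ring. now rewrite Cmod_0. }
  assert (HK : 0 <= K) by (unfold K; apply Rmult_le_pos; [lra|left; apply Rinv_0_lt_compat, pow_lt; lra]).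
  assert (HQ : forall k z h, Cmod (z - a) < R0 / 16 -> Cmod h <= R0 / 8 ->
    Cmod (F k (z + h)%C - F k z - h * cderiv (F k) z) <= K * Cmod h ^ 2).
  { intros k z h Hz Hhh. apply taylor_bound; try lra.
    - intros w Hw. apply Hh. replace (w - a)%C with (w - z + (z - a))%C by ring. generalize (Cmod_triangle (w - z) (z - a)); lra.
    - intros w Hw. apply HM. replace (w - a)%C with (w - z + (z - a))%C by ring. generalize (Cmod_triangle (w - z) (z - a)); lra. }
  assert (HD : forall z, Cmod (z - a) < R0 / 16 -> exists l, Clim (fun k => cderiv (F k) z) l).
  { intros z Hz. apply Clim_Cauchy. intros e He.
    (* The step [t] is fixed first, small enough for the two quadratic remainders; only afterwards
       are the values at z and z + t made close, to within t e / 8. *)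
    set (t := Rmin (R0 / 8) (e / (4 * (K + 1)))).
    assert (Ht : 0 < t) by (apply Rmin_glb_lt; [lra|apply Rdiv_lt_0_compat; lra]).
    assert (T1 : t <= R0 / 8) by apply Rmin_l. assert (T2 : t <= e / (4 * (K + 1))) by apply Rmin_r.
    assert (T3 : t * (4 * (K + 1)) <= e).
    { apply Rmult_le_compat_r with (r := 4 * (K + 1)) in T2; [|lra]. unfold Rdiv in T2. rewrite Rmult_assoc, Rinv_l in T2 by lra. lra. }
    assert (Et : Cmod t = t) by (rewrite Cmod_R, Rabs_pos_eq; lra).
    assert (Hzt : Cmod (z + t - a) < R0).
    { replace (z + t - a)%C with (z - a + t)%C by ring. generalize (Cmod_triangle (z - a) t). lra. }
    assert (L1 := Hl z ltac:(lra)). assert (L2 := Hl _ Hzt).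
    assert (He4 : 0 < t * e / 8) by nra.
    apply Clim_eps with (e := t * e / 8) in L1; auto. apply Clim_eps with (e := t * e / 8) in L2; auto.
    destruct L1 as [N1 L1], L2 as [N2 L2]. exists (max N1 N2). intros n m Hn Hm.
    assert (Q1 := HQ n z t Hz ltac:(lra)). assert (Q2 := HQ m z t Hz ltac:(lra)). rewrite Et in Q1, Q2.
    assert (X1 := L1 n ltac:(lia)). assert (X2 := L1 m ltac:(lia)). assert (X3 := L2 n ltac:(lia)). assert (X4 := L2 m ltac:(lia)).
    apply Rmult_lt_reg_l with t; auto. rewrite <- Et at 1. rewrite <- Cmod_mult.
    replace (t * (cderiv (F n) z - cderiv (F m) z))%C with
      ((F m (z + t)%C - F m z - t * cderiv (F m) z) - (F n (z + t)%C - F n z - t * cderiv (F n) z)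
       + ((F n (z + t)%C - f (z + t)%C) - (F m (z + t)%C - f (z + t)%C)) - ((F n z - f z) - (F m z - f z)))%C by ring.
    eapply Rle_lt_trans; [apply Cmod_triangle_minus|].
    eapply Rle_lt_trans; [apply Rplus_le_compat; [apply Cmod_triangle|apply Cmod_triangle_minus]|].
    eapply Rle_lt_trans; [apply Rplus_le_compat_r, Rplus_le_compat; apply Cmod_triangle_minus|].
    assert (t * (t * (4 * (K + 1))) <= t * e) by (apply Rmult_le_compat_l; lra). nra. }
  exists (fun z => epsilon (inhabits (RtoC 0)) (Clim (fun k => cderiv (F k) z))), (R0 / 16), K.
  split; [lra|split; auto]. intros z h Hz Hzh.
  assert (HDz := epsilon_spec (inhabits (RtoC 0)) _ (HD z Hz)). set (l := epsilon _ _) in *.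
  apply Clim_le with (fun k => F k (z + h)%C - F k z - h * cderiv (F k) z)%C.
  - exists O. intros k _. apply HQ; auto.
    replace h with (z + h - a - (z - a))%C by ring. generalize (Cmod_triangle_minus (z + h - a) (z - a)). lra.
  - apply Clim_minus. apply Clim_minus. apply Hl; lra. apply Hl; lra. now apply Clim_scal.
Qed.

Lemma hol_series (F : nat -> CC -> CC) (b : nat -> R) a R0 : 0 < R0 ->
  (forall k w, Cmod (w - a) < R0 -> hol (F k) w) ->
  (forall k w, Cmod (w - a) < R0 -> Cmod (F k w) <= b k) -> ex_series b ->
  hol (fun w => CSer (fun k => F k w)) a.
Proof.
  intros HR Hh Hb Eb. apply hol_limit with (F := fun n w => csum (fun k => F k w) n) (R0 := R0) (M := Series b); auto.
  - intros n w Hw. apply hol_csum; auto.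
  - intros n w Hw. apply csum_le_Series; auto.
  - intros w Hw. apply CSer_correct. apply ex_series_Cmod_le with b; auto.
Qed.

Lemma ex_series_shift (b : nat -> R) J : ex_series (fun k => b (J + k)%nat) -> ex_series b.
Proof. apply ex_series_incr_n. Qed.

Lemma CSer_shift (a : nat -> CC) J : ex_series (fun k => Cmod (a (J + k)%nat)) ->
  CSer a = (csum a J + CSer (fun k => a (J + k)%nat))%C.
Proof.
  intros H. apply CSer_unique. apply Clim_decr with J.
  apply Clim_ext with (fun n => csum a J + csum (fun k => a (J + k)%nat) n)%C.
  - intros n. rewrite Nat.add_comm, csum_split. auto.
  - apply Clim_plus. apply Clim_const. now apply CSer_correct.
Qed.

Lemma hol_series_ev (F : nat -> CC -> CC) (b : nat -> R) a R0 J : 0 < R0 ->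
  (forall k w, Cmod (w - a) < R0 -> hol (F k) w) ->
  (forall k w, (J <= k)%nat -> Cmod (w - a) < R0 -> Cmod (F k w) <= b k) -> ex_series b ->
  hol (fun w => CSer (fun k => F k w)) a.
Proof.
  intros HR Hh Hb Eb. apply (ex_series_incr_n b J) in Eb.
  apply hol_ext_loc with (fun w => csum (fun k => F k w) J + CSer (fun k => F (J + k)%nat w))%C.
  - exists R0; split; auto. intros w Hw. symmetry. apply CSer_shift.
    apply ex_series_Cmod_le with (fun k => b (J + k)%nat); auto. intros; apply Hb; auto; lia.
  - apply hol_plus. apply hol_csum. intros; apply Hh. replace (a - a)%C with (RtoC 0) by ring. now rewrite Cmod_0.
    apply hol_series with (fun k => b (J + k)%nat) R0; auto. intros; apply Hb; auto; lia.
Qed.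

Lemma Cmod_0_lim (x : CC) (K q : R) : 0 <= q < 1 -> (forall n, Cmod x <= K * q ^ n) -> x = 0%C.
Proof.
  intros Hq H. apply Cmod_eq_0. apply Rle_antisym; [|apply Cmod_ge_0].
  assert (L : is_lim_seq (fun n => K * q ^ n) (K * 0)).
  { apply is_lim_seq_mult'. apply is_lim_seq_const. apply is_lim_seq_geom. rewrite Rabs_pos_eq; lra. }
  rewrite Rmult_0_r in L.
  apply (is_lim_seq_le (fun _ => Cmod x) _ (Cmod x) 0 H); auto using is_lim_seq_const.
Qed.

(* The weak maximum principle is applied to [f w / (w - a) ^ n] for all [n]. *)
Lemma hol_identity_disc f a R0 rho : 0 < rho -> (forall w, Cmod (w - a) < R0 -> hol f w) ->
  (forall w, Cmod (w - a) < rho -> f w = 0%C) -> forall w, Cmod (w - a) < R0 / 2 -> f w = 0%C.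
Proof.
  intros Hrho Hf H0 w Hw. set (h := (w - a)%C) in *. set (r := (Cmod h + R0 / 2) / 2).
  generalize (Cmod_ge_0 h); intros P0.
  assert (Hr : Cmod h < r < R0 / 2) by (unfold r; lra).
  assert (Hd : forall v, Cmod (v - a) <= 2 * r -> hol f v) by (intros; apply Hf; lra).
  destruct (hol_bounded_disc f a r ltac:(lra) Hd) as [M HM].
  replace w with (a + h)%C by (unfold h; ring).
  (* At [a] itself the denominator is 0 for n > 0, but [f] vanishes near [a], so the quotient is
     identically 0 there. *)
  assert (HG : forall n v, Cmod (v - a) <= 2 * r -> hol (fun v => f v / (v - a) ^ n)%C v).
  { intros n v Hv. destruct (Ceq_dec (v - a) 0) as [E|E].
    - apply hol_ext_loc with (fun _ => RtoC 0); [|apply hol_const]. exists rho; split; auto. intros u Hu.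
      rewrite H0. unfold Cdiv; ring. replace (u - a)%C with (u - v + (v - a))%C by ring. rewrite E.
      replace (u - v + 0)%C with (u - v)%C by ring. auto.
    - apply hol_div; auto. apply hol_pow. apply hol_minus; auto using hol_id, hol_const. now apply Cpow_nz. }
  destruct (Req_dec (Cmod h) 0) as [E|E].
  { apply H0. replace (a + h - a)%C with h by ring. lra. }
  assert (Hh0 : h <> 0%C) by (apply Cmod_gt_0; lra).
  apply Cmod_0_lim with (M * (r / (r - Cmod h))) (Cmod h / r).
  { split. apply Rmult_le_pos; [lra|left; apply Rinv_0_lt_compat; lra].
    apply Rmult_lt_reg_r with r; [lra|]. unfold Rdiv; rewrite Rmult_assoc, Rinv_l; lra. }
  intros n.
  assert (Q := weak_max (fun v => f v / (v - a) ^ n)%C a h r (M / r ^ n) ltac:(lra) ltac:(lra) (HG n)).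
  assert (Hrn : 0 < r ^ n) by (apply pow_lt; lra).
  assert (Hhn : 0 < Cmod h ^ n) by (apply pow_lt; lra).
  simpl in Q. replace (a + h - a)%C with h in Q by ring.
  rewrite Cmod_div, Cmod_pow in Q by now apply Cpow_nz.
  apply Rmult_le_reg_r with (/ Cmod h ^ n). now apply Rinv_0_lt_compat.
  eapply Rle_trans; [apply Q|].
  - intros v Hv. rewrite Cmod_div, Cmod_pow, Hv. apply Rmult_le_compat_r. left; now apply Rinv_0_lt_compat. apply HM; lra.
    apply Cpow_nz. apply Cmod_gt_0; lra.
  - right. unfold Rdiv. rewrite !Rpow_mult_distr, pow_inv. field. repeat split; try lra.
Qed.

(** A chain of discs along the segment. Consecutive centres are at most d/4 apart, so vanishing
    within d/2 of one gives vanishing within d/4 of the next, which [hol_identity_disc] enlarges to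
    d/2 again. *)
Lemma hol_identity_segment f (p v : CC) d rho : 0 < d -> 0 < rho ->
  (forall t w, 0 <= t <= 1 -> Cmod (w - (p + t * v)) < d -> hol f w) ->
  (forall w, Cmod (w - p) < rho -> f w = 0%C) -> forall w, Cmod (w - (p + v)) < d / 2 -> f w = 0%C.
Proof.
  intros Hd Hrho Hf H0.
  destruct (nfloor_ex (4 * Cmod v / d)) as [n [_ Hn]].
  { generalize (Cmod_ge_0 v); intros. apply Rmult_le_pos; [lra|left; now apply Rinv_0_lt_compat]. }
  rewrite <- S_INR in Hn. set (N := S n) in *. assert (HN : 0 < INR N) by (apply (lt_INR 0); unfold N; lia).
  assert (Hs : Cmod v / INR N <= d / 4).
  { apply Rmult_le_reg_r with (INR N); auto. unfold Rdiv in *. rewrite Rmult_assoc, Rinv_l by lra.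
    apply Rlt_le in Hn. apply Rmult_le_compat_r with (r := d) in Hn; [|lra]. rewrite Rmult_assoc, Rinv_l in Hn by lra. lra. }
  assert (HI : forall i, (i <= N)%nat -> forall w, Cmod (w - (p + (INR i / INR N)%R * v)) < d / 2 -> f w = 0%C).
  { induction i; intros Hi.
    - apply hol_identity_disc with rho; auto.
      + intros w Hw. apply Hf with (INR 0 / INR N); auto. simpl. unfold Rdiv. rewrite Rmult_0_l. lra.
      + intros w Hw. apply H0. replace (w - p)%C with (w - (p + (INR 0 / INR N)%R * v))%C; auto.
        simpl. unfold Rdiv. rewrite Rmult_0_l. ring.
    - apply hol_identity_disc with (d / 4); [lra| |].
      + intros w Hw. apply Hf with (INR (S i) / INR N); auto. split.
        apply Rmult_le_pos; [apply pos_INR|left; now apply Rinv_0_lt_compat].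
        apply Rmult_le_reg_r with (INR N); auto. unfold Rdiv. rewrite Rmult_assoc, Rinv_l by lra.
        apply le_INR in Hi. lra.
      + intros w Hw. apply IHi; [lia|].
        replace (w - (p + (INR i / INR N)%R * v))%C with ((w - (p + (INR (S i) / INR N)%R * v)) + (/ INR N)%R * v)%C.
        * eapply Rle_lt_trans; [apply Cmod_triangle|]. rewrite Cmod_mult, Cmod_R, Rabs_pos_eq.
          unfold Rdiv in Hs. lra. left; now apply Rinv_0_lt_compat.
        * rewrite S_INR. replace ((INR i + 1) / INR N) with (INR i / INR N + / INR N) by (field; lra). rewrite RtoC_plus. ring. }
  intros w Hw. apply (HI N (Nat.le_refl N)). replace (INR N / INR N) with 1 by (field; lra).
  now rewrite Cmult_1_l.
Qed.

Lemma hol_continuous f a (u : nat -> CC) : hol f a -> Clim u a -> Clim (fun n => f (u n)) (f a).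
Proof.
  intros Hf Hu. destruct (hol_bounds f a Hf) as [r [K [Hr [HK [_ [_ HL]]]]]].
  apply Clim_squeeze with (fun n => K * Cmod (u n - a)).
  - apply Clim_eps with (e := r) in Hu; auto. destruct Hu as [N HN]. exists N. intros n Hn.
    generalize (HL a (u n - a)%C). replace (a + (u n - a))%C with (u n) by ring.
    replace (a - a)%C with (RtoC 0) by ring. rewrite Cmod_0. auto.
  - replace (Finite 0) with (Finite (K * 0)) by (f_equal; ring). apply is_lim_seq_mult'. apply is_lim_seq_const. exact Hu.
Qed.

(** * Infinite products and the Gamma function *)

Lemma exp_ge_1_plus (x : R) : 0 <= x -> 1 + x <= exp x.
Proof.
  intros Hx. destruct (Req_dec x 0) as [->|H]. rewrite exp_0; lra. left; apply exp_ineq1; lra.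
Qed.

Lemma inf_prod_diff (x a : nat -> CC) (b : nat -> R) n :
  (forall n, x (S n) = x n * (1 + a n))%C -> (forall n, Cmod (a n) <= b n) ->
  Cmod (x n - x O) <= Cmod (x O) * (exp (rsum b n) - 1).
Proof.
  intros Hx Hb. induction n.
  - simpl. replace (x O - x O)%C with (RtoC 0) by ring. rewrite Cmod_0, exp_0. lra.
  - rewrite Hx. replace (x n * (1 + a n) - x O)%C with ((x n - x O) + x n * a n)%C by ring.
    eapply Rle_trans; [apply Cmod_triangle|]. rewrite Cmod_mult. simpl rsum. rewrite exp_plus.
    assert (H0 : 0 <= b n) by (eapply Rle_trans; [apply Cmod_ge_0|apply Hb]).
    assert (H1 := exp_ge_1_plus (b n) H0). assert (H2 := Hb n).
    assert (H3 : Cmod (x n) <= Cmod (x O) * exp (rsum b n)).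
    { generalize (Cmod_triangle_sub (x n) (x O)). lra. }
    assert (H4 : Cmod (x n) * Cmod (a n) <= Cmod (x O) * exp (rsum b n) * b n).
    { apply Rmult_le_compat; auto using Cmod_ge_0. }
    assert (H5 : Cmod (x O) * exp (rsum b n) * (1 + b n) <= Cmod (x O) * exp (rsum b n) * exp (b n)).
    { apply Rmult_le_compat_l; auto. apply Rmult_le_pos. apply Cmod_ge_0. left; apply exp_pos. }
    lra.
Qed.

Lemma exp_half_lt_2 : exp (1 / 2) < 2.
Proof.
  generalize exp_le_3 (exp_pos (1 / 2)). replace 1 with (1 / 2 + 1 / 2) at 1 by lra. rewrite exp_plus. nra.
Qed.

Lemma Series_tail_small b e : 0 < e -> ex_series b -> exists N, Series b - rsum b N < e.
Proof.
  intros He H. apply ex_series_Series_lim in H. apply is_lim_seq_spec in H.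
  destruct (H (mkposreal e He)) as [N HN]. exists N. specialize (HN N (Nat.le_refl N)).
  simpl in HN. apply Rabs_def2 in HN. lra.
Qed.

(** The partial products are bounded, so their increments x_k a_k form an absolutely convergent
    series and the product is its sum. *)
Lemma inf_prod (x a : nat -> CC) (b : nat -> R) :
  (forall n, x (S n) = x n * (1 + a n))%C -> (forall n, Cmod (a n) <= b n) -> ex_series b ->
  exists l, Clim x l /\ Cmod (l - x O) <= Cmod (x O) * (exp (Series b) - 1) /\ ((forall n, x n <> 0%C) -> l <> 0%C).
Proof.
  intros Hx Hb Eb.
  assert (Hb0 : forall n, 0 <= b n) by (intros; eapply Rle_trans; [apply Cmod_ge_0|apply Hb]).
  assert (HD : forall n, Cmod (x n - x O) <= Cmod (x O) * (exp (Series b) - 1)).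
  { intros n. eapply Rle_trans; [apply (inf_prod_diff x a b n Hx Hb)|].
    apply Rmult_le_compat_l. apply Cmod_ge_0.
    destruct (rsum_le_Series b n Hb0 Eb) as [H|H]. apply exp_increasing in H. lra. rewrite H; lra. }
  set (X := Cmod (x O) * exp (Series b)).
  assert (HX : forall n, Cmod (x n) <= X).
  { intros n. unfold X. generalize (HD n) (Cmod_triangle_sub (x n) (x O)). lra. }
  assert (HS : ex_series (fun k => Cmod (x k * a k))).
  { apply ex_series_Cmod_le with (fun k => X * b k).
    - intros k. rewrite Cmod_mult. apply Rmult_le_compat; auto using Cmod_ge_0.
    - apply (ex_series_scal_l X b Eb). }
  assert (Ex : forall n, x n = (x O + csum (fun k => x k * a k) n)%C).
  { induction n; simpl. ring. rewrite Hx, IHn at 1. ring_simplify. rewrite IHn at 1. ring. }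
  exists (x O + CSer (fun k => x k * a k))%C.
  assert (L : Clim x (x O + CSer (fun k => x k * a k))%C).
  { apply Clim_ext with (fun n => x O + csum (fun k => x k * a k) n)%C. intros; symmetry; apply Ex.
    apply Clim_plus. apply Clim_const. now apply CSer_correct. }
  split; [exact L|split].
  - apply Clim_le with (fun n => x n - x O)%C. exists O; auto. apply Clim_minus; auto using Clim_const.
  (* Beyond [N] the tail of [b] is below 1/2, so the limit differs from x_N by at most (exp(1/2) -
     1)|x_N|, which is less than |x_N|; it cannot be 0. *)
  - intros H0. destruct (Series_tail_small b (1/2) ltac:(lra) Eb) as [N HN].
    assert (HT : Cmod ((x O + CSer (fun k => x k * a k)%C) - x N) <= Cmod (x N) * (exp (1/2) - 1)).
    { apply Clim_le with (fun n => x n - x N)%C; [|apply Clim_minus; auto using Clim_const].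
      exists N. intros n Hn.
      generalize (inf_prod_diff (fun k => x (N + k)%nat) (fun k => a (N + k)%nat) (fun k => b (N + k)%nat) (n - N)).
      replace (N + (n - N))%nat with n by lia. rewrite Nat.add_0_r. intros Q.
      eapply Rle_trans; [apply Q|].
      - intros m. rewrite Nat.add_succ_r. apply Hx.
      - intros; apply Hb.
      - apply Rmult_le_compat_l. apply Cmod_ge_0.
        generalize (rsum_le_Series b (N + (n - N)) Hb0 Eb). rewrite rsum_split. intros R.
        assert (HE : rsum (fun k => b (N + k)%nat) (n - N) < 1/2) by lra. apply exp_increasing in HE. lra. }
    intros E. rewrite E in HT.
    assert (Hp : 0 < Cmod (x N)) by (apply Cmod_gt_0; auto).
    replace (0 - x N)%C with (- x N)%C in HT by ring. rewrite Cmod_opp in HT.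
    generalize exp_half_lt_2. nra.
Qed.

(** * Real and complex powers, and the Gauss product for 1/Gamma *)

Lemma Rpower_derive p x : 0 < x -> is_derive (fun x => Rpower x p) x (p * Rpower x (p - 1)).
Proof. intros Hx. apply is_derive_Reals. now apply derivable_pt_lim_power. Qed.

Lemma Rpower_pos x p : 0 < Rpower x p.
Proof. apply exp_pos. Qed.

Lemma Rpower_le_base x y p : 0 < x -> x <= y -> 0 <= p -> Rpower x p <= Rpower y p.
Proof. intros Hx Hxy Hp. apply Rle_Rpower_l; auto. Qed.

Lemma Rpower_le_base_neg x y p : 0 < x -> x <= y -> p <= 0 -> Rpower y p <= Rpower x p.
Proof.
  intros Hx Hxy Hp. replace p with (- - p) by ring. rewrite (Rpower_Ropp y), (Rpower_Ropp x).
  apply Rinv_le_contravar. apply Rpower_pos. apply Rpower_le_base; lra.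
Qed.

Lemma INR_S_pos k : 0 < INR (S k).
Proof. apply (lt_INR 0); lia. Qed.

(** The integral test by the mean value theorem: (x+1)^{-p} is at most (x^{1-p} - (x+1)^{1-p}) / (p
    - 1), which telescopes. *)
Lemma ex_series_Rpower p : 1 < p -> ex_series (fun k => Rpower (INR (S k)) (- p)).
Proof.
  intros Hp. apply ex_series_of_bounded with (1 + / (p - 1)).
  - intros; left; apply Rpower_pos.
  - assert (HS : forall n, rsum (fun k => Rpower (INR (S k)) (- p)) (S n) <= 1 + / (p - 1) - / (p - 1) * Rpower (INR (S n)) (1 - p)).
    { induction n.
      - simpl. unfold Rpower. rewrite ln_1, !Rmult_0_r, exp_0. lra.
      - change (rsum (fun k => Rpower (INR (S k)) (- p)) (S (S n))) with
          (rsum (fun k => Rpower (INR (S k)) (- p)) (S n) + Rpower (INR (S (S n))) (- p)).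
        set (x := INR (S n)) in *. assert (Hx : 0 < x) by apply INR_S_pos.
        assert (E : INR (S (S n)) = x + 1) by (rewrite (S_INR (S n)); auto). rewrite E.
        destruct (MVT_gen (fun x => Rpower x (1 - p)) x (x + 1) (fun x => (1 - p) * Rpower x (1 - p - 1))) as [c [Hc EQ]].
        + intros u. rewrite Rmin_left, Rmax_right by lra. intros. apply Rpower_derive; lra.
        + intros u. rewrite Rmin_left, Rmax_right by lra. intros.
          apply derivable_continuous_pt. eexists. apply is_derive_Reals. apply Rpower_derive; lra.
        + rewrite Rmin_left, Rmax_right in Hc by lra. replace (1 - p - 1) with (- p) in EQ by ring.
          assert (Q : Rpower (x + 1) (- p) <= Rpower c (- p)) by (apply Rpower_le_base_neg; lra).
          assert (Q2 : Rpower (x + 1) (- p) <= / (p - 1) * (Rpower x (1 - p) - Rpower (x + 1) (1 - p))).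
          { apply Rmult_le_reg_l with (p - 1); [lra|]. rewrite <- Rmult_assoc, Rinv_r, Rmult_1_l by lra. nra. }
          lra. }
    intros [|n]. simpl. assert (0 < / (p - 1)) by (apply Rinv_0_lt_compat; lra). lra.
    eapply Rle_trans; [apply HS|]. assert (0 < / (p - 1)) by (apply Rinv_0_lt_compat; lra).
    generalize (Rpower_pos (INR (S n)) (1 - p)). nra.
Qed.

Lemma ex_series_scalR (c : R) a : ex_series a -> ex_series (fun k => c * a k).
Proof. exact (ex_series_scal_l c a). Qed.

Lemma ex_series_inv_sq c : ex_series (fun k => c * / (INR (S k)) ^ 2).
Proof.
  apply ex_series_scalR. apply ex_series_ext with (fun k => Rpower (INR (S k)) (Ropp 2)).
  - intros k. rewrite Rpower_Ropp. f_equal. replace 2 with (INR 2) by (simpl; lra). apply Rpower_pow, INR_S_pos.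
  - apply ex_series_Rpower. lra.
Qed.

Lemma cpow_plus a (z w : CC) : cpow a (z + w) = (cpow a z * cpow a w)%C.
Proof. unfold cpow. rewrite <- cexp_plus. f_equal. ring. Qed.

Lemma cpow_minus a (z w : CC) : cpow a (z - w) = (cpow a z / cpow a w)%C.
Proof. unfold cpow. rewrite <- cexp_minus. f_equal. ring. Qed.

Lemma cpow_opp a (z : CC) : cpow a (- z) = (/ cpow a z)%C.
Proof. unfold cpow. rewrite <- cexp_opp. f_equal. ring. Qed.

Lemma cpow_neq_0 a (z : CC) : cpow a z <> 0%C.
Proof. apply cexp_neq_0. Qed.

Lemma Cmod_cpow a (z : CC) : Cmod (cpow a z) = Rpower a (fst z).
Proof. unfold cpow, Rpower. rewrite Cmod_cexp. f_equal. simpl. ring. Qed.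

Lemma cpow_mult_base a b (z : CC) : 0 < a -> 0 < b -> cpow (a * b) z = (cpow a z * cpow b z)%C.
Proof.
  intros Ha Hb. unfold cpow. rewrite ln_mult by auto. rewrite <- cexp_plus. f_equal. rewrite RtoC_plus. ring.
Qed.

Lemma cpow_inv_base a (z : CC) : 0 < a -> cpow (/ a) z = (/ cpow a z)%C.
Proof.
  intros Ha. unfold cpow. rewrite ln_Rinv by auto. rewrite <- cexp_opp. f_equal. rewrite RtoC_opp. ring.
Qed.

Lemma cpow_1 a : 0 < a -> cpow a 1 = RtoC a.
Proof. intros Ha. unfold cpow. rewrite Cmult_1_r, cexp_R, exp_ln; auto. Qed.

Lemma hol_cpow c f a : hol f a -> hol (fun z => cpow c (f z)) a.
Proof. intros. unfold cpow. apply hol_cexp, hol_mult; auto using hol_const. Qed.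

Lemma hol_poch f n a : hol f a -> hol (fun z => poch (f z) n) a.
Proof.
  intros Hf. induction n; simpl. apply hol_const. apply hol_mult; auto. apply hol_plus; auto using hol_const.
Qed.

Lemma poch_neq_0 (z : CC) n : (forall k, (k < n)%nat -> (z + INR k)%C <> 0%C) -> poch z n <> 0%C.
Proof.
  induction n; intros H; simpl. apply RtoC_neq_0; lra. apply Cmult_neq_0; auto.
Qed.

Lemma Cmod_poch_le (z : CC) A n : Cmod z <= A -> Cmod (poch z n) <= fst (poch A n).
Proof.
  intros Hz. assert (HA : 0 <= A) by (eapply Rle_trans; [apply Cmod_ge_0|eauto]).
  assert (E : forall n, snd (poch A n) = 0) by (induction n0; simpl; auto; rewrite IHn0; ring).
  induction n.
  - simpl. rewrite Cmod_1; lra.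
  - simpl poch. rewrite Cmod_mult. simpl. rewrite E. 
    replace (fst (poch A n) * (A + INR n) - 0 * (0 + 0)) with (fst (poch A n) * (A + INR n)) by ring.
    apply Rmult_le_compat; auto using Cmod_ge_0.
    eapply Rle_trans; [apply Cmod_triangle|]. rewrite Cmod_R, Rabs_pos_eq by apply pos_INR. lra.
Qed.

Lemma RfactC n : RtoC (INR (fact n)) <> 0%C.
Proof. apply RtoC_neq_0, INR_fact_neq_0. Qed.

Definition gauss_ratio (z : CC) (n : nat) : CC :=
  ((1 + z * (/ INR (S n))%R) * cexp (z * (ln (INR n) - ln (INR (S n)))%R))%C.

Lemma gauss_seq_S z n : (0 < n)%nat -> gauss_seq z (S n) = (gauss_seq z n * gauss_ratio z n)%C.
Proof.
  intros Hn. unfold gauss_seq, gauss_ratio. change (poch z (S (S n))) with (poch z (S n) * (z + INR (S n)))%C.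
  set (P := poch z (S n)). rewrite fact_simpl, mult_INR, RtoC_mult.
  assert (H1 := INR_S_pos n). assert (H2 : RtoC (INR (S n)) <> 0%C) by (apply RtoC_neq_0; lra).
  replace (z * (ln (INR n) - ln (INR (S n)))%R)%C with (ln (INR n) * z - ln (INR (S n)) * z)%C by (rewrite RtoC_minus; ring).
  rewrite cexp_minus. unfold cpow. set (e1 := cexp (ln (INR n) * z)). set (e2 := cexp (ln (INR (S n)) * z)).
  assert (e1 <> 0%C) by apply cexp_neq_0. assert (e2 <> 0%C) by apply cexp_neq_0.
  rewrite RtoC_inv by lra. field. repeat split; auto using RfactC.
Qed.

Lemma ln_step_bound n : (0 < n)%nat -> let t := / INR (S n) in
  Rabs (ln (INR n) - ln (INR (S n)) + t) <= 2 * t ^ 2 /\ 0 < t <= / 2.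
Proof.
  intros Hn t. assert (H0 : 1 <= INR n) by (apply (le_INR 1); lia). assert (H1 : INR (S n) = INR n + 1) by apply S_INR.
  assert (Ht : 0 < t) by (apply Rinv_0_lt_compat; lra).
  assert (Ht2 : t <= / 2) by (apply Rinv_le_contravar; lra). split; [|lra].
  assert (HU : ln (INR n) - ln (INR (S n)) <= - t).
  { replace (ln (INR n)) with (ln (INR (S n)) + ln (1 - t)).
    - assert (ln (1 - t) <= - t).
      { rewrite <- (ln_exp (- t)). apply ln_le. lra.
        generalize (exp_ineq1_le (- t)). lra. } lra.
    - rewrite <- ln_mult by lra. f_equal. unfold t. rewrite H1. field. lra. }
  assert (HL : - (t + 2 * t ^ 2) <= ln (INR n) - ln (INR (S n))).
  { assert (ln (INR (S n)) - ln (INR n) <= t + 2 * t ^ 2); [|lra].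
    replace (ln (INR (S n))) with (ln (INR n) + ln (1 + / INR n)).
    - assert (ln (1 + / INR n) <= / INR n).
      { rewrite <- (ln_exp (/ INR n)) at 2. apply ln_le. assert (0 < / INR n) by (apply Rinv_0_lt_compat; lra). lra.
        apply exp_ineq1_le. }
      assert (/ INR n <= t + 2 * t ^ 2); [|lra].
      apply Rmult_le_reg_l with (INR n); [lra|]. rewrite Rinv_r by lra.
      assert (E : INR n = / t - 1) by (unfold t; rewrite Rinv_inv; lra). rewrite E.
      replace ((/ t - 1) * (t + 2 * t ^ 2)) with (1 + t - 2 * t ^ 2) by (field; lra). nra.
    - rewrite <- ln_mult by (try lra; assert (0 < / INR n) by (apply Rinv_0_lt_compat; lra); lra). f_equal. rewrite H1. field. lra. }
  apply Rabs_le. split; nra.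
Qed.

(** With t = 1/(n+1), the factor is (1 + zt) exp(zu) where u = -t + O(t^2), so the linear terms
    cancel. The constant is 16 = 2 + 2 + 12: from u + t, from the product of zt and zu, and from the
    remainder of the exponential. *)
Lemma gauss_ratio_bound A z n : Cmod z <= A -> 1 <= A -> 2 * A <= INR n ->
  Cmod (gauss_ratio z n - 1) <= 16 * A ^ 2 * / (INR (S n)) ^ 2.
Proof.
  intros Hz HA Hn. assert (Hn0 : (0 < n)%nat) by (apply INR_lt; simpl; lra).
  destruct (ln_step_bound n Hn0) as [B1 B2]. set (t := / INR (S n)) in *.
  set (u := ln (INR n) - ln (INR (S n))) in *.
  rewrite <- pow_inv. fold t.
  assert (Hu : Rabs u <= 2 * t).
  { replace u with (u + t + - t) by ring. eapply Rle_trans; [apply Rabs_triang|].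
    rewrite Rabs_Ropp, (Rabs_pos_eq t) by lra. nra. }
  assert (HtA : 2 * A * t <= 1).
  { unfold t. apply Rmult_le_reg_r with (INR (S n)). apply INR_S_pos. rewrite Rmult_assoc, Rinv_l, S_INR; [lra|].
    generalize (INR_S_pos n); lra. }
  assert (Hzu : Cmod (z * u) <= 2 * A * t).
  { rewrite Cmod_mult, Cmod_R. generalize (Cmod_ge_0 z) (Rabs_pos u). nra. }
  unfold gauss_ratio. fold t u. set (E := (cexp (z * u) - 1 - z * u)%C).
  assert (HE : Cmod E <= 6 * A ^ 2 * t ^ 2).
  { unfold E. eapply Rle_trans; [apply cexp_sub1h; lra|].
    replace (6 * A ^ 2 * t ^ 2) with (3/2 * (2 * A * t) ^ 2) by field. apply Rmult_le_compat_l; [lra|].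
    apply pow_incr. split; auto using Cmod_ge_0. }
  replace (cexp (z * u)) with (1 + z * u + E)%C by (unfold E; ring).
  replace (_ - 1)%C with (z * (u + t)%R + z * t * (z * u) + E * (1 + z * t))%C by (rewrite RtoC_plus; ring).
  eapply Rle_trans; [apply Cmod_triangle|]. eapply Rle_trans; [apply Rplus_le_compat_r, Cmod_triangle|].
  rewrite !(Cmod_mult z), !Cmod_mult, !Cmod_R.
  assert (Hzt : Cmod z * Rabs t <= A * t) by (rewrite Rabs_pos_eq by lra; apply Rmult_le_compat_r; lra).
  rewrite Cmod_mult, Cmod_R in Hzu.
  assert (H1zt : Cmod (1 + z * t) <= 2).
  { eapply Rle_trans; [apply Cmod_triangle|]. rewrite Cmod_1, Cmod_mult, Cmod_R. lra. }
  generalize (Cmod_ge_0 z); intros P0.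
  assert (T1 : Cmod z * Rabs (u + t) <= A * (2 * t ^ 2)) by (apply Rmult_le_compat; auto using Rabs_pos).
  assert (T2 : Cmod z * Rabs t * (Cmod z * Rabs u) <= A * t * (2 * A * t)).
  { apply Rmult_le_compat; auto; apply Rmult_le_pos; auto using Rabs_pos. }
  assert (T3 : Cmod E * Cmod (1 + z * t) <= 6 * A ^ 2 * t ^ 2 * 2) by (apply Rmult_le_compat; auto using Cmod_ge_0).
  assert (A * (2 * t ^ 2) <= A ^ 2 * (2 * t ^ 2)) by (generalize (pow2_ge_0 t); nra).
  nra.
Qed.

(** From [N] on the sequence is an infinite product with factors 1 + O(1/n^2). Neither [N] nor the
    bound depends on [z] beyond |z| <= A; this uniformity is what [hol_rgamma_id] feeds to
    [hol_limit]. *)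
Lemma gauss_tail A z N : Cmod z <= A -> 1 <= A -> 2 * A <= INR N ->
  exists l, Clim (gauss_seq z) l /\ 
   (forall n, Cmod (gauss_seq z (N + n)%nat) <= Cmod (gauss_seq z N) * exp (Series (fun k => 16 * A ^ 2 * / INR (S k) ^ 2))) /\
   ((forall k : nat, (z + INR k)%C <> 0%C) -> l <> 0%C).
Proof.
  intros Hz HA HN. assert (HN0 : (0 < N)%nat) by (apply INR_lt; simpl; lra).
  set (x := fun n => gauss_seq z (N + n)%nat). set (a := fun n => (gauss_ratio z (N + n) - 1)%C).
  set (b := fun k => 16 * A ^ 2 * / INR (S k) ^ 2).
  assert (Hx : forall n, x (S n) = (x n * (1 + a n))%C).
  { intros n. unfold x, a. rewrite Nat.add_succ_r, gauss_seq_S by lia. f_equal. ring. }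
  assert (Hb : forall n, Cmod (a n) <= b n).
  { intros n. unfold a, b. eapply Rle_trans. apply (gauss_ratio_bound A z (N + n) Hz HA).
    rewrite plus_INR. generalize (pos_INR n); lra.
    apply Rmult_le_compat_l. generalize (pow2_ge_0 A); lra. apply Rinv_le_contravar. apply pow_lt, INR_S_pos.
    apply pow_incr. split. left; apply INR_S_pos. apply le_INR. lia. }
  assert (Eb : ex_series b) by apply ex_series_inv_sq.
  destruct (inf_prod x a b Hx Hb Eb) as [l [L1 [L2 L3]]]. exists l. split; [|split].
  - apply Clim_decr with N. apply Clim_ext with (2 := L1). intros n. unfold x. f_equal. lia.
  - intros n. assert (D := inf_prod_diff x a b n Hx Hb). unfold x in D at 1 2 3. rewrite Nat.add_0_r in D.
    assert (Hb0 : forall k, 0 <= b k) by (intros; eapply Rle_trans; [apply Cmod_ge_0|apply Hb]).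
    assert (HE : exp (rsum b n) <= exp (Series b)).
    { destruct (rsum_le_Series b n Hb0 Eb) as [H|H]. left; now apply exp_increasing. rewrite H; lra. }
    generalize (Cmod_triangle_sub (gauss_seq z (N + n)) (gauss_seq z N)) (Cmod_ge_0 (gauss_seq z N)). fold b. nra.
  - intros H0. apply L3. intros n. unfold x, gauss_seq. unfold Cdiv. apply Cmult_neq_0.
    apply poch_neq_0; auto. apply Cmod_gt_0. rewrite Cmod_inv. apply Rinv_0_lt_compat, Cmod_gt_0.
    all: apply Cmult_neq_0; [apply RfactC|apply cpow_neq_0].
Qed.

Lemma rgamma_eq z l : Clim (gauss_seq z) l -> rgamma z = l.
Proof.
  intros H. apply Clim_components in H as [A B]. unfold rgamma.
  apply is_lim_seq_unique in A, B. rewrite A, B. now destruct l.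
Qed.

Lemma exists_INR_ge (x : R) : exists N : nat, x <= INR N.
Proof. destruct (INR_unbounded x) as [n Hn]. exists n. lra. Qed.

Lemma gauss_lim z : Clim (gauss_seq z) (rgamma z).
Proof.
  set (A := Cmod z + 1). destruct (exists_INR_ge (2 * A)) as [N HN].
  generalize (Cmod_ge_0 z); intros.
  destruct (gauss_tail A z N) as [l [L _]]; try (unfold A in *; lra). now rewrite (rgamma_eq z l L).
Qed.

Lemma rgamma_neq_0 (z : CC) : (forall k : nat, (z + INR k)%C <> 0%C) -> rgamma z <> 0%C.
Proof.
  intros H0. set (A := Cmod z + 1). destruct (exists_INR_ge (2 * A)) as [N HN].
  generalize (Cmod_ge_0 z); intros.
  destruct (gauss_tail A z N) as [l [L [_ L2]]]; try (unfold A in *; lra). rewrite (rgamma_eq z l L). auto.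
Qed.

Lemma Cmod_gauss_seq_le A z N : Cmod z <= A -> (0 < N)%nat ->
  Cmod (gauss_seq z N) <= fst (poch A (S N)) * Rpower (INR N) A.
Proof.
  intros Hz HN. unfold gauss_seq. assert (H1 : 1 <= INR N) by (apply (le_INR 1); lia).
  rewrite Cmod_div by (apply Cmult_neq_0; [apply RfactC|apply cpow_neq_0]).
  assert (HF : 1 <= INR (fact N)) by (apply (le_INR 1), lt_O_fact).
  rewrite Cmod_mult, Cmod_cpow, Cmod_R, Rabs_pos_eq by lra.
  apply Rmult_le_compat; auto using Cmod_ge_0, Cmod_poch_le.
  - left. apply Rinv_0_lt_compat. apply Rmult_lt_0_compat. lra. apply Rpower_pos.
  - replace (Rpower (INR N) A) with (/ Rpower (INR N) (- A)) by (rewrite <- Rpower_Ropp; f_equal; ring).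
    apply Rinv_le_contravar. apply Rpower_pos.
    assert (Rpower (INR N) (- A) <= Rpower (INR N) (fst z)).
    { destruct (Req_dec (INR N) 1) as [E|E]. rewrite E. unfold Rpower. rewrite ln_1, !Rmult_0_r. lra.
      apply Rle_Rpower; [lra|]. generalize (Cmod_fst_le z) (Rabs_le_between (fst z) A). intros Q1 Q2.
      apply Q2. lra. }
    generalize (Rpower_pos (INR N) (- A)). nra.
Qed.

Lemma hol_gauss_seq n a : hol (fun z => gauss_seq z n) a.
Proof.
  unfold gauss_seq. apply hol_div.
  - apply hol_poch, hol_id.
  - apply hol_mult. apply hol_const. apply hol_cpow, hol_id.
  - apply Cmult_neq_0; [apply RfactC|apply cpow_neq_0].
Qed.

Lemma hol_rgamma_id a : hol rgamma a.
Proof.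
  set (A := Cmod a + 2). destruct (exists_INR_ge (2 * A)) as [N HN]. generalize (Cmod_ge_0 a); intros Ha.
  assert (HN0 : (0 < N)%nat) by (apply INR_lt; simpl; unfold A in *; lra).
  assert (HD : forall w, Cmod (w - a) < 1 -> Cmod w <= A).
  { intros w Hw. generalize (Cmod_triangle_sub w a). unfold A; lra. }
  apply hol_limit with (F := fun k z => gauss_seq z (N + k)) (R0 := 1)
    (M := fst (poch A (S N)) * Rpower (INR N) A * exp (Series (fun k => 16 * A ^ 2 * / INR (S k) ^ 2))).
  - lra.
  - intros; apply hol_gauss_seq.
  - intros k w Hw. destruct (gauss_tail A w N) as [l [_ [B _]]]; auto. unfold A; lra.
    eapply Rle_trans; [apply B|]. apply Rmult_le_compat_r. left; apply exp_pos. apply Cmod_gauss_seq_le; auto.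
  - intros w _. apply Clim_ext with (fun k => gauss_seq w (k + N)). intros; f_equal; lia.
    apply Clim_incr, gauss_lim.
Qed.

Lemma hol_rgamma f a : hol f a -> hol (fun z => rgamma (f z)) a.
Proof. intros. apply (hol_comp rgamma f); auto using hol_rgamma_id. Qed.

Lemma hol_Gamma f a : hol f a -> (forall k : nat, (f a + INR k)%C <> 0%C) -> hol (fun z => Gamma (f z)) a.
Proof. intros. unfold Gamma. apply hol_inv. now apply hol_rgamma. now apply rgamma_neq_0. Qed.

(** * The continuation and its poles *)

Lemma cexp_eq_1 (z : CC) : cexp z = 1%C -> exists m : Z, z = im (2 * PI * IZR m).
Proof.
  intros E. assert (E0 := f_equal Cmod E). rewrite Cmod_cexp, Cmod_1 in E0.
  assert (Hx : fst z = 0) by (rewrite <- (ln_exp (fst z)), E0; apply ln_1).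
  assert (E1 := f_equal fst E). simpl in E1. rewrite Hx, exp_0, Rmult_1_l in E1.
  replace (snd z) with (2 * (snd z / 2)) in E1 by field. rewrite cos_2a_sin in E1.
  assert (Hs : sin (snd z / 2) = 0) by nra.
  destruct (sin_eq_0_0 _ Hs) as [m Hm]. exists m. apply C_eq; simpl; lra.
Qed.

Lemma cexp_2PI_Z m : cexp (im (2 * PI * IZR m)) = 1%C.
Proof.
  assert (H : forall n : nat, cexp (im (2 * PI * INR n)) = 1%C).
  { intros n. rewrite <- (cexp_2PI_nat n). do 2 f_equal. ring. }
  destruct (Z_le_dec 0 m) as [Hm|Hm].
  - rewrite <- (Z2Nat.id m), <- INR_IZR_INZ by auto. apply H.
  - replace (im (2 * PI * IZR m)) with (- im (2 * PI * INR (Z.to_nat (- m))))%C.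
    + rewrite cexp_opp, H. field.
    + rewrite INR_IZR_INZ, Z2Nat.id, opp_IZR by lia. apply C_eq; simpl; ring.
Qed.

Definition bcoef (s : CC) (j : nat) : CC := (poch s j / INR (fact j))%C.

(* The exponent is 4L (j + s/2); it lies in 2 pi i Z exactly at the poles with k = j. *)
Definition bexp (L : R) (s : CC) (j : nat) : CC := ((2 * L)%R * (s + (2 * INR j)%R))%C.

Definition Sterm (L : R) (s : CC) (j : nat) : CC := (bcoef s j / (cexp (bexp L s j) - 1))%C.

(* q^{-s/2} Z(s): expand (e^X - e^{-X})^{-s} by the binomial series and sum over X = 2L, 4L, 6L, ... *)
Definition SL (L : R) (s : CC) : CC := CSer (Sterm L s).

Definition bcoef_majorant (A : R) (j : nat) : R := fst (poch A j) / INR (fact j).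

Lemma snd_poch_R A n : snd (poch (RtoC A) n) = 0.
Proof. induction n; simpl; auto. rewrite IHn; ring. Qed.

Lemma Cmod_bcoef_le (s : CC) A j : Cmod s <= A -> Cmod (bcoef s j) <= bcoef_majorant A j.
Proof.
  intros Hs. unfold bcoef, bcoef_majorant. rewrite Cmod_div by apply RfactC.
  rewrite Cmod_R, Rabs_pos_eq by apply pos_INR. apply Rmult_le_compat_r.
  left; apply Rinv_0_lt_compat, INR_fact_lt_0. now apply Cmod_poch_le.
Qed.

Lemma bcoef_majorant_S A j : bcoef_majorant A (S j) = bcoef_majorant A j * ((A + INR j) / INR (S j)).
Proof.
  unfold bcoef_majorant. simpl poch. cbn [fst Cmult]. rewrite snd_poch_R. rewrite fact_simpl, mult_INR.
  simpl fst. simpl snd. field. split; [apply not_0_INR; lia|apply INR_fact_neq_0].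
Qed.

Lemma bcoef_majorant_pos A j : 0 < A -> 0 < bcoef_majorant A j.
Proof.
  intros HA. induction j. unfold bcoef_majorant; simpl; lra. rewrite bcoef_majorant_S. apply Rmult_lt_0_compat; auto.
  apply Rdiv_lt_0_compat. generalize (pos_INR j); lra. apply INR_S_pos.
Qed.

Lemma bcoef_S (s : CC) j : bcoef s (S j) = (bcoef s j * ((s + INR j) / INR (S j)))%C.
Proof.
  unfold bcoef. simpl poch. rewrite fact_simpl, mult_INR, RtoC_mult. field.
  split; [|apply RfactC]. apply RtoC_neq_0, not_0_INR; lia.
Qed.

Lemma ex_series_bcoef_majorant A x : 0 < A -> 0 < x < 1 -> ex_series (fun j => bcoef_majorant A j * x ^ j).
Proof.
  intros HA Hx. apply ex_series_ext with (fun j => Rabs (bcoef_majorant A j * x ^ j)).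
  { intros j. apply Rabs_pos_eq. apply Rmult_le_pos. left; now apply bcoef_majorant_pos. apply pow_le; lra. }
  apply ex_series_DAlembert with x; [lra| |].
  - intros j. apply Rgt_not_eq. apply Rmult_lt_0_compat. now apply bcoef_majorant_pos. apply pow_lt; lra.
  - apply is_lim_seq_ext with (fun j => (1 + (A - 1) / INR (S j)) * x).
    + intros j. rewrite Rabs_pos_eq.
      * rewrite bcoef_majorant_S. simpl pow. generalize (bcoef_majorant_pos A j HA) (pow_lt x j (proj1 Hx)). intros.
        rewrite S_INR. field. generalize (pos_INR j); lra.
      * apply Rmult_le_pos. apply Rmult_le_pos. left; now apply bcoef_majorant_pos. apply pow_le; lra.
        left; apply Rinv_0_lt_compat. apply Rmult_lt_0_compat. now apply bcoef_majorant_pos. apply pow_lt; lra.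
    + replace (Finite x) with (Finite ((1 + 0) * x)) by (f_equal; ring).
      apply is_lim_seq_mult'; [|apply is_lim_seq_const]. apply is_lim_seq_plus'. apply is_lim_seq_const.
      apply (is_lim_seq_incr_1 (fun j => (A - 1) / INR j)). apply is_lim_seq_inv_INR.
Qed.

Lemma cexp_sub1_inv_bound (u : CC) : 1 <= fst u -> Cmod (/ (cexp u - 1)) <= 2 * exp (- fst u).
Proof.
  intros Hu. rewrite exp_Ropp.
  replace (2 * / exp (fst u)) with (/ (exp (fst u) / 2)) by (field; apply Rgt_not_eq, exp_pos).
  apply Cmod_inv_le. generalize (exp_pos (fst u)); lra.
  generalize (Cmod_triangle_sub (cexp u) 1). rewrite Cmod_cexp, Cmod_1.
  assert (2 <= exp (fst u)) by (generalize (exp_ineq1_le (fst u)); lra). lra.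
Qed.

Lemma fst_bexp L s j : fst (bexp L s j) = 2 * L * (fst s + 2 * INR j).
Proof. unfold bexp. simpl. ring. Qed.

Lemma snd_bexp L s j : snd (bexp L s j) = 2 * L * snd s.
Proof. unfold bexp. simpl. ring. Qed.

Lemma bexp_pole L s j : 0 < L -> cexp (bexp L s j) = 1%C -> pole_set L s.
Proof.
  intros HL E. destruct (cexp_eq_1 _ E) as [m Hm]. exists m, j.
  assert (E1 := f_equal fst Hm). assert (E2 := f_equal snd Hm). rewrite fst_bexp in E1. rewrite snd_bexp in E2. simpl in E1, E2.
  apply C_eq; cbn [fst snd].
  - nra.
  - apply Rmult_eq_reg_l with (2 * L); [|lra]. rewrite E2. field. lra.
Qed.

(** The last hypothesis puts the real part of the exponent u above 1, where |e^u - 1| is at least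
    half of |e^u|; the exponent grows by 4L with each j, hence the geometric ratio. *)
Lemma Sterm_bound L A (s : CC) j : 0 < L -> Cmod s <= A -> 1 <= 2 * L * (2 * INR j - A) ->
  Cmod (Sterm L s j) <= 2 * exp (2 * L * A) * (bcoef_majorant A j * exp (- (4 * L)) ^ j).
Proof.
  intros HL Hs Hj. unfold Sterm, Cdiv. rewrite Cmod_mult.
  assert (Hf : - A <= fst s) by (generalize (Cmod_fst_le s) (Rabs_le_between (fst s) A); intros Q1 Q2; apply Q2; lra).
  assert (HU : 2 * L * (2 * INR j - A) <= fst (bexp L s j)).
  { rewrite fst_bexp. apply Rmult_le_compat_l; lra. }
  replace (2 * exp (2 * L * A) * (bcoef_majorant A j * exp (- (4 * L)) ^ j)) with
    (bcoef_majorant A j * (2 * exp (- (2 * L * (2 * INR j - A))))).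
  - apply Rmult_le_compat; auto using Cmod_ge_0, Cmod_bcoef_le.
    eapply Rle_trans; [apply cexp_sub1_inv_bound; lra|]. apply Rmult_le_compat_l; [lra|].
    destruct (Req_dec (fst (bexp L s j)) (2 * L * (2 * INR j - A))) as [->|Hne]; [lra|]. left. apply exp_increasing. lra.
  - replace (exp (- (4 * L)) ^ j) with (exp (INR j * - (4 * L))).
    + replace (- (2 * L * (2 * INR j - A))) with (2 * L * A + INR j * - (4 * L)) by ring. rewrite exp_plus. ring.
    + rewrite <- Rpower_pow by apply exp_pos. unfold Rpower. now rewrite ln_exp.
Qed.

Lemma hol_neq_0_near f a : hol f a -> f a <> 0%C -> exists r, 0 < r /\ forall w, Cmod (w - a) < r -> f w <> 0%C.
Proof.
  intros Hf H0. destruct (hol_bounds f a Hf) as [r [K [Hr [HK [_ [_ HL]]]]]].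
  assert (Hp : 0 < Cmod (f a)) by now apply Cmod_gt_0.
  exists (Rmin r (Cmod (f a) / (K + 1))). split. apply Rmin_glb_lt; auto. apply Rdiv_lt_0_compat; lra.
  intros w Hw E. assert (A1 := Rlt_le_trans _ _ _ Hw (Rmin_l _ _)). assert (A2 := Rlt_le_trans _ _ _ Hw (Rmin_r _ _)).
  generalize (HL a (w - a)%C). replace (a + (w - a))%C with w by ring.
  replace (a - a)%C with (RtoC 0) by ring. rewrite Cmod_0. intros Q. specialize (Q Hr A1). rewrite E in Q.
  replace (0 - f a)%C with (- f a)%C in Q by ring. rewrite Cmod_opp in Q.
  apply Rmult_lt_compat_r with (r := K + 1) in A2; [|lra]. unfold Rdiv in A2. rewrite Rmult_assoc, Rinv_l in A2 by lra.
  generalize (Cmod_ge_0 (w - a)). nra.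
Qed.

Lemma forall_near_finite (P : nat -> CC -> Prop) a J :
  (forall j, (j < J)%nat -> exists r, 0 < r /\ forall w, Cmod (w - a) < r -> P j w) ->
  exists r, 0 < r /\ forall j w, (j < J)%nat -> Cmod (w - a) < r -> P j w.
Proof.
  induction J; intros H. exists 1; split; [lra|]. intros; lia.
  destruct IHJ as [r [Hr HP]]. intros; apply H; lia.
  destruct (H J ltac:(lia)) as [r2 [Hr2 HP2]]. exists (Rmin r r2). split. now apply Rmin_glb_lt.
  intros j w Hj Hw. assert (A1 := Rlt_le_trans _ _ _ Hw (Rmin_l _ _)). assert (A2 := Rlt_le_trans _ _ _ Hw (Rmin_r _ _)).
  destruct (Nat.eq_dec j J) as [->|Hne]; auto. apply HP; auto; lia.
Qed.

Lemma hol_bexp L j a : hol (fun s => bexp L s j) a.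
Proof. unfold bexp. apply hol_mult. apply hol_const. apply hol_plus. apply hol_id. apply hol_const. Qed.

(* Leaving one index out isolates the pole that it carries. *)
Definition Spart (good : nat -> bool) (L : R) (s : CC) (j : nat) : CC := if good j then Sterm L s j else 0%C.

(** Beyond [J] the exponent has real part at least 1 throughout the unit disc about [a], which
    excludes poles and yields the geometric majorant. The finitely many smaller indices are met by
    shrinking the radius. *)
Lemma Spart_near good L a : 0 < L -> (forall j, good j = true -> cexp (bexp L a j) <> 1%C) ->
  exists r J, 0 < r /\ r <= 1 /\ 
   (forall j w, Cmod (w - a) < r -> good j = true -> cexp (bexp L w j) <> 1%C) /\
   (forall j w, Cmod (w - a) < r -> (J <= j)%nat ->
     Cmod (Spart good L w j) <= 2 * exp (2 * L * (Cmod a + 2)) * (bcoef_majorant (Cmod a + 2) j * exp (- (4 * L)) ^ j)).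
Proof.
  intros HL Ha. set (A := Cmod a + 2). destruct (exists_INR_ge (A + / (4 * L))) as [J HJ].
  assert (HA : forall w, Cmod (w - a) < 1 -> Cmod w <= A) by (intros w Hw; generalize (Cmod_triangle_sub w a); unfold A; lra).
  assert (HJj : forall j, (J <= j)%nat -> 1 <= 2 * L * (2 * INR j - A)).
  { intros j Hj. apply le_INR in Hj. assert (A + / (4 * L) <= INR j) by lra.
    assert (4 * L * / (4 * L) = 1) by (field; lra). assert (0 < A) by (unfold A; generalize (Cmod_ge_0 a); lra).
    assert (0 < / (4 * L)) by (apply Rinv_0_lt_compat; lra). nra. }
  assert (HF := forall_near_finite (fun j w => good j = true -> cexp (bexp L w j) <> 1%C) a J).
  destruct HF as [r [Hr HP]].
  { intros j Hj. destruct (good j) eqn:E.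
    - destruct (hol_neq_0_near (fun s => cexp (bexp L s j) - 1)%C a) as [r [Hr Hw]].
      + apply hol_minus. apply hol_cexp, hol_bexp. apply hol_const.
      + intros E2. apply (Ha j E). replace (cexp (bexp L a j)) with (cexp (bexp L a j) - 1 + 1)%C by ring. rewrite E2. ring.
      + exists r. split; auto. intros w H1 _ E2. apply (Hw w H1). rewrite E2. ring.
    - exists 1. split; [lra|]. intros; discriminate. }
  exists (Rmin r 1), J. split; [apply Rmin_glb_lt; lra|split; [apply Rmin_r|split]].
  - intros j w Hw Hg. assert (A1 := Rlt_le_trans _ _ _ Hw (Rmin_l _ _)). assert (A2 := Rlt_le_trans _ _ _ Hw (Rmin_r _ _)).
    destruct (le_lt_dec J j) as [Hj|Hj]; [|apply HP; auto]. intros E.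
    assert (Q := cexp_eq_1 _ E). destruct Q as [m Hm]. assert (E1 := f_equal fst Hm). rewrite fst_bexp in E1. simpl in E1.
    specialize (HJj j Hj). generalize (Cmod_fst_le w) (Rabs_le_between (fst w) A) (HA w A2). intros Q1 Q2 Q3.
    assert (Q4 : - A <= fst w) by (apply Q2; lra). nra.
  - intros j w Hw Hj. assert (A2 := Rlt_le_trans _ _ _ Hw (Rmin_r _ _)). unfold Spart. destruct (good j).
    + apply Sterm_bound; auto.
    + rewrite Cmod_0. apply Rmult_le_pos. generalize (exp_pos (2 * L * A)); lra. apply Rmult_le_pos.
      left; apply bcoef_majorant_pos. unfold A; generalize (Cmod_ge_0 a); lra. apply pow_le. left; apply exp_pos.
Qed.

Lemma ex_series_Sbound L A : 0 < L -> 0 < A -> ex_series (fun j => 2 * exp (2 * L * A) * (bcoef_majorant A j * exp (- (4 * L)) ^ j)).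
Proof.
  intros HL HA. apply ex_series_scalR. apply ex_series_bcoef_majorant; auto. split. apply exp_pos.
  rewrite <- exp_0. apply exp_increasing. lra.
Qed.

Lemma hol_bcoef j a : hol (fun s => bcoef s j) a.
Proof. unfold bcoef. apply hol_div. apply hol_poch, hol_id. apply hol_const. apply RfactC. Qed.

Lemma hol_Sterm L j a : cexp (bexp L a j) <> 1%C -> hol (fun s => Sterm L s j) a.
Proof.
  intros H. unfold Sterm. apply hol_div. apply hol_bcoef.
  apply hol_minus. apply hol_cexp, hol_bexp. apply hol_const.
  intros E2. apply H. replace (cexp (bexp L a j)) with (cexp (bexp L a j) - 1 + 1)%C by ring. rewrite E2. ring.
Qed.

Lemma ex_series_Spart good L a : 0 < L -> (forall j, good j = true -> cexp (bexp L a j) <> 1%C) ->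
  ex_series (fun j => Cmod (Spart good L a j)).
Proof.
  intros HL Ha. destruct (Spart_near good L a HL Ha) as [r [J [Hr [_ [_ HB]]]]].
  apply ex_series_shift with J.
  apply ex_series_Cmod_le with (fun k => 2 * exp (2 * L * (Cmod a + 2)) * (bcoef_majorant (Cmod a + 2) (J + k) * exp (- (4 * L)) ^ (J + k))).
  - intros k. apply HB. replace (a - a)%C with (RtoC 0) by ring. now rewrite Cmod_0. lia.
  - apply (ex_series_incr_n (fun j => 2 * exp (2 * L * (Cmod a + 2)) * (bcoef_majorant (Cmod a + 2) j * exp (- (4 * L)) ^ j)) J).
    apply ex_series_Sbound; auto. generalize (Cmod_ge_0 a); lra.
Qed.

Lemma hol_Spart good L a : 0 < L -> (forall j, good j = true -> cexp (bexp L a j) <> 1%C) ->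
  hol (fun s => CSer (Spart good L s)) a.
Proof.
  intros HL Ha. destruct (Spart_near good L a HL Ha) as [r [J [Hr [_ [HN HB]]]]].
  apply (hol_series_ev (fun j s => Spart good L s j)) with (R0 := r) (J := J)
   (b := fun j => 2 * exp (2 * L * (Cmod a + 2)) * (bcoef_majorant (Cmod a + 2) j * exp (- (4 * L)) ^ j)); auto.
  - intros k w Hw. specialize (HN k w Hw). unfold Spart. destruct (good k). apply hol_Sterm; auto. apply hol_const.
  - apply ex_series_Sbound; auto. generalize (Cmod_ge_0 a); lra.
Qed.

Lemma hol_SL L a : 0 < L -> ~ pole_set L a -> hol (SL L) a.
Proof.
  intros HL Ha. apply (hol_Spart (fun _ => true) L a HL). intros j _ E. apply Ha. now apply bexp_pole with j.
Qed.

Lemma ex_series_Sterm L a : 0 < L -> ~ pole_set L a -> ex_series (fun j => Cmod (Sterm L a j)).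
Proof.
  intros HL Ha. apply (ex_series_Spart (fun _ => true) L a HL). intros j _ E. apply Ha. now apply bexp_pole with j.
Qed.

Definition expm1_quot (w : CC) : CC := if Ceq_dec w 0 then 1%C else ((cexp w - 1) / w)%C.

(** A Riemann sum for the integral of e^{tw} over 0 <= t <= 1. These sums are entire and bounded on
    discs, so the removable singularity of (e^w - 1)/w is settled by [hol_limit], without power
    series. *)
Definition expm1_mean (n : nat) (w : CC) : CC := (/ INR (S n) * csum (fun k => cexp (w / INR (S n)) ^ k) (S n))%C.

Lemma expm1_mean_lim w : Clim (fun n => expm1_mean n w) (expm1_quot w).
Proof.
  unfold expm1_quot. destruct (Ceq_dec w 0) as [->|Hw].
  - apply Clim_ext with (fun _ => RtoC 1); [|apply Clim_const]. intros n. unfold expm1_mean.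
    assert (H : RtoC (INR (S n)) <> 0%C) by (apply RtoC_neq_0, not_0_INR; lia).
    rewrite (csum_ext _ (fun _ => RtoC 1)), csum_const. field. auto.
    intros k _. replace (0 / INR (S n))%C with (RtoC 0) by (unfold Cdiv; ring). rewrite cexp_0. apply Cpow_1_l.
  (* By the geometric sum the mean equals (e^w - 1) / d_n as soon as d_n is nonzero, and d_n tends
     to w. *)
  - set (d := fun n => (INR (S n) * (cexp (w / INR (S n)) - 1))%C).
    assert (Hd : Clim d w).
    { apply Clim_squeeze with (fun n => 3/2 * Cmod w ^ 2 / INR (S n)).
      2: apply (is_lim_seq_incr_1 (fun n => 3/2 * Cmod w ^ 2 / INR n)); apply is_lim_seq_inv_INR.
      destruct (exists_INR_ge (Cmod w)) as [N HN]. exists N. intros n Hn. apply le_INR in Hn.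
      assert (H1 := INR_S_pos n). assert (H : RtoC (INR (S n)) <> 0%C) by (apply RtoC_neq_0; lra).
      assert (H2 : INR n <= INR (S n)) by (rewrite S_INR; lra).
      assert (E : Cmod (w / INR (S n)) = Cmod w / INR (S n)).
      { rewrite Cmod_div, Cmod_R, Rabs_pos_eq; auto; lra. }
      unfold d. replace (_ - w)%C with (INR (S n) * (cexp (w / INR (S n)) - 1 - w / INR (S n)))%C by (field; auto).
      rewrite Cmod_mult, Cmod_R, Rabs_pos_eq by lra.
      apply Rle_trans with (INR (S n) * (3/2 * (Cmod w / INR (S n)) ^ 2)).
      - apply Rmult_le_compat_l; [lra|]. rewrite <- E. apply cexp_sub1h. rewrite E.
        apply Rmult_le_reg_r with (INR (S n)); auto. unfold Rdiv. rewrite Rmult_assoc, Rinv_l; lra.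
      - right. field. lra. }
    assert (Hw0 : 0 < Cmod w) by now apply Cmod_gt_0.
    assert (Hd0 : exists N, forall n, (N <= n)%nat -> d n <> 0%C).
    { apply Clim_eps with (e := Cmod w) in Hd; auto. destruct Hd as [N HN]. exists N. intros n Hn E.
      specialize (HN n Hn). rewrite E in HN. replace (0 - w)%C with (- w)%C in HN by ring. rewrite Cmod_opp in HN. lra. }
    destruct Hd0 as [N HN].
    apply Clim_ext_loc with (fun n => (cexp w - 1) * / d n)%C.
    + exists N. intros n Hn. specialize (HN n Hn). unfold expm1_mean, d in *.
      assert (H : RtoC (INR (S n)) <> 0%C) by (apply RtoC_neq_0, not_0_INR; lia).
      set (x := cexp (w / INR (S n))) in *. assert (G := geom_sum x (S n)).
      assert (Ex : (x ^ S n)%C = cexp w).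
      { unfold x. rewrite cexp_pow. f_equal. field. auto. }
      rewrite Ex in G. replace (cexp w - 1)%C with (- (1 - cexp w))%C by ring. rewrite <- G.
      assert ((x - 1)%C <> 0%C) by (intros E; apply HN; rewrite E; ring). field. auto.
    + apply Clim_scal. apply Clim_inv; auto.
Qed.

Lemma hol_expm1_quot a : hol expm1_quot a.
Proof.
  apply hol_limit with (F := expm1_mean) (R0 := 1) (M := exp (Cmod a + 1)).
  - lra.
  - intros k w _. unfold expm1_mean. apply hol_mult. apply hol_const. apply hol_csum. intros j _.
    apply hol_pow, hol_cexp. apply hol_mult. apply hol_id. apply hol_const.
  - intros k w Hw. apply mean_bound; [lia|]. intros j Hj. rewrite cexp_pow, Cmod_cexp.
    assert (H1 := INR_S_pos k). assert (H : RtoC (INR (S k)) <> 0%C) by (apply RtoC_neq_0; lra).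
    replace (INR j * (w / INR (S k)))%C with ((INR j / INR (S k))%R * w)%C by (rewrite RtoC_div by lra; field; auto).
    rewrite fst_RC_mult. assert (Hq : 0 <= INR j / INR (S k) <= 1).
    { split. apply Rmult_le_pos. apply pos_INR. left; now apply Rinv_0_lt_compat.
      apply Rmult_le_reg_r with (INR (S k)); auto. unfold Rdiv. rewrite Rmult_assoc, Rinv_l by lra.
      apply lt_INR in Hj. lra. }
    left. apply exp_increasing. generalize (Cmod_fst_le w) (Rle_abs (fst w)) (Cmod_triangle_sub w a) (Cmod_ge_0 w). nra.
  - intros w _. apply expm1_mean_lim.
Qed.

Lemma CSer_zero_term (a : nat -> CC) k : ex_series (fun j => Cmod (if Nat.eqb j k then RtoC 0 else a j)) ->
  CSer a = (a k + CSer (fun j => if Nat.eqb j k then RtoC 0 else a j))%C.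
Proof.
  intros H. apply CSer_unique.
  apply Clim_ext with (fun n => csum (fun j => if Nat.eqb j k then a j else RtoC 0) n + csum (fun j => if Nat.eqb j k then RtoC 0 else a j) n)%C.
  - intros n. rewrite <- csum_plus. apply csum_ext. intros j _. destruct (Nat.eqb j k); ring.
  - apply Clim_plus; [|now apply CSer_correct].
    apply Clim_ext_loc with (fun _ => a k); [|apply Clim_const]. exists (S k). intros n Hn.
    replace n with (k + S (n - S k))%nat by lia. rewrite csum_split, csum_S_l.
    rewrite Nat.add_0_r, Nat.eqb_refl, !csum_0. ring.
    + intros i _. replace (k + S i =? k)%nat with false; auto. symmetry; apply Nat.eqb_neq; lia.
    + intros i Hi. replace (i =? k)%nat with false; auto. symmetry; apply Nat.eqb_neq; lia.
Qed.

(** The real part -2k of the pole determines k, so the term of index k alone is singular at [s]; the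
    others sum to a holomorphic function. In the singular term e^{2L(z-s)} - 1 is 2L(z - s) times
    [E z], where E(s) = 1, so the numerator at [s] is G(s) c_k(s) / (2L). *)
Lemma simple_pole_SL L (G : CC -> CC) s : 0 < L -> (forall z, hol G z) -> G s <> 0%C -> pole_set L s ->
  simple_pole (fun z => G z * SL L z)%C s.
Proof.
  intros HL HG HG0 [m [k Hs]]. set (good := fun j => negb (Nat.eqb j k)).
  assert (Hgood : forall j, good j = true -> cexp (bexp L s j) <> 1%C).
  { intros j Hj E. destruct (cexp_eq_1 _ E) as [m2 Hm]. assert (E1 := f_equal fst Hm). rewrite fst_bexp, Hs in E1. simpl in E1.
    assert (INR j = INR k) by nra. apply INR_eq in H. subst. unfold good in Hj. rewrite Nat.eqb_refl in Hj. discriminate. }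
  destruct (Spart_near good L s HL Hgood) as [r [J [Hr [_ [HN HB]]]]].
  set (Rk := fun z => CSer (Spart good L z)).
  (* At [s] the exponent is 2 pi i m, a period, so it may be measured from [s]. *)
  assert (Hbexp : forall z, cexp (bexp L z k) = cexp ((2 * L)%R * (z - s))).
  { intros z. replace (bexp L z k) with ((2 * L)%R * (z - s) + bexp L s k)%C by (unfold bexp; ring).
    rewrite cexp_plus. replace (bexp L s k) with (im (2 * PI * IZR m)).
    rewrite cexp_2PI_Z. ring. rewrite Hs. apply C_eq. rewrite fst_bexp. simpl; ring. rewrite snd_bexp. simpl. field. lra. }
  set (E := fun z => expm1_quot ((2 * L)%R * (z - s))%C).
  assert (HE : forall z, hol E z).
  { intros z. apply (hol_comp expm1_quot (fun z => (2 * L)%R * (z - s))%C). apply hol_mult. apply hol_const.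
    apply hol_minus. apply hol_id. apply hol_const. apply hol_expm1_quot. }
  assert (HEs : E s = 1%C).
  { unfold E, expm1_quot. destruct (Ceq_dec _ 0) as [_|Hn]; auto. exfalso. apply Hn. ring. }
  destruct (hol_neq_0_near E s (HE s)) as [r2 [Hr2 HE0]]. rewrite HEs. apply RtoC_neq_0; lra.
  assert (HL2 : RtoC (2 * L) <> 0%C) by (apply RtoC_neq_0; lra).
  exists (Rmin r r2). split. now apply Rmin_glb_lt.
  exists (fun z => G z * (bcoef z k / ((2 * L)%R * E z) + (z - s) * Rk z))%C. split; [|split].
  - intros z Hz. assert (A1 := Rlt_le_trans _ _ _ Hz (Rmin_l _ _)). assert (A2 := Rlt_le_trans _ _ _ Hz (Rmin_r _ _)).
    apply hol_holo_at. apply hol_mult; auto. apply hol_plus.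
    + apply hol_div. apply hol_bcoef. apply hol_mult; auto using hol_const. apply Cmult_neq_0; auto.
    + apply hol_mult. apply hol_minus. apply hol_id. apply hol_const. apply hol_Spart; auto.
  - rewrite HEs. apply Cmult_neq_0; auto.
    replace (bcoef s k / ((2 * L)%R * 1) + (s - s) * Rk s)%C with (bcoef s k * / ((2 * L)%R))%C by (field; auto).
    apply Cmult_neq_0.
    + unfold bcoef, Cdiv. apply Cmult_neq_0.
      (* The residue does not vanish: Re s = -2k, so each factor s + i with i < k has negative real
         part. *)
      * apply poch_neq_0. intros i Hi E0. assert (E1 := f_equal fst E0). rewrite Hs in E1. simpl in E1.
        apply lt_INR in Hi. generalize (pos_INR i). lra.
      * apply Cmod_gt_0. rewrite Cmod_inv by apply RfactC. apply Rinv_0_lt_compat, Cmod_gt_0, RfactC.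
    + apply Cmod_gt_0. rewrite Cmod_inv by auto. apply Rinv_0_lt_compat, Cmod_gt_0; auto.
  - intros z [Hz0 Hz]. assert (A1 := Rlt_le_trans _ _ _ Hz (Rmin_l _ _)). assert (A2 := Rlt_le_trans _ _ _ Hz (Rmin_r _ _)).
    assert (Hzs : (z - s)%C <> 0%C) by now apply Cmod_gt_0.
    assert (HSP : Rk z = CSer (fun j => if Nat.eqb j k then RtoC 0 else Sterm L z j)).
    { apply CSer_ext. intros j. unfold Spart, good. now destruct (Nat.eqb j k). }
    unfold SL. rewrite (CSer_zero_term _ k).
    + rewrite <- HSP. unfold Sterm. rewrite Hbexp.
      assert (HEz : E z = ((cexp ((2 * L)%R * (z - s)) - 1) / ((2 * L)%R * (z - s)))%C).
      { unfold E, expm1_quot. destruct (Ceq_dec _ 0) as [E0|_]; auto. exfalso.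
        apply (Cmult_neq_0 (2 * L)%R (z - s)%C); auto. }
      assert (HE0z := HE0 z A2). 
      assert (Hden : (cexp ((2 * L)%R * (z - s)) - 1)%C <> 0%C).
      { intros E0. apply HE0z. rewrite HEz, E0. unfold Cdiv; ring. }
      rewrite HEz. field. repeat split; auto.
    + apply ex_series_ext with (fun j => Cmod (Spart good L z j)).
      * intros j. unfold Spart, good. now destruct (Nat.eqb j k).
      * apply ex_series_Spart; auto.
Qed.

(** * The Dirichlet series *)

Lemma Cder_pow (n : nat) t : Cder (fun u => RtoC (u ^ n)) t (INR n * (t ^ pred n)%R)%C.
Proof.
  rewrite <- RtoC_mult. apply Cder_R. destruct n.
  - apply is_derive_eqR with 0; [exact (is_derive_const (K := R_AbsRing) (V := R_NormedModule) 1 t)|simpl; ring].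
  - apply is_derive_eqR with (INR (S n) * 1 * t ^ n); [|simpl pred; bring].
    eapply is_derive_ext; [|apply (is_derive_pow_const 1 n t)]. intros; simpl; ring.
Qed.

Lemma Cder_ln1m (t : R) : t < 1 -> Cder (fun u => RtoC (ln (1 - u))) t (RtoC (- / (1 - t))).
Proof. intros Ht. apply Cder_R. auto_derive. lra. field. lra. Qed.

Definition binom_weight (s : CC) (u : R) : CC := cexp (s * ln (1 - u)).

Definition binom_der (s : CC) (N : nat) (u : R) : CC :=
  match N with O => 0%C | S n => (- (INR (S n) * bcoef s (S n) * (u ^ n)%R * binom_weight (s - 1) u))%C end.

Lemma binom_weight_split s u : u < 1 -> binom_weight s u = ((1 - u)%R * binom_weight (s - 1) u)%C.
Proof.
  intros Hu. unfold binom_weight. replace (s * ln (1 - u))%C with (ln (1 - u) + (s - 1) * ln (1 - u))%C by ring.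
  rewrite cexp_plus, cexp_R, exp_ln by lra. auto.
Qed.

(* The derivative of [(1-u)^s] times a partial sum of the binomial series telescopes to one term. *)
Lemma binom_partial_der s N u : u < 1 ->
  Cder (fun u => binom_weight s u * csum (fun j => bcoef s j * (u ^ j)%R) N)%C u (binom_der s N u).
Proof.
  intros Hu. induction N.
  - simpl. apply Cder_ext with (fun _ => RtoC 0). intros; ring. apply Cder_const.
  - apply Cder_ext with (fun u => binom_weight s u * csum (fun j => bcoef s j * (u ^ j)%R) N
       + binom_weight s u * (bcoef s N * (u ^ N)%R))%C. intros; simpl; ring.
    eapply Cder_eq. apply Cder_plus. apply IHN. apply Cder_mult. apply Cder_cexp. apply Cder_scal. apply Cder_ln1m; auto.
    apply Cder_scal, Cder_pow.
    eqbeta. change (cexp (s * ln (1 - u))) with (binom_weight s u). rewrite (binom_weight_split s u Hu).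
    set (e := binom_weight (s - 1) u). 
    assert (H1 : RtoC (1 - u) <> 0%C) by (apply RtoC_neq_0; lra).
    assert (HSN : RtoC (INR (S N)) <> 0%C) by (apply RtoC_neq_0, not_0_INR; lia).
    assert (EN : binom_der s (S N) u = (- ((s + INR N) * bcoef s N * (u ^ N)%R * e))%C).
    { unfold binom_der. fold e. rewrite bcoef_S. field. auto. }
    rewrite EN, RtoC_opp, RtoC_inv by lra.
    destruct N as [|n].
    + simpl. field. auto.
    + unfold binom_der. fold e. simpl pred. simpl pow. rewrite RtoC_mult, RtoC_minus in *. field. auto.
Qed.

(** The product of (1-u)^s and a partial sum is 1 at u = 0, and its derivative is a single term.
    Integrated up to t by [Cmvt], this shows that the product differs from 1 by at most a constant
    times |c_N| t^N. *)
Lemma binom_series (s : CC) (t : R) : 0 <= t < 1 ->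
  Clim (csum (fun j => bcoef s j * (t ^ j)%R)%C) (cexp (- s * ln (1 - t))).
Proof.
  intros Ht. set (W := binom_weight s t).
  assert (HW : W <> 0%C) by apply cexp_neq_0.
  assert (H1 : Clim (fun N => W * csum (fun j => bcoef s j * (t ^ j)%R) N)%C 1).
  (* [K] bounds |(1-u)^{s-1}| for u between 0 and t, whatever the sign of Re s - 1. *)
  { set (K := exp (Rabs (fst s - 1) * - ln (1 - t))).
    set (A := Cmod s + 1). assert (HA : 0 < A) by (unfold A; generalize (Cmod_ge_0 s); lra).
    (* [x] stands for [t], which may be 0, because [ex_series_bcoef_majorant] asks for a positive
       ratio. *)
    set (x := (1 + t) / 2). assert (Hx : 0 < x < 1 /\ t <= x) by (unfold x; lra).
    apply Clim_squeeze with (fun N => K * (bcoef_majorant A N * x ^ N)).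
    - exists 1%nat. intros [|n] HN; [lia|].
      assert (M := Cmvt (fun u => binom_weight s u * csum (fun j => bcoef s j * (u ^ j)%R) (S n))%C
        (binom_der s (S n)) (fun u => K * Cmod (bcoef s (S n)) * u ^ S n)
        (fun u => INR (S n) * (K * Cmod (bcoef s (S n))) * u ^ n) 0 t (proj1 Ht)).
      assert (E0 : (binom_weight s 0 * csum (fun j => bcoef s j * (0 ^ j)%R) (S n))%C = 1%C).
      { rewrite csum_S_l, csum_0. unfold binom_weight. rewrite Rminus_0_r, ln_1, Cmult_0_r, cexp_0.
        unfold bcoef. simpl. field. intros k _. simpl. rewrite Rmult_0_l. ring. }
      cbv beta in M. rewrite E0 in M. fold W in M.
      eapply Rle_trans; [apply M|].
      + intros u Hu. apply binom_partial_der; lra.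
      + intros u Hu. apply is_derive_pow_const.
      + intros u Hu. unfold binom_der. rewrite Cmod_opp, !Cmod_mult, !Cmod_R, !Rabs_pos_eq by (try apply pos_INR; apply pow_le; lra).
        assert (HwK : Cmod (binom_weight (s - 1) u) <= K).
        { unfold binom_weight. rewrite Cmod_cexp. unfold K.
          replace (fst ((s - 1) * ln (1 - u))%C) with ((fst s - 1) * ln (1 - u)) by (simpl; ring).
          assert (L1 : ln (1 - t) <= ln (1 - u)) by (apply ln_le; lra).
          assert (L2 : ln (1 - u) <= 0) by (rewrite <- ln_1; apply ln_le; lra).
          assert (HH : (fst s - 1) * ln (1 - u) <= Rabs (fst s - 1) * - ln (1 - t)).
          { generalize (Rle_abs (- (fst s - 1))) (Rabs_pos (fst s - 1)). rewrite Rabs_Ropp. nra. }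
          destruct HH as [HH|HH]. left; now apply exp_increasing. rewrite HH; lra. }
        assert (P0 : 0 <= INR (S n) * Cmod (bcoef s (S n)) * u ^ n).
        { apply Rmult_le_pos. apply Rmult_le_pos. apply pos_INR. apply Cmod_ge_0. apply pow_le; lra. }
        replace (INR (S n) * (K * Cmod (bcoef s (S n))) * u ^ n) with (INR (S n) * Cmod (bcoef s (S n)) * u ^ n * K) by ring.
        apply Rmult_le_compat_l; auto.
      + simpl (0 ^ S n). rewrite Rmult_0_l, Rmult_0_r, Rminus_0_r. rewrite Rmult_assoc.
        apply Rmult_le_compat_l. left; apply exp_pos. apply Rmult_le_compat. apply Cmod_ge_0. apply pow_le; lra.
        apply Cmod_bcoef_le. unfold A; lra. apply pow_incr; lra.
    - replace (Finite 0) with (Finite (K * 0)) by (f_equal; ring). apply is_lim_seq_mult'. apply is_lim_seq_const.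
      apply ex_series_lim_0. apply ex_series_bcoef_majorant; lra. }
  apply Clim_ext with (fun N => / W * (W * csum (fun j => bcoef s j * (t ^ j)%R) N))%C.
  - intros N. field. auto.
  - replace (cexp (- s * ln (1 - t))) with (/ W * 1)%C. now apply Clim_scal.
    rewrite Cmult_1_r. unfold W, binom_weight. rewrite <- cexp_opp. f_equal. ring.
Qed.

Definition sinh_arg (L : R) (k : nat) : R := 2 * L * INR (S k).

(** The logarithm of 2 sinh X for X > 0, in the form that isolates the argument of the binomial
    series. Thus [sinh_term L s k] is (2 sinh(2L(k+1)))^{-s}, a term of the Dirichlet series without
    its power of q. *)
Definition ln2sinh (X : R) : R := X + ln (1 - exp (- (2 * X))).

Definition sinh_term (L : R) (s : CC) (k : nat) : CC := cexp (- s * ln2sinh (sinh_arg L k)).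

Lemma sinh_arg_pos L k : 0 < L -> 0 < sinh_arg L k.
Proof. intros HL. unfold sinh_arg. generalize (INR_S_pos k). nra. Qed.

Lemma exp_neg_lt_1 x : 0 < x -> 0 < exp (- x) < 1.
Proof. intros Hx. split. apply exp_pos. rewrite <- exp_0. apply exp_increasing. lra. Qed.

Lemma Clim_csum (f : nat -> nat -> CC) (l : nat -> CC) K :
  (forall k, (k < K)%nat -> Clim (f k) (l k)) -> Clim (fun n => csum (fun k => f k n) K) (csum l K).
Proof. induction K; intros H; simpl. apply Clim_const. apply Clim_plus; auto. Qed.

Lemma sinh_term_series L s k : 0 < L ->
  Clim (csum (fun j => bcoef s j * cexp (- bexp L s j) ^ S k)%C) (sinh_term L s k).
Proof.
  intros HL. assert (HX := sinh_arg_pos L k HL). set (X := sinh_arg L k) in *.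
  assert (Ht := exp_neg_lt_1 (2 * X) ltac:(lra)). set (t := exp (- (2 * X))) in *.
  apply Clim_ext with (fun n => cexp (- s * X) * csum (fun j => bcoef s j * (t ^ j)%R) n)%C.
  - intros n. rewrite <- csum_scal. apply csum_ext. intros j _.
    rewrite cexp_pow. replace (INR (S k) * - bexp L s j)%C with (- s * X + RtoC (INR j * - (2 * X)))%C.
    + rewrite cexp_plus, cexp_R. replace (exp (INR j * - (2 * X))) with (t ^ j). ring.
      unfold t. rewrite <- Rpower_pow by apply exp_pos. unfold Rpower. now rewrite ln_exp.
    + unfold X, sinh_arg, bexp. apply C_eq; simpl; ring.
  - unfold sinh_term, ln2sinh. fold X t. rewrite RtoC_plus, Cmult_plus_distr_l, cexp_plus.
    apply Clim_scal. apply binom_series. lra.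
Qed.

Lemma geom_partial_bound (r : CC) K : Cmod r < 1 -> Cmod (csum (fun k => r ^ S k)%C K) <= Cmod r * / (1 - Cmod r).
Proof.
  intros Hr. rewrite (csum_ext _ (fun k => r * r ^ k)%C) by auto. rewrite csum_scal, Cmod_mult.
  generalize (Cmod_ge_0 r); intros P0. apply Rmult_le_compat_l; auto.
  eapply Rle_trans; [apply csum_mod_le|].
  rewrite <- (Series_geom (Cmod r)) by (rewrite Rabs_pos_eq; auto).
  eapply Rle_trans; [apply (rsum_le _ (fun k => Cmod r ^ k)); intros; rewrite Cmod_pow; lra|].
  apply rsum_le_Series. intros; now apply pow_le. apply ex_series_geom. rewrite Rabs_pos_eq; auto.
Qed.

Lemma geom_partial_lim (r : CC) : Cmod r < 1 -> Clim (csum (fun k => r ^ S k)%C) (r / (1 - r))%C.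
Proof.
  intros Hr. assert (H1 := one_minus_neq_0 r Hr).
  apply Clim_ext with (fun n => r / (1 - r) * (1 - r ^ n))%C.
  - intros n. rewrite <- geom_sum. rewrite (csum_ext (fun k => r ^ S k)%C (fun k => r * r ^ k)%C) by auto.
    rewrite (csum_scal r (fun k => r ^ k)%C). field. auto.
  - apply Clim_eq with (r / (1 - r) * (1 - 0))%C; [|ring]. apply Clim_scal. apply Clim_minus. apply Clim_const.
    apply Clim_squeeze with (fun n => Cmod r ^ n). exists O; intros n _. replace (r ^ n - 0)%C with (r ^ n)%C by ring. rewrite Cmod_pow. lra.
    apply is_lim_seq_geom. rewrite Rabs_pos_eq; auto using Cmod_ge_0.
Qed.

(** The partial sum over the first K terms is a sum over j of c_j times a partial geometric sum, and
    [Tannery] in j lets K grow. The majorant uses |r_j| <= [r0] < 1, which is where Re s > 0 enters,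
    together with |r_j| <= x^j. *)
Lemma SL_dirichlet L s : 0 < L -> 0 < fst s -> Clim (csum (sinh_term L s)) (SL L s).
Proof.
  intros HL Hs. set (r := fun j => cexp (- bexp L s j)).
  assert (Hr : forall j, Cmod (r j) = exp (- (2 * L * fst s)) * exp (- (4 * L)) ^ j).
  { intros j. unfold r. rewrite Cmod_cexp. rewrite <- Rpower_pow by apply exp_pos. unfold Rpower. rewrite ln_exp, <- exp_plus.
    f_equal. change (fst (- bexp L s j)%C) with (- fst (bexp L s j)). rewrite fst_bexp. ring. }
  assert (H0 := exp_neg_lt_1 (2 * L * fst s) ltac:(nra)). set (r0 := exp (- (2 * L * fst s))) in *.
  assert (H4 := exp_neg_lt_1 (4 * L) ltac:(nra)). set (x := exp (- (4 * L))) in *.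
  assert (Hrr : forall j, Cmod (r j) <= r0).
  { intros j. rewrite Hr. assert (x ^ j <= 1 ^ j) by (apply pow_incr; lra). rewrite pow1 in H. nra. }
  set (A := Cmod s + 1). assert (HA : 0 < A) by (unfold A; generalize (Cmod_ge_0 s); lra).
  assert (T := Tannery (fun K j => bcoef s j * csum (fun k => r j ^ S k) K)%C (Sterm L s)
    (fun K => csum (sinh_term L s) K) (fun j => / (1 - r0) * (bcoef_majorant A j * x ^ j))).
  apply T.
  - intros K j. rewrite Cmod_mult.
    replace (/ (1 - r0) * (bcoef_majorant A j * x ^ j)) with (bcoef_majorant A j * (x ^ j * / (1 - r0))) by ring.
    apply Rmult_le_compat; auto using Cmod_ge_0. apply Cmod_bcoef_le. unfold A; lra.
    eapply Rle_trans; [apply geom_partial_bound|]. specialize (Hrr j); lra.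
    apply Rmult_le_compat. apply Cmod_ge_0. left; apply Rinv_0_lt_compat; specialize (Hrr j); lra.
    rewrite Hr. generalize (pow_lt x j (proj1 H4)); nra. apply Rinv_le_contravar; specialize (Hrr j); lra.
  - apply ex_series_scalR. now apply ex_series_bcoef_majorant.
  - intros j. unfold Sterm, Cdiv.
    replace (/ (cexp (bexp L s j) - 1))%C with (r j / (1 - r j))%C.
    + apply Clim_scal, geom_partial_lim. specialize (Hrr j); lra.
    + unfold r. rewrite cexp_opp. assert (HE := cexp_neq_0 (bexp L s j)).
      assert (Hd : (1 - r j)%C <> 0%C) by (apply one_minus_neq_0; specialize (Hrr j); lra).
      unfold r in Hd. rewrite cexp_opp in Hd.
      assert (Hd2 : (cexp (bexp L s j) - 1)%C <> 0%C).
      { intros E. apply Hd. replace (1 - / cexp (bexp L s j))%C with ((cexp (bexp L s j) - 1) * / cexp (bexp L s j))%C by (field; auto). rewrite E. ring. }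
      field. auto.
  - intros K. apply Clim_ext with (fun n => csum (fun k => csum (fun j => bcoef s j * r j ^ S k)%C n) K).
    + intros n. rewrite csum_swap. apply csum_ext. intros j _. now rewrite csum_scal.
    + apply (Clim_csum (fun k n => csum (fun j => bcoef s j * r j ^ S k)%C n) (sinh_term L s)). intros k _. now apply sinh_term_series.
Qed.

(** The conjugate is -1/eps, and the even index removes the sign: F_D(2n) is 2 sinh(2nL) / sqrt q.
    The square root accounts for q^{s/2}. *)
Lemma FD_term (D : Z) eps epsb s k : 1 < eps -> eps * epsb = -1 -> 0 < qD D ->
  cpow (FD D eps epsb (2 * S k)) (- s) = (cpow (qD D) (s / 2) * sinh_term (ln eps) s k)%C.
Proof.
  intros He Hn Hq. set (L := ln eps). assert (HL : 0 < L) by (unfold L; rewrite <- ln_1; apply ln_increasing; lra).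
  set (X := sinh_arg L k). assert (HX := sinh_arg_pos L k HL). fold X in HX.
  assert (E1 : eps ^ (2 * S k) = exp X).
  { rewrite <- Rpower_pow by lra. unfold Rpower. fold L. f_equal. unfold X, sinh_arg. rewrite mult_INR. simpl (INR 2). ring. }
  assert (E2 : epsb ^ (2 * S k) = exp (- X)).
  { assert (Hb : epsb = - / eps).
    { apply Rmult_eq_reg_l with eps; [|lra]. rewrite Hn. field. lra. }
    rewrite Hb, pow_mult. replace ((- / eps) ^ 2) with (/ (eps ^ 2)) by (field; lra).
    rewrite pow_inv, <- pow_mult, E1. symmetry; apply exp_Ropp. }
  assert (Ht := exp_neg_lt_1 (2 * X) ltac:(lra)).
  assert (Hln : ln (FD D eps epsb (2 * S k)) = ln2sinh X - ln (qD D) / 2).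
  { unfold FD. rewrite E1, E2. replace (exp X - exp (- X)) with (exp X * (1 - exp (- (2 * X)))).
    - unfold Rdiv. rewrite ln_mult; [|apply Rmult_lt_0_compat; [apply exp_pos|lra]|apply Rinv_0_lt_compat, sqrt_lt_R0; auto].
      rewrite ln_mult by (try apply exp_pos; lra). rewrite ln_exp, ln_Rinv by now apply sqrt_lt_R0.
      rewrite <- Rpower_sqrt by auto. unfold Rpower. rewrite ln_exp. unfold ln2sinh. field.
    - rewrite Rmult_minus_distr_l, <- exp_plus, Rmult_1_r. replace (X + - (2 * X)) with (- X) by ring. reflexivity. }
  unfold cpow. rewrite Hln. unfold sinh_term. fold L X. rewrite <- cexp_plus. f_equal.
  rewrite RtoC_minus, RtoC_div by lra. field.
Qed.

Lemma sinh_ge X : 0 < X -> 2 * X <= exp X - exp (- X).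
Proof.
  intros HX. assert (H := is_derive_nonneg_le (fun x => exp x - exp (- x) - 2 * x) (fun x => exp x + exp (- x) - 2) 0 X ltac:(lra)).
  cbv beta in H. rewrite Ropp_0, exp_0 in H. assert (1 - 1 - 2 * 0 <= exp X - exp (- X) - 2 * X); [|lra]. apply H.
  - intros t Ht. auto_derive; auto. ring.
  - intros t Ht. rewrite exp_Ropp. assert (P := exp_pos t). 
    assert (E : exp t + / exp t - 2 = (exp t - 1) ^ 2 / exp t) by (field; lra). rewrite E.
    apply Rmult_le_pos. apply pow2_ge_0. left; now apply Rinv_0_lt_compat.
Qed.

(** In other words 2X <= 2 sinh X <= 2X e^X. In [SL_to_zeta] the lower bound gives the majorant and
    the upper one the limit of each term. *)
Lemma ln2sinh_bounds X : 0 < X -> 0 <= ln2sinh X - ln (2 * X) <= X.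
Proof.
  intros HX. assert (Ht := exp_neg_lt_1 (2 * X) ltac:(lra)). unfold ln2sinh. split.
  - assert (ln (2 * X) <= X + ln (1 - exp (- (2 * X)))); [|lra].
    replace (X + ln (1 - exp (- (2 * X)))) with (ln (exp X - exp (- X))). apply ln_le. lra. now apply sinh_ge.
    replace (exp X - exp (- X)) with (exp X * (1 - exp (- (2 * X)))). rewrite ln_mult, ln_exp; try apply exp_pos; lra.
    rewrite Rmult_minus_distr_l, <- exp_plus, Rmult_1_r. replace (X + - (2 * X)) with (- X) by ring. reflexivity.
  - assert (ln (1 - exp (- (2 * X))) <= ln (2 * X)); [|lra]. apply ln_le. lra. generalize (exp_ineq1_le (- (2 * X))). lra.
Qed.

(** For small X one has 2 sinh X close to 2X; at X = 2 L_n k this is 4 L_n k, so the normalization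
    (4 L_n)^s leaves k^{-s}. Since sinh X >= X, the terms are dominated by k^{-Re s}, independently
    of n. *)
Lemma SL_to_zeta L s : 0 < L -> 1 < fst s ->
  Clim (fun n => cpow (4 * (L / INR (S n))) s * SL (L / INR (S n)) s)%C (CSer (fun k => cpow (INR (S k)) (- s))).
Proof.
  intros HL Hs. set (Ln := fun n => L / INR (S n)).
  assert (HLn : forall n, 0 < Ln n) by (intros n; unfold Ln; apply Rdiv_lt_0_compat; auto using INR_S_pos).
  set (v := fun n k => ln2sinh (sinh_arg (Ln n) k) - ln (2 * sinh_arg (Ln n) k)).
  assert (Hv : forall n k, 0 <= v n k <= sinh_arg (Ln n) k) by (intros; apply ln2sinh_bounds, sinh_arg_pos; auto).
  assert (Et : forall n k, (cpow (4 * Ln n) s * sinh_term (Ln n) s k)%C = cexp (- s * (v n k + ln (INR (S k)))%R)).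
  { intros n k. unfold cpow, sinh_term. rewrite <- cexp_plus. f_equal. unfold v.
    assert (E : ln (2 * sinh_arg (Ln n) k) = ln (4 * Ln n) + ln (INR (S k))).
    { rewrite <- ln_mult by (try apply INR_S_pos; specialize (HLn n); lra). f_equal. unfold sinh_arg. ring. }
    rewrite E.
    replace (ln2sinh (sinh_arg (Ln n) k) - (ln (4 * Ln n) + ln (INR (S k))) + ln (INR (S k))) with (ln2sinh (sinh_arg (Ln n) k) - ln (4 * Ln n)) by ring.
    rewrite RtoC_minus. ring. }
  apply Tannery with (fun n k => cexp (- s * (v n k + ln (INR (S k)))%R)) (fun k => Rpower (INR (S k)) (- fst s)).
  - intros n k. rewrite Cmod_cexp. unfold Rpower.
    replace (fst (- s * (v n k + ln (INR (S k)))%R)%C) with (- fst s * v n k + - fst s * ln (INR (S k))) by (simpl; ring).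
    specialize (Hv n k).
    assert (HH : - fst s * v n k + - fst s * ln (INR (S k)) <= - fst s * ln (INR (S k))) by nra.
    destruct HH as [HH|HH]. left; now apply exp_increasing. rewrite HH; lra.
  - now apply ex_series_Rpower.
  - intros k. unfold cpow.
    apply Clim_ext with (fun n => cexp (- s * v n k) * cexp (ln (INR (S k)) * - s))%C.
    { intros n. rewrite <- cexp_plus. f_equal. rewrite RtoC_plus. ring. }
    apply Clim_eq with (1 * cexp (ln (INR (S k)) * - s))%C; [|ring].
    apply Clim_mult; [|apply Clim_const]. rewrite <- cexp_0. apply (hol_continuous cexp). apply hol_cexp_id.
    apply Clim_eq with (- s * 0)%C; [|ring]. apply Clim_scal.
    apply Clim_squeeze with (fun n => 2 * L * INR (S k) / INR (S n)).
    + exists O. intros n _. replace (v n k - 0)%C with (RtoC (v n k)) by ring. rewrite Cmod_R, Rabs_pos_eq by apply Hv.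
      eapply Rle_trans; [apply Hv|]. unfold sinh_arg, Ln. right. field. apply not_0_INR; lia.
    + apply (is_lim_seq_incr_1 (fun n => 2 * L * INR (S k) / INR n)). apply is_lim_seq_inv_INR.
  - intros n. apply Clim_ext with (fun K => cpow (4 * Ln n) s * csum (sinh_term (Ln n) s) K)%C.
    + intros K. rewrite <- csum_scal. apply csum_ext. intros; apply Et.
    + apply Clim_scal. apply SL_dirichlet; [apply HLn|lra].
Qed.

(** * Partial fractions of the exponential and of the Beta function *)

Lemma Tannery_ev (a : nat -> nat -> CC) (l : nat -> CC) (A : nat -> CC) (b : nat -> R) J :
  (forall N j, (J <= j)%nat -> Cmod (a N j) <= b j) -> ex_series b ->
  (forall j, Clim (fun N => a N j) (l j)) ->
  (forall N, Clim (csum (a N)) (A N)) ->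
  Clim A (CSer l) /\ ex_series (fun j => Cmod (l j)).
Proof.
  intros Hb Eb Hl HA.
  assert (Eb' := proj1 (ex_series_incr_n b J) Eb).
  assert (El : ex_series (fun k => Cmod (l (J + k)%nat))).
  { apply ex_series_Cmod_le with (fun k => b (J + k)%nat); auto. intros k.
    apply Clim_le with (2 := Hl (J + k)%nat). exists O; intros; apply Hb; lia. }
  split; [|apply ex_series_shift with J; exact El].
  rewrite (CSer_shift l J El).
  assert (T := Tannery (fun N k => a N (J + k)%nat) (fun k => l (J + k)%nat) (fun N => A N - csum (a N) J)%C (fun k => b (J + k)%nat)).
  apply Clim_ext with (fun N => csum (a N) J + (A N - csum (a N) J))%C. intros; ring.
  apply Clim_plus.
  - apply (Clim_csum (fun j N => a N j) l). auto.
  - apply T; auto. intros; apply Hb; lia. intros N.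
    apply Clim_ext with (fun n => csum (a N) (n + J) - csum (a N) J)%C.
    intros n. rewrite Nat.add_comm, csum_split. ring.
    apply Clim_minus. now apply Clim_incr. apply Clim_const.
Qed.

Lemma csum_rev g M : csum (fun j => g (M - 1 - j)%nat) M = csum g M.
Proof.
  induction M. reflexivity. rewrite csum_S_l. simpl csum. rewrite Cplus_comm. f_equal.
  - rewrite <- IHM. apply csum_ext. intros k Hk. f_equal. lia.
  - f_equal. lia.
Qed.

Lemma csum_symmetric (f : nat -> CC) M :
  csum f (2 * M + 1) = (f O + csum (fun j => f (S j) + f (2 * M - j)%nat) M)%C.
Proof.
  replace (2 * M + 1)%nat with (S (M + M)) by lia. rewrite csum_S_l, csum_split, csum_plus. f_equal. f_equal.
  rewrite <- csum_rev. apply csum_ext. intros k Hk. f_equal. lia.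
Qed.

Lemma exp1m_scaled_lim (w : CC) (N : nat -> nat) : (forall n, (n <= N n)%nat) ->
  Clim (fun n => INR (N n) * (1 - cexp (- w / INR (N n))))%C w.
Proof.
  intros HN. apply Clim_squeeze with (fun n => 3/2 * Cmod w ^ 2 / INR n); [|apply is_lim_seq_inv_INR].
  destruct (exists_INR_ge (Cmod w + 1)) as [N0 H0]. exists N0. intros n Hn. assert (HNn := le_INR _ _ (HN n)). apply le_INR in Hn.
  generalize (Cmod_ge_0 w); intros P0.
  set (x := INR (N n)) in *. assert (Hx : 0 < x) by lra. assert (H : RtoC x <> 0%C) by (apply RtoC_neq_0; lra).
  assert (E : Cmod (- w / x) = Cmod w / x) by (rewrite Cmod_div, Cmod_opp, Cmod_R, Rabs_pos_eq; auto; lra).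
  replace (_ - w)%C with (- (x * (cexp (- w / x) - 1 - - w / x)))%C by (field; auto).
  rewrite Cmod_opp, Cmod_mult, Cmod_R, Rabs_pos_eq by lra.
  apply Rle_trans with (x * (3/2 * (Cmod w / x) ^ 2)).
  - apply Rmult_le_compat_l; [lra|]. rewrite <- E. apply cexp_sub1h. rewrite E.
    apply Rmult_le_reg_r with x; auto. unfold Rdiv. rewrite Rmult_assoc, Rinv_l; lra.
  - replace (x * (3 / 2 * (Cmod w / x) ^ 2)) with (3 / 2 * Cmod w ^ 2 * / x) by (field; lra).
    apply Rmult_le_compat_l. generalize (pow2_ge_0 (Cmod w)); lra. apply Rinv_le_contravar; lra.
Qed.

Lemma exp1m_scaled_inv_lim (w : CC) (N : nat -> nat) : w <> 0%C -> (forall n, (n <= N n)%nat) ->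
  Clim (fun n => / INR (N n) * (/ (1 - cexp (- w / INR (N n))) - 1 / 2))%C (/ w)%C.
Proof.
  intros Hw HN.
  apply Clim_eq with (/ w - 1 / 2 * 0)%C; [|ring].
  apply Clim_ext_loc with (fun n => / (INR (N n) * (1 - cexp (- w / INR (N n)))) - 1 / 2 * / INR (N n))%C.
  - assert (L := exp1m_scaled_lim w N HN). apply Clim_eps with (e := Cmod w) in L; [|now apply Cmod_gt_0].
    destruct L as [M HM]. exists (S M). intros n Hn.
    assert (HNn : RtoC (INR (N n)) <> 0%C) by (apply RtoC_neq_0, not_0_INR; specialize (HN n); lia).
    assert (H1 : (1 - cexp (- w / INR (N n)))%C <> 0%C).
    { intros E. specialize (HM n ltac:(lia)). rewrite E in HM.
      replace (INR (N n) * 0 - w)%C with (- w)%C in HM by ring. rewrite Cmod_opp in HM. lra. }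
    field. auto.
  - apply Clim_minus. apply Clim_inv; auto. now apply exp1m_scaled_lim.
    apply Clim_scal. apply Clim_squeeze with (fun n => 1 / INR n); [|apply is_lim_seq_inv_INR].
    exists 1%nat. intros n Hn. replace (/ INR (N n) - 0)%C with (/ INR (N n))%C by ring.
    assert (Hn1 : 1 <= INR n) by (apply (le_INR 1); lia). assert (HNn := le_INR _ _ (HN n)).
    rewrite <- RtoC_inv by lra. rewrite Cmod_R, Rabs_pos_eq by (left; apply Rinv_0_lt_compat; lra).
    unfold Rdiv. rewrite Rmult_1_l. apply Rinv_le_contravar; lra.
Qed.

Lemma PI_bounds : 3 < PI <= 3.5.
Proof.
  split. generalize PI2_3_2; lra. assert (G := PI_ineq 1). unfold tg_alt, PI_tg in G; simpl in G; lra.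
Qed.

(** The right side is 4 sin^2(b/2), and sin x >= x - x^3/6 >= x/3 holds up to x = 2, beyond pi/2.
    The crude 1/9 is enough. *)
Lemma one_minus_cos_ge b : 0 <= b <= PI -> b ^ 2 / 9 <= 2 - 2 * cos b.
Proof.
  intros Hb. destruct PI_bounds as [P1 P2].
  replace b with (2 * (b / 2)) at 2 by field. rewrite cos_2a_sin. set (x := b / 2).
  assert (Hx : 0 <= x <= 1.75) by (unfold x; lra).
  destruct (sin_bound x 0) as [S1 _]. lra. lra.
  assert (S2 : x - x ^ 3 / 6 <= sin x).
  { eapply Rle_trans; [|exact S1]. unfold sin_approx, sin_term. simpl. lra. }
  assert (x / 3 <= sin x) by (simpl in S2; nra).
  replace (b ^ 2) with (4 * x ^ 2) by (unfold x; field). simpl. nra.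
Qed.

(** The contributions of the roots of index k and N - k to the mean that [rt_kernel_sum] evaluates
    at q = e^{-u/N}, with 1/2 taken from each so that the pair becomes summable. For large N it
    tends to 1/(u + 2 pi i k) + 1/(u - 2 pi i k). *)
Definition coth_pair (u : CC) (N k : nat) : CC :=
  (/ INR N * (/ (1 - cexp (- u / INR N) / rt N k) + / (1 - cexp (- u / INR N) * rt N k) - 1))%C.

(** With A = e^{u/N} and B the root, the pair is (A - 1/A) / (A + 1/A - B - 1/B), divided by N. Here
    B + 1/B = 2 cos b, where 2k < N keeps b below pi, so 2 - 2 cos b is at least 4 (k/N)^2. The
    perturbation A + 1/A - 2 is at most 27 (|u|/N)^2, and 4|u| <= k makes this at most half of
    it. *)
Lemma coth_pair_bound u N k : (0 < k)%nat -> (2 * k < N)%nat -> Cmod u <= INR N -> 4 * Cmod u <= INR k ->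
  Cmod (coth_pair u N k) <= 3 * Cmod u * / INR k ^ 2.
Proof.
  intros Hk HkN HuN Huk. assert (HN0 : 0 < INR N) by (apply (lt_INR 0); lia).
  assert (Hk0 : 1 <= INR k) by (apply (le_INR 1); lia).
  assert (HNc : RtoC (INR N) <> 0%C) by (apply RtoC_neq_0; lra).
  set (a := (u / INR N)%C). set (A := cexp a). set (B := rt N k).
  assert (HA : A <> 0%C) by apply cexp_neq_0. assert (HB : B <> 0%C) by apply rt_neq_0.
  assert (EA : cexp (- u / INR N) = (/ A)%C).
  { unfold A. rewrite <- cexp_opp. f_equal. unfold a, Cdiv. ring. }
  assert (Ha : Cmod a = Cmod u / INR N) by (unfold a; rewrite Cmod_div, Cmod_R, Rabs_pos_eq; auto; lra).
  assert (Ha1 : Cmod a <= 1).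
  { rewrite Ha. apply Rmult_le_reg_r with (INR N); auto. unfold Rdiv. rewrite Rmult_assoc, Rinv_l; lra. }
  set (b := 2 * PI * INR k / INR N).
  assert (HBB : (B + / B)%C = RtoC (2 * cos b)).
  { unfold B, rt. rewrite <- cexp_opp. fold b. apply C_eq; simpl; rewrite Ropp_0, exp_0, ?cos_neg, ?sin_neg; ring. }
  destruct PI_bounds as [P1 P2].
  assert (Hb : 6 * INR k / INR N <= b <= PI).
  { unfold b. split.
    - apply Rmult_le_compat_r. left; now apply Rinv_0_lt_compat. nra.
    - apply Rmult_le_reg_r with (INR N); auto. unfold Rdiv. rewrite Rmult_assoc, Rinv_l by lra.
      apply lt_INR in HkN. rewrite mult_INR in HkN. simpl (INR 2) in HkN. nra. }
  assert (Hkn : 0 < INR k / INR N) by (apply Rdiv_lt_0_compat; lra).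
  assert (HC : 4 * (INR k / INR N) ^ 2 <= 2 - 2 * cos b).
  { eapply Rle_trans; [|apply one_minus_cos_ge; unfold Rdiv in *; lra].
    assert ((6 * INR k / INR N) ^ 2 <= b ^ 2) by (apply pow_incr; unfold Rdiv in *; lra).
    replace ((6 * INR k / INR N) ^ 2) with (36 * (INR k / INR N) ^ 2) in H by (field; lra). lra. }
  assert (HA2 : Cmod (A + / A - 2) <= 27 * (Cmod u / INR N) ^ 2).
  { replace (A + / A - 2)%C with ((A - 1) * (A - 1) * / A)%C by (field; auto).
    rewrite !Cmod_mult. unfold A at 3. rewrite <- cexp_opp.
    assert (Q1 := cexp_sub1 a Ha1). fold A in Q1. assert (Q2 := cexp_bound (- a) 1 ltac:(now rewrite Cmod_opp) ltac:(lra)).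
    rewrite Cmult_1_l in Q2. rewrite <- Ha. generalize (Cmod_ge_0 (A - 1)); intros P0.
    replace (27 * Cmod a ^ 2) with ((3 * Cmod a) * (3 * Cmod a) * 3) by ring.
    apply Rmult_le_compat; auto using Cmod_ge_0. nra. apply Rmult_le_compat; auto. }
  set (den := (A + / A - (B + / B))%C).
  assert (Hden : 2 * (INR k / INR N) ^ 2 <= Cmod den).
  { unfold den. rewrite HBB.
    replace (A + / A - RtoC (2 * cos b))%C with (RtoC (2 - 2 * cos b) + (A + / A - 2))%C by (rewrite RtoC_minus; ring).
    generalize (Cmod_triangle_plus (RtoC (2 - 2 * cos b)) (A + / A - 2)). rewrite Cmod_R, Rabs_pos_eq.
    2:{ generalize (pow2_ge_0 (INR k / INR N)); lra. }
    assert (27 * (Cmod u / INR N) ^ 2 <= 2 * (INR k / INR N) ^ 2).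
    { assert ((4 * (Cmod u / INR N)) ^ 2 <= (INR k / INR N) ^ 2).
      { apply pow_incr. split. generalize (Cmod_ge_0 a). rewrite Ha. lra.
        unfold Rdiv. rewrite <- Rmult_assoc. apply Rmult_le_compat_r; auto. left; now apply Rinv_0_lt_compat. }
      rewrite Rpow_mult_distr in H. generalize (pow2_ge_0 (Cmod u / INR N)). lra. }
    lra. }
  assert (Hkn2 : 0 < (INR k / INR N) ^ 2) by (apply pow_lt; auto).
  assert (Hd0 : den <> 0%C) by (apply Cmod_gt_0; lra).
  assert (E : coth_pair u N k = (/ INR N * ((A - / A) * / den))%C).
  { unfold coth_pair. rewrite EA. fold B. f_equal.
    assert (D : ((A * B - 1) * (A - B))%C = (A * B * den)%C) by (unfold den; field; auto).
    assert (D0 : ((A * B - 1) * (A - B))%C <> 0%C) by (rewrite D; repeat apply Cmult_neq_0; auto).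
    assert (D1 : (A * B - 1)%C <> 0%C) by (intros E0; apply D0; rewrite E0; ring).
    assert (D2 : (A - B)%C <> 0%C) by (intros E0; apply D0; rewrite E0; ring).
    replace (/ den)%C with (A * B / ((A * B - 1) * (A - B)))%C by (rewrite D; field; auto).
    field. repeat split; auto. }
  rewrite E, !Cmod_mult, <- RtoC_inv, Cmod_R, Rabs_pos_eq by (try lra; left; now apply Rinv_0_lt_compat).
  assert (HN1 : Cmod (A - / A) <= 6 * (Cmod u / INR N)).
  { replace (A - / A)%C with ((A - 1) - (/ A - 1))%C by ring. eapply Rle_trans; [apply Cmod_triangle_minus|].
    unfold A at 2. rewrite <- cexp_opp.
    assert (Q1 := cexp_sub1 a Ha1). fold A in Q1. assert (Q2 := cexp_sub1 (- a) ltac:(now rewrite Cmod_opp)).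
    rewrite Cmod_opp in Q2. rewrite <- Ha. lra. }
  apply Rle_trans with (/ INR N * (6 * (Cmod u / INR N) * / (2 * (INR k / INR N) ^ 2))).
  - apply Rmult_le_compat_l. left; now apply Rinv_0_lt_compat. apply Rmult_le_compat; auto using Cmod_ge_0.
    apply Cmod_inv_le; lra.
  - right. field. lra.
Qed.

Definition pole_pair (u : CC) (m : nat) : CC :=
  (/ (u + im (2 * PI * INR (S m))) + / (u - im (2 * PI * INR (S m))))%C.

Lemma bexp_neq (u : CC) m : cexp u <> 1%C -> (u + im (2 * PI * IZR m))%C <> 0%C.
Proof.
  intros Hu E. apply Hu. replace u with (im (2 * PI * IZR (- m))). apply cexp_2PI_Z.
  replace u with (u + im (2 * PI * IZR m) - im (2 * PI * IZR m))%C by ring. rewrite E, opp_IZR.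
  apply C_eq; simpl; ring.
Qed.

Lemma im_neg x : im (- x) = (- im x)%C.
Proof. apply C_eq; simpl; ring. Qed.

(** The limit of a finite identity: the mean of 1/(1 - e^{-u/N}/w) over the N-th roots of unity w is
    1/(1 - e^{-u}). The root 1 produces 1/u in the limit, the other roots the pairs, and
    [Tannery_ev] sums the limits of the pairs. *)
Lemma coth_partial_fractions (u : CC) : cexp u <> 1%C ->
  Clim (csum (pole_pair u)) (/ (cexp u - 1) + 1 / 2 - / u)%C.
Proof.
  intros Hu.
  assert (Hw : forall m, (u + im (2 * PI * IZR m))%C <> 0%C) by (intros; now apply bexp_neq).
  assert (Hu0 : u <> 0%C).
  { intros E. apply (Hw 0%Z). rewrite E, Rmult_0_r. apply C_eq; simpl; ring. }
  destruct (exists_INR_ge (4 * Cmod u)) as [J HJ]. set (M0 := J). generalize (Cmod_ge_0 u); intros P0.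
  (* An odd order pairs all roots except 1. The offset [M0] makes the order exceed |u| for every M,
     as [coth_pair_bound] requires. *)
  set (N := fun M => (2 * (M0 + M) + 1)%nat).
  assert (HN : forall n, (n <= N n)%nat) by (intros; unfold N; lia).
  assert (HNp : forall n, RtoC (INR (N n)) <> 0%C) by (intros; apply RtoC_neq_0, not_0_INR; unfold N; lia).
  set (a := fun M j => if (j <? M0 + M)%nat then coth_pair u (N M) (S j) else RtoC 0).
  destruct (Tannery_ev a (pole_pair u) (fun M => csum (fun j => coth_pair u (N M) (S j)) (M0 + M))
    (fun j => 3 * Cmod u * / INR (S j) ^ 2) J) as [T1 T2].
  - intros M j Hj. unfold a. destruct (Nat.ltb_spec j (M0 + M)) as [Hl|Hl].
    + apply coth_pair_bound; unfold N; try lia.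
      * apply Rle_trans with (INR J). lra. apply le_INR. unfold M0; lia.
      * apply le_INR in Hj. rewrite S_INR. lra.
    + rewrite Cmod_0. apply Rmult_le_pos. lra. left. apply Rinv_0_lt_compat, pow_lt, INR_S_pos.
  - apply ex_series_inv_sq.
  - intros j. unfold pole_pair.
    set (b := 2 * PI * INR (S j)).
    assert (W1 : (u + im b)%C <> 0%C) by (unfold b; rewrite INR_IZR_INZ; apply Hw).
    assert (W2 : (u - im b)%C <> 0%C).
    { unfold b. rewrite INR_IZR_INZ. generalize (Hw (- Z.of_nat (S j))%Z). rewrite opp_IZR.
      replace (2 * PI * - IZR (Z.of_nat (S j))) with (- (2 * PI * IZR (Z.of_nat (S j)))) by ring. now rewrite im_neg. }
    apply Clim_ext_loc with (fun n => / INR (N n) * (/ (1 - cexp (- (u + im b) / INR (N n))) - 1 / 2)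
      + / INR (N n) * (/ (1 - cexp (- (u - im b) / INR (N n))) - 1 / 2))%C.
    + exists (S j). intros n Hn. unfold a. destruct (Nat.ltb_spec j (M0 + n)) as [Hl|Hl]; [|lia].
      unfold coth_pair, rt. fold b.
      assert (Er : im (b / INR (N n)) = (im b / INR (N n))%C).
      { unfold Rdiv, Cdiv. rewrite Rmult_comm, im_scale, RtoC_inv. ring. apply not_0_INR. unfold N; lia. }
      replace (2 * PI * INR (S j) / INR (N n)) with (b / INR (N n)) by reflexivity. rewrite Er.
      replace (- (u + im b) / INR (N n))%C with (- u / INR (N n) - im b / INR (N n))%C by (unfold Cdiv; ring).
      replace (- (u - im b) / INR (N n))%C with (- u / INR (N n) + im b / INR (N n))%C by (unfold Cdiv; ring).
      rewrite cexp_minus, cexp_plus. unfold Cdiv.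
      match goal with |- _ = (_ * (?x + ?y - _))%C => generalize x y; intros x' y' end.
      field. apply HNp.
    + apply Clim_plus; apply exp1m_scaled_inv_lim; auto.
  - intros M. 
    replace (csum (fun j => coth_pair u (N M) (S j)) (M0 + M)) with (csum (a M) (M0 + M)).
    + apply csum_finite_lim. intros k Hk. unfold a. destruct (Nat.ltb_spec k (M0 + M)); auto; lia.
    + apply csum_ext. intros k Hk. unfold a. destruct (Nat.ltb_spec k (M0 + M)); auto; lia.
  - assert (HL : Clim (csum (pole_pair u)) (CSer (pole_pair u))) by now apply CSer_correct.
    assert (Hid : forall M, csum (fun j => coth_pair u (N M) (S j)) (M0 + M) =
      (/ (1 - cexp (- u)) - 1 / 2 - / INR (N M) * (/ (1 - cexp (- u / INR (N M))) - 1 / 2))%C).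
    { intros M. set (q := cexp (- u / INR (N M))). set (n := N M).
      assert (Hq : (q ^ n)%C = cexp (- u)).
      { unfold q. rewrite cexp_pow. f_equal. fold n. field. apply HNp. }
      assert (Hq1 : (1 - q ^ n)%C <> 0%C).
      { rewrite Hq, cexp_opp. intros E. apply Hu.
        assert (E2 : (/ cexp u)%C = 1%C) by (replace (/ cexp u)%C with (1 - (1 - / cexp u))%C by ring; rewrite E; ring).
        transitivity (cexp u * / cexp u)%C; [rewrite E2; ring|field; apply cexp_neq_0]. }
      assert (K := rt_kernel_sum n q ltac:(unfold n, N; lia) Hq1).
      assert (Kn : csum (fun k => / (1 - q / rt n k))%C n = csum (fun k => / (1 - q / rt n k))%C (2 * (M0 + M) + 1)) by reflexivity.
      rewrite Kn, csum_symmetric, rt_0 in K.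
      rewrite Hq in K.
      rewrite (csum_ext _ (fun j => / INR n * (/ (1 - q / rt n (S j)) + / (1 - q / rt n (2 * (M0 + M) - j)) - 1))%C).
      - rewrite csum_scal, csum_minus, csum_const.
        set (X := csum _ (M0 + M)) in *.
        assert (HX : X = (INR n / (1 - cexp (- u)) - / (1 - q / 1))%C) by (rewrite <- K; ring).
        rewrite HX. assert (En : INR n = 2 * INR (M0 + M) + 1).
        { unfold n, N. rewrite plus_INR, mult_INR. simpl; ring. }
        assert (En2 : RtoC (INR (M0 + M)) = ((INR n - 1) / 2)%C).
        { rewrite En, RtoC_plus, RtoC_mult. field. }
        rewrite En2. assert (Hn0 : RtoC (INR n) <> 0%C) by apply HNp. 
        replace (q / 1)%C with q by field.
        unfold Cdiv. generalize (/ (1 - cexp (- u)))%C (/ (1 - q))%C. intros x y. field. auto.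
      - intros j Hj. unfold coth_pair. fold n. fold q.
        assert (Er : (rt n (S j) * rt n (2 * (M0 + M) - j))%C = 1%C).
        { unfold rt. rewrite <- cexp_plus. replace (_ + _)%C with (im (2 * PI * INR 1)).
          rewrite INR_IZR_INZ. apply cexp_2PI_Z.
          apply C_eq; cbn [fst snd Cplus im]; [ring|].
          assert (Hs : INR (S j) + INR (2 * (M0 + M) - j) = INR n) by (rewrite <- plus_INR; f_equal; unfold n, N; lia).
          assert (Hn0 : INR n <> 0) by (apply not_0_INR; unfold n, N; lia).
          replace (INR (2 * (M0 + M) - j)) with (INR n - INR (S j)) by lra. simpl (INR 1). field. auto. }
        replace (q / rt n (2 * (M0 + M) - j))%C with (q * rt n (S j))%C. reflexivity.
        transitivity (q * (rt n (S j) * rt n (2 * (M0 + M) - j)) / rt n (2 * (M0 + M) - j))%C; [field; apply rt_neq_0|rewrite Er; unfold Cdiv; ring]. }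
    assert (HR : Clim (fun M => / (1 - cexp (- u)) - 1 / 2 - / INR (N M) * (/ (1 - cexp (- u / INR (N M))) - 1 / 2))%C
      (/ (1 - cexp (- u)) - 1 / 2 - / u)%C).
    { apply Clim_minus. apply Clim_const. now apply exp1m_scaled_inv_lim. }
    assert (E : CSer (pole_pair u) = (/ (1 - cexp (- u)) - 1 / 2 - / u)%C).
    { apply Clim_unique with (1 := T1). apply Clim_ext with (2 := HR). intros M. symmetry. apply Hid. }
    rewrite E in HL. apply Clim_eq with (1 := HL). rewrite cexp_opp.
    assert (HE := cexp_neq_0 u). assert (H1 : (cexp u - 1)%C <> 0%C).
    { intros E0. apply Hu. replace (cexp u) with (cexp u - 1 + 1)%C by ring. rewrite E0; ring. }
    field. repeat split; auto.
Qed.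

(** * Pochhammer symbols and the Beta series *)

Lemma poch_S_l (z : CC) n : poch z (S n) = (z * poch (z + 1) n)%C.
Proof.
  induction n. simpl; ring. change (poch z (S (S n))) with (poch z (S n) * (z + INR (S n)))%C. rewrite IHn.
  simpl poch. rewrite S_INR, RtoC_plus. ring.
Qed.

Lemma poch_reverse (w : CC) n : poch (- w - INR n + 1) n = ((- (1)) ^ n * poch w n)%C.
Proof.
  induction n. simpl; ring. rewrite S_INR, RtoC_plus, (poch_S_l (- w - (INR n + 1) + 1)). simpl poch. simpl Cpow.
  replace (- w - (INR n + 1) + 1 + 1)%C with (- w - INR n + 1)%C by ring. rewrite IHn. ring.
Qed.

Lemma poch_1 n : poch 1 n = RtoC (INR (fact n)).
Proof.
  induction n. reflexivity. simpl poch. rewrite IHn, fact_simpl, mult_INR, RtoC_mult, S_INR, RtoC_plus. ring.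
Qed.

Lemma S_INR_C n : RtoC (INR (S n)) = (INR n + 1)%C.
Proof. now rewrite S_INR, RtoC_plus. Qed.

Lemma INR_S_C_neq_0 n : RtoC (INR (S n)) <> 0%C.
Proof. apply RtoC_neq_0, not_0_INR; lia. Qed.

Definition beta_coef (s : CC) (n j : nat) : CC := (bcoef s j * bcoef (1 - s) (n - j))%C.

(* The residue at [z = -(n+1)] needed in the induction step is the value of the inductive hypothesis at that point. *)
Lemma beta_partial_fractions (s : CC) n : forall z : CC, (forall k, (k <= n)%nat -> (z + INR k)%C <> 0%C) ->
  (poch (z + 1 - s) n / poch z (S n))%C = csum (fun j => beta_coef s n j / (z + INR j))%C (S n).
Proof.
  induction n; intros z Hz.
  - simpl. unfold beta_coef, bcoef. simpl. assert (Hz0 : z <> 0%C) by (intros E; apply (Hz O); auto; rewrite E; simpl; ring).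
    field. replace (z + 0)%C with z by ring. auto.
  - assert (HS : csum (fun j => beta_coef s n j * s / INR (S n - j))%C (S n) = bcoef s (S n)).
    { set (z0 := (- INR (S n))%C).
      assert (Hz0 : forall k, (k <= n)%nat -> (z0 + INR k)%C <> 0%C).
      { intros k Hk. unfold z0. rewrite <- RtoC_opp, <- RtoC_plus. apply RtoC_neq_0.
        assert (INR k < INR (S n)) by (apply lt_INR; lia). lra. }
      specialize (IHn z0 Hz0).
      rewrite (csum_ext _ (fun j => - s * (beta_coef s n j / (z0 + INR j)))%C).
      - rewrite csum_scal, <- IHn.
        replace (z0 + 1 - s)%C with (- (s + 1) - INR n + 1)%C by (unfold z0; rewrite S_INR_C; ring).
        replace z0 with (- (1) - INR (S n) + 1)%C by (unfold z0; ring).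
        rewrite !poch_reverse, poch_1. unfold bcoef. rewrite poch_S_l. simpl Cpow.
        assert (H1 : ((- (1)) ^ n)%C <> 0%C) by (apply Cpow_nz; rewrite <- RtoC_opp; apply RtoC_neq_0; lra).
        field. split; auto using RfactC.
      - intros j Hj. unfold z0. rewrite minus_INR, RtoC_minus by lia.
        assert (Hd : (- INR (S n) + INR j)%C <> 0%C) by (apply (Hz0 j); lia).
        assert (Hd2 : (INR (S n) - INR j)%C <> 0%C) by (intros E; apply Hd; replace (- INR (S n) + INR j)%C with (- (INR (S n) - INR j))%C by ring; rewrite E; ring).
        field. auto. }
    assert (Hzn := Hz (S n) (Nat.le_refl _)).
    change (poch z (S (S n))) with (poch z (S n) * (z + INR (S n)))%C.
    change (poch (z + 1 - s) (S n)) with (poch (z + 1 - s) n * (z + 1 - s + INR n))%C.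
    assert (HP : poch z (S n) <> 0%C) by (apply poch_neq_0; intros; apply Hz; lia).
    replace (poch (z + 1 - s) n * (z + 1 - s + INR n) / (poch z (S n) * (z + INR (S n))))%C
      with ((z + 1 - s + INR n) / (z + INR (S n)) * (poch (z + 1 - s) n / poch z (S n)))%C by (field; auto).
    rewrite IHn by (intros; apply Hz; lia).
    change (csum (fun j => beta_coef s (S n) j / (z + INR j))%C (S (S n))) with
      (csum (fun j => beta_coef s (S n) j / (z + INR j))%C (S n) + beta_coef s (S n) (S n) / (z + INR (S n)))%C.
    replace (beta_coef s (S n) (S n)) with (bcoef s (S n)).
    2:{ unfold beta_coef. rewrite Nat.sub_diag. unfold bcoef at 3. simpl poch. simpl fact. simpl INR. field. }
    rewrite <- HS. match goal with |- _ = (_ + ?x / ?y)%C => replace (x / y)%C with (/ y * x)%C by (unfold Cdiv; ring) end.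
    rewrite <- !csum_scal, <- csum_plus.
    apply csum_ext. intros j Hj.
    assert (Hzj := Hz j ltac:(lia)).
    assert (E : beta_coef s (S n) j = (beta_coef s n j * ((1 - s + INR (n - j)) / INR (S n - j)))%C).
    { unfold beta_coef. replace (S n - j)%nat with (S (n - j)) by lia. rewrite bcoef_S. ring. }
    rewrite E. assert (Hnj : RtoC (INR (S n - j)) = (INR n + 1 - INR j)%C).
    { rewrite minus_INR, RtoC_minus, S_INR_C by lia. ring. }
    assert (Hn0 : (INR n + 1 - INR j)%C <> 0%C) by (rewrite <- Hnj; apply RtoC_neq_0, not_0_INR; lia).
    rewrite Hnj. rewrite minus_INR, RtoC_minus by lia. rewrite S_INR_C in *. field. auto.
Qed.

(** Partial sums are the coefficients of (1-t)^{-s} / (1-t) = (1-t)^{-(s+1)}. *)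
Lemma csum_bcoef (s : CC) n : csum (bcoef s) (S n) = bcoef (s + 1) n.
Proof.
  induction n.
  - simpl. unfold bcoef. simpl. field.
  - change (csum (bcoef s) (S (S n))) with (csum (bcoef s) (S n) + bcoef s (S n))%C. rewrite IHn, bcoef_S.
    assert (E : bcoef s (S n) = (s / INR (S n) * bcoef (s + 1) n)%C).
    { unfold bcoef. rewrite poch_S_l, fact_simpl, mult_INR, RtoC_mult. field. split; [apply RfactC|apply INR_S_C_neq_0]. }
    rewrite bcoef_S in E. rewrite E. rewrite bcoef_S. assert (H := INR_S_C_neq_0 n). rewrite S_INR_C in *. field. auto.
Qed.

Lemma Clim_inv_INR : Clim (fun n => / INR n)%C 0.
Proof.
  apply Clim_squeeze with (fun n => 1 / INR n); [|apply is_lim_seq_inv_INR]. exists 1%nat. intros n Hn.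
  assert (1 <= INR n) by (apply (le_INR 1); lia). replace (/ INR n - 0)%C with (/ INR n)%C by ring.
  rewrite <- RtoC_inv, Cmod_R, Rabs_pos_eq by (try lra; left; apply Rinv_0_lt_compat; lra). unfold Rdiv; lra.
Qed.

Lemma shifted_neq_0 (z : CC) (x : R) : Cmod z + 1 <= x -> (z + x)%C <> 0%C.
Proof.
  intros Hx. generalize (Cmod_ge_0 z); intros. apply Cmod_gt_0. rewrite Cplus_comm.
  generalize (Cmod_triangle_plus x z). rewrite Cmod_R, Rabs_pos_eq by lra. lra.
Qed.

Lemma shift_quotient_lim (z : CC) : Clim (fun n => INR n / (z + INR n))%C 1.
Proof.
  apply Clim_ext_loc with (fun n => / (1 + z * / INR n))%C.
  - destruct (exists_INR_ge (Cmod z + 1)) as [N HN]. exists N. intros n Hn. apply le_INR in Hn.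
    generalize (Cmod_ge_0 z); intros. assert (H1 : RtoC (INR n) <> 0%C) by (apply RtoC_neq_0; lra).
    assert (H2 : (z + INR n)%C <> 0%C).
    { apply shifted_neq_0; lra. }
    field. repeat split; auto.
  - apply Clim_eq with (/ (1 + z * 0))%C; [|replace (1 + z * 0)%C with (RtoC 1) by ring; field].
    apply Clim_inv. replace (1 + z * 0)%C with (RtoC 1) by ring. apply RtoC_neq_0; lra.
    apply Clim_plus. apply Clim_const. apply Clim_scal, Clim_inv_INR.
Qed.

Lemma cpow_one_minus n (s : CC) : (0 < n)%nat -> cpow (INR n) (1 - s) = (INR n / cpow (INR n) s)%C.
Proof. intros Hn. rewrite cpow_minus, cpow_1; auto. apply (lt_INR 0); lia. Qed.

(** [gauss_seq s n] contains one more Pochhammer factor, s + n; hence the quotient n / (s + n),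
    which tends to 1. *)
Lemma bcoef_lim (s : CC) : Clim (fun n => bcoef s n * cpow (INR n) (1 - s))%C (rgamma s).
Proof.
  apply Clim_eq with (rgamma s * 1)%C; [|ring].
  apply Clim_ext_loc with (fun n => gauss_seq s n * (INR n / (s + INR n)))%C.
  - destruct (exists_INR_ge (Cmod s + 1)) as [N HN]. exists N. intros n Hn. apply le_INR in Hn.
    generalize (Cmod_ge_0 s); intros. assert (Hn0 : (0 < n)%nat) by (apply INR_lt; simpl; lra).
    assert (H2 : (s + INR n)%C <> 0%C).
    { apply shifted_neq_0; lra. }
    rewrite cpow_one_minus by auto. unfold gauss_seq, bcoef. simpl poch. field.
    repeat split; auto using RfactC, cpow_neq_0.
  - apply Clim_mult. apply gauss_lim. apply shift_quotient_lim.
Qed.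

Lemma bcoef_decay (s : CC) : exists K, 0 <= K /\ forall n, (0 < n)%nat -> Cmod (bcoef s n) <= K * Rpower (INR n) (fst s - 1).
Proof.
  destruct (Clim_bounded _ _ (bcoef_lim s)) as [K HK]. exists K. split.
  - eapply Rle_trans; [apply Cmod_ge_0|apply (HK O)].
  - intros n Hn. specialize (HK n). rewrite Cmod_mult, Cmod_cpow in HK. simpl in HK.
    replace (fst s - 1) with (- (1 + - fst s)) by ring. rewrite Rpower_Ropp.
    apply Rmult_le_reg_r with (Rpower (INR n) (1 + - fst s)). apply Rpower_pos.
    rewrite Rmult_assoc, Rinv_l by (apply Rgt_not_eq, Rpower_pos). lra.
Qed.

Lemma bcoef_summable (s : CC) : fst s < 0 -> ex_series (fun j => Cmod (bcoef s j)).
Proof.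
  intros Hs. destruct (bcoef_decay s) as [K [HK0 HK]]. apply ex_series_shift with 1%nat.
  apply ex_series_Cmod_le with (fun k => K * Rpower (INR (S k)) (- (1 - fst s))).
  - intros k. replace (- (1 - fst s)) with (fst s - 1) by ring. apply HK. lia.
  - apply ex_series_scalR, ex_series_Rpower. lra.
Qed.

Lemma Rpower_INR_lim p : p < 0 -> is_lim_seq (fun n => Rpower (INR n) p) 0.
Proof.
  intros Hp. apply is_lim_seq_ext with (fun n => exp (p * ln (INR n))). auto.
  apply (is_lim_comp_seq exp (fun n => p * ln (INR n)) m_infty 0).
  - apply is_lim_exp_m.
  - exists O; intros n _; discriminate.
  - apply is_lim_seq_ext with (fun n => - ((- p) * ln (INR n))). intros; ring.
    apply (is_lim_seq_opp _ p_infty). 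
    apply is_lim_seq_mult with (Finite (- p)) p_infty. apply is_lim_seq_const.
    apply (is_lim_comp_seq ln INR p_infty p_infty). apply is_lim_ln_p. exists O; intros; discriminate. apply is_lim_seq_INR.
    unfold is_Rbar_mult, Rbar_mult'. destruct (Rle_dec 0 (- p)) as [Hd|Hd]; [|lra].
    destruct (Rle_lt_or_eq_dec 0 (- p) Hd); auto. lra.
Qed.

(** The value of (1-t)^{-s} at t = 1. By [csum_bcoef] and [bcoef_lim] the partial sums have the size
    of n^s, which tends to 0. *)
Lemma bcoef_sum_zero (s : CC) : fst s < 0 -> CSer (bcoef s) = 0%C.
Proof.
  intros Hs. apply CSer_unique. apply Clim_decr with 1%nat.
  apply Clim_ext with (fun n => bcoef (s + 1) n). intros n. rewrite Nat.add_1_r. symmetry; apply csum_bcoef.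
  apply Clim_ext_loc with (fun n => bcoef (s + 1) n * cpow (INR n) (1 - (s + 1)) * / cpow (INR n) (- s))%C.
  - exists 1%nat. intros n Hn. replace (1 - (s + 1))%C with (- s)%C by ring. field. apply cpow_neq_0.
  - apply Clim_eq with (rgamma (s + 1) * 0)%C; [|ring]. apply Clim_mult. apply bcoef_lim.
    apply Clim_squeeze with (fun n => Rpower (INR n) (fst s)).
    + exists 1%nat. intros n Hn. replace (_ - 0)%C with (/ cpow (INR n) (- s))%C by ring.
      rewrite <- cpow_opp. replace (- - s)%C with s by ring. rewrite Cmod_cpow. lra.
    + now apply Rpower_INR_lim.
Qed.

Lemma Rpower_ratio_le m n p : (0 < m)%nat -> (m <= n)%nat -> p <= 0 -> Rpower (INR n) p <= Rpower (INR m) p.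
Proof. intros Hm Hn Hp. apply Rpower_le_base_neg; auto. apply (lt_INR 0); lia. now apply le_INR. Qed.

Lemma shifted_INR_bound (z : CC) : (forall k : nat, (z + INR k)%C <> 0%C) -> exists d, 0 < d /\ forall k : nat, d <= Cmod (z + INR k).
Proof.
  intros Hz. destruct (exists_INR_ge (Cmod z + 1)) as [N HN].
  assert (H : exists d, 0 < d /\ forall k, (k < N)%nat -> d <= Cmod (z + INR k)).
  { clear HN. induction N. exists 1. split; [lra|intros; lia]. destruct IHN as [d [Hd HdN]].
    exists (Rmin d (Cmod (z + INR N))). split. apply Rmin_glb_lt; auto. apply Cmod_gt_0; auto.
    intros k Hk. destruct (Nat.eq_dec k N) as [->|Hne]. apply Rmin_r. eapply Rle_trans; [apply Rmin_l|]. apply HdN; lia. }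
  destruct H as [d [Hd HdN]]. exists (Rmin d 1). split. apply Rmin_glb_lt; lra.
  intros k. destruct (le_lt_dec N k) as [Hk|Hk].
  - eapply Rle_trans; [apply Rmin_r|]. apply le_INR in Hk. generalize (Cmod_triangle_plus (INR k) z).
    generalize (Cmod_ge_0 z); intros. rewrite Cmod_R, Rabs_pos_eq, Cplus_comm in H0 by lra. lra.
  - eapply Rle_trans; [apply Rmin_l|]. auto.
Qed.

Lemma beta_terms_summable (s z : CC) : fst s < 0 -> (forall k : nat, (z + INR k)%C <> 0%C) ->
  ex_series (fun j => Cmod (bcoef s j / (z + INR j))).
Proof.
  intros Hs Hz. destruct (shifted_INR_bound z Hz) as [d [Hd Hdk]].
  apply ex_series_Cmod_le with (fun j => / d * Cmod (bcoef s j)).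
  - intros j. unfold Cdiv. rewrite Cmod_mult, Rmult_comm. apply Rmult_le_compat_r. apply Cmod_ge_0. apply Cmod_inv_le; auto.
  - now apply ex_series_scalR, bcoef_summable.
Qed.

Lemma gauss_ratio_lim (s z : CC) : (forall k : nat, (z + INR k)%C <> 0%C) ->
  Clim (fun n => poch (z + 1 - s) n / poch z (S n) * cpow (INR n) s)%C (rgamma (z + 1 - s) / rgamma z)%C.
Proof.
  intros Hz. apply Clim_eq with (rgamma (z + 1 - s) * / rgamma z * 1)%C; [|unfold Cdiv; ring].
  apply Clim_ext_loc with (fun n => gauss_seq (z + 1 - s) n * / gauss_seq z n * (INR n / (z + 1 - s + INR n)))%C.
  - destruct (exists_INR_ge (Cmod (z + 1 - s) + 1)) as [N HN]. exists N. intros n Hn. apply le_INR in Hn.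
    generalize (Cmod_ge_0 (z + 1 - s)); intros. assert (Hn0 : (0 < n)%nat) by (apply INR_lt; simpl; lra).
    assert (H2 : (z + 1 - s + INR n)%C <> 0%C).
    { apply shifted_neq_0; lra. }
    unfold gauss_seq. change (poch (z + 1 - s) (S n)) with (poch (z + 1 - s) n * (z + 1 - s + INR n))%C.
    assert (HP : poch z (S n) <> 0%C) by (apply poch_neq_0; auto).
    replace (cpow (INR n) (z + 1 - s)) with (cpow (INR n) z * INR n / cpow (INR n) s)%C.
    2:{ replace (z + 1 - s)%C with (z + (1 - s))%C by ring. rewrite cpow_plus, cpow_one_minus by auto. unfold Cdiv; ring. }
    assert (HnC : RtoC (INR n) <> 0%C) by (apply RtoC_neq_0; lra).
    set (Q := poch z (S n)) in *. field. repeat split; auto using RfactC, cpow_neq_0.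
  - apply Clim_mult. apply Clim_mult. apply gauss_lim. apply Clim_inv. now apply rgamma_neq_0. apply gauss_lim. apply shift_quotient_lim.
Qed.

Lemma INR_ratio_lim j : Clim (fun n => INR n / INR (n - j))%C 1.
Proof.
  apply Clim_ext_loc with (fun n => INR n / (- INR j + INR n))%C; [|apply shift_quotient_lim].
  exists j. intros n Hn. rewrite minus_INR, RtoC_minus by auto. replace (INR n - INR j)%C with (- INR j + INR n)%C by ring. reflexivity.
Qed.

Lemma cpow_ratio_lim j (s : CC) : Clim (fun n => cpow (INR n) s * / cpow (INR (n - j)) s)%C 1.
Proof.
  apply Clim_ext_loc with (fun n => cexp (s * ln (INR n / INR (n - j)))).
  - exists (S j). intros n Hn. assert (0 < INR n) by (apply (lt_INR 0); lia). assert (0 < INR (n - j)) by (apply (lt_INR 0); lia).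
    unfold cpow. rewrite <- cexp_opp, <- cexp_plus. f_equal.
    unfold Rdiv. rewrite ln_mult, ln_Rinv, RtoC_plus, RtoC_opp by (auto; now apply Rinv_0_lt_compat). ring.
  - rewrite <- cexp_0. apply (hol_continuous cexp). apply hol_cexp_id.
    apply Clim_eq with (s * RtoC 0)%C; [|ring]. apply Clim_scal.
    apply Clim_components. simpl. split; [|apply is_lim_seq_const].
    rewrite <- ln_1. apply is_lim_seq_continuous.
    + apply continuity_pt_filterlim. apply (ex_derive_continuous ln 1). exists (/ 1). apply is_derive_Reals. apply derivable_pt_lim_ln; lra.
    + assert (L := INR_ratio_lim j). apply Clim_components in L as [L _].
      apply is_lim_seq_ext_loc with (fun n => fst (INR n / INR (n - j))%C); [|exact L]. exists (S j). intros n Hn.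
      rewrite <- RtoC_div by (apply not_0_INR; lia). reflexivity.
Qed.

Lemma beta_series (s z : CC) : fst s < 0 -> (forall k : nat, (z + INR k)%C <> 0%C) ->
  CSer (fun j => bcoef s j / (z + INR j))%C = (Gamma (1 - s) * Gamma z / Gamma (z + 1 - s))%C.
Proof.
  intros Hs Hz.
  assert (H1s : rgamma (1 - s) <> 0%C).
  { apply rgamma_neq_0. intros k E. assert (E1 := f_equal fst E). simpl in E1. generalize (pos_INR k). lra. }
  set (B := fun j => (bcoef s j / (z + INR j))%C).
  assert (HB : ex_series (fun j => Cmod (B j))) by now apply beta_terms_summable.
  destruct (bcoef_decay (1 - s)) as [K [HK0 HK]].
  assert (HK2 : forall n j, (0 < n)%nat -> (j <= n)%nat -> Cmod (bcoef (1 - s) (n - j) * cpow (INR n) s) <= K + 1).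
  { intros n j Hn Hj. rewrite Cmod_mult, Cmod_cpow.
    assert (Hn1 : Rpower (INR n) (fst s) <= 1).
    { replace 1 with (Rpower (INR 1) (fst s)). apply Rpower_ratio_le; auto; lra.
      simpl. unfold Rpower. rewrite ln_1, Rmult_0_r. apply exp_0. }
    destruct (Nat.eq_dec j n) as [->|Hne].
    - rewrite Nat.sub_diag. unfold bcoef. simpl poch. simpl fact. simpl INR. replace (1 / 1)%C with (RtoC 1) by field. rewrite Cmod_1. lra.
    - specialize (HK (n - j)%nat ltac:(lia)). replace (fst (1 - s)%C - 1) with (- fst s) in HK by (simpl; ring).
      rewrite Rpower_Ropp in HK.
      assert (Q := Rpower_ratio_le (n - j) n (fst s) ltac:(lia) ltac:(lia) ltac:(lra)).
      assert (P1 := Rpower_pos (INR (n - j)) (fst s)). assert (P2 := Rpower_pos (INR n) (fst s)).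
      apply Rle_trans with (K * / Rpower (INR (n - j)) (fst s) * Rpower (INR (n - j)) (fst s)).
      apply Rmult_le_compat; auto using Cmod_ge_0. lra. rewrite Rmult_assoc, Rinv_l by lra. lra. }
  set (a := fun n j => if (j <=? S n)%nat then (B j * (bcoef (1 - s) (S n - j) * cpow (INR (S n)) s))%C else 0%C).
  assert (T := Tannery a (fun j => B j * rgamma (1 - s))%C
     (fun n => poch (z + 1 - s) (S n) / poch z (S (S n)) * cpow (INR (S n)) s)%C (fun j => (K + 1) * Cmod (B j))).
  assert (L : Clim (fun n => poch (z + 1 - s) (S n) / poch z (S (S n)) * cpow (INR (S n)) s)%C (CSer (fun j => B j * rgamma (1 - s)))%C).
  { apply T.
    - intros n j. unfold a. destruct (Nat.leb_spec j (S n)).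
      + rewrite Cmod_mult, Rmult_comm. apply Rmult_le_compat_r. apply Cmod_ge_0. apply HK2; lia.
      + rewrite Cmod_0. apply Rmult_le_pos; [lra|apply Cmod_ge_0].
    - now apply ex_series_scalR.
    - intros j. apply Clim_ext_loc with (fun n => B j * (bcoef (1 - s) (S n - j) * cpow (INR (S n)) s))%C.
      + exists j. intros n Hn. unfold a. destruct (Nat.leb_spec j (S n)); auto; lia.
      + apply Clim_scal. apply Clim_decr with j.
        apply Clim_ext with (fun n => bcoef (1 - s) (n + 1) * cpow (INR (n + 1)) (1 - (1 - s)) * (cpow (INR (n + (1 + j))) s * / cpow (INR (n + (1 + j) - j)) s))%C.
        * intros n. replace (S (n + j) - j)%nat with (n + 1)%nat by lia. replace (n + (1 + j) - j)%nat with (n + 1)%nat by lia.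
          replace (n + (1 + j))%nat with (S (n + j)) by lia.
          replace (1 - (1 - s))%C with s by ring. field. apply cpow_neq_0.
        * apply Clim_eq with (rgamma (1 - s) * 1)%C; [|ring]. apply Clim_mult.
          apply (Clim_incr (fun n => bcoef (1 - s) n * cpow (INR n) (1 - (1 - s)))%C _ 1), bcoef_lim.
          apply (Clim_incr (fun n => cpow (INR n) s * / cpow (INR (n - j)) s)%C _ (1 + j)), cpow_ratio_lim.
    - intros n. rewrite (beta_partial_fractions s (S n) z) by auto. rewrite Cmult_comm, <- csum_scal.
      replace (csum _ (S (S n))) with (csum (a n) (S (S n))).
      + apply csum_finite_lim. intros k Hk. unfold a. destruct (Nat.leb_spec k (S n)); auto; lia.
      + apply csum_ext. intros k Hk. unfold a. destruct (Nat.leb_spec k (S n)); [|lia].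
        unfold B, beta_coef, Cdiv. ring. }
  assert (L2 := gauss_ratio_lim s z Hz). apply (Clim_incr _ _ 1) in L2.
  assert (E : CSer (fun j => B j * rgamma (1 - s))%C = (rgamma (z + 1 - s) / rgamma z)%C).
  { apply Clim_unique with (1 := L). apply Clim_ext with (2 := L2). intros n. rewrite Nat.add_1_r. reflexivity. }
  assert (E2 : CSer (fun j => B j * rgamma (1 - s))%C = (rgamma (1 - s) * CSer B)%C).
  { apply CSer_unique. apply Clim_ext with (fun n => rgamma (1 - s) * csum B n)%C.
    intros n. rewrite <- csum_scal. apply csum_ext; intros; ring. apply Clim_scal. now apply CSer_correct. }
  assert (Hz0 : rgamma z <> 0%C) by now apply rgamma_neq_0.
  unfold Gamma. unfold Cdiv. 
  (* If z + 1 - s is a pole of Gamma, [rgamma] is 0 there and both inversions return 0, so the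
     quotient has the correct value 0. *)
  assert (EI : (/ / rgamma (z + 1 - s))%C = rgamma (z + 1 - s)).
  { destruct (Ceq_dec (rgamma (z + 1 - s)) 0) as [E0|E0]; [|field; auto].
    rewrite E0. apply C_eq; unfold Cinv; simpl; unfold Rdiv; rewrite ?Rmult_0_l, ?Ropp_0, ?Rmult_0_l; ring. }
  rewrite EI. transitivity (/ rgamma (1 - s) * (rgamma (1 - s) * CSer B))%C. field; auto.
  rewrite <- E2, E. unfold Cdiv. ring.
Qed.

(** * The formula for negative real part *)

Lemma Ci_im (x : R) : (Ci * x)%C = im x.
Proof. apply C_eq; simpl; ring. Qed.

Definition ym (L : R) (m : Z) : R := PI * IZR m / (2 * L).

(** Chosen so that u_j - 2 pi i m = 4L (z_m + j), see [bexp_zm]: the m-th partial fraction, summed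
    over j, is then the Beta series at z_m. *)
Definition zm (L : R) (s : CC) (m : Z) : CC := (s / 2 - im (ym L m))%C.

Lemma zm_pole L s m (k : nat) : 0 < L -> (zm L s m + INR k)%C = 0%C -> pole_set L s.
Proof.
  intros HL E. exists m, k. unfold zm, ym in E.
  assert (E2 : s = (2 * im (PI * IZR m / (2 * L)) - 2 * INR k)%C).
  { replace s with (2 * (s / 2 - im (PI * IZR m / (2 * L)) + INR k) + 2 * im (PI * IZR m / (2 * L)) - 2 * INR k)%C by field.
    rewrite E. ring. }
  rewrite E2. apply C_eq; simpl; field; lra.
Qed.

Lemma zm_not_pole L s m : 0 < L -> ~ pole_set L s -> forall k : nat, (zm L s m + INR k)%C <> 0%C.
Proof. intros HL Hs k E. apply Hs. now apply zm_pole with m k. Qed.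

Lemma T2_zm L s m : T2 L s m = (Gamma (zm L s m) / Gamma (zm L s m + 1 - s))%C.
Proof.
  unfold T2. rewrite !Ci_im. unfold zm, ym. set (y := im _).
  replace (s / 2 - y + 1 - s)%C with (1 - s / 2 - y)%C by field. reflexivity.
Qed.

Lemma bexp_zm L s j m : L <> 0 -> (bexp L s j - im (2 * PI * IZR m))%C = ((4 * L)%R * (zm L s m + INR j))%C.
Proof. intros HL. unfold bexp, zm, ym. apply C_eq; simpl; field; auto. Qed.

(** The telescoping form is what makes the sum over m bounded by 8, independently of [u]; a bound in
    m alone would not do, because u_j grows with j. The pair is 2u / (u^2 + b^2) with b = 2 pi
    (m+1), and the sector condition keeps Re(u^2) above 3/4 of (Re u)^2. *)
Lemma pole_pair_bound (u : CC) m : 1 <= fst u -> 2 * Rabs (snd u) <= fst u ->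
  Cmod (pole_pair u m) <= 8 * fst u * (/ (fst u + INR m) - / (fst u + INR (S m))).
Proof.
  intros Hx Hy. set (x := fst u) in *. set (y := snd u) in *. set (t := INR (S m)).
  assert (Ht : 1 <= t) by (apply (le_INR 1); lia). set (b := 2 * PI * t).
  assert (Hb : t <= b) by (unfold b; generalize PI_bounds; nra).
  assert (Hy2 : y ^ 2 <= x ^ 2 / 4) by (rewrite <- (pow2_abs y); generalize (Rabs_pos y); nra).
  set (den := (u * u + RtoC (b * b))%C).
  assert (Hden : 3/4 * (x ^ 2 + t ^ 2) <= Cmod den).
  { generalize (Cmod_fst_le den) (Rle_abs (fst den)). unfold den. simpl. fold x y. nra. }
  assert (Hd0 : den <> 0%C) by (apply Cmod_gt_0; nra).
  assert (E : pole_pair u m = (2 * u / den)%C).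
  { unfold pole_pair. fold t b.
    assert (Hf : ((u + im b) * (u - im b))%C = den) by (unfold den; apply C_eq; simpl; ring).
    assert (D1 : (u + im b)%C <> 0%C) by (intros E; apply Hd0; rewrite <- Hf, E; ring).
    assert (D2 : (u - im b)%C <> 0%C) by (intros E; apply Hd0; rewrite <- Hf, E; ring).
    rewrite <- Hf. field. auto. }
  assert (Hnum : Cmod (2 * u) <= 3 * x).
  { rewrite Cmod_mult, Cmod_R, Rabs_pos_eq by lra. generalize (Cmod_le_abs u). fold x y. rewrite (Rabs_pos_eq x) by lra. lra. }
  rewrite E, Cmod_div by auto.
  assert (Ex : INR m = t - 1) by (unfold t; rewrite S_INR; ring). rewrite Ex.
  replace (8 * x * (/ (x + (t - 1)) - / (x + t))) with (3 * x * (8/3 * / ((x + (t - 1)) * (x + t)))) by (field; lra).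
  apply Rmult_le_compat; auto using Cmod_ge_0. left; apply Rinv_0_lt_compat; nra.
  apply Rle_trans with (/ (3/4 * (x ^ 2 + t ^ 2))). apply Rinv_le_contravar; nra.
  replace (8/3 * / ((x + (t - 1)) * (x + t))) with (/ (3/8 * ((x + (t - 1)) * (x + t)))) by (field; lra).
  apply Rinv_le_contravar. apply Rmult_lt_0_compat; [lra|]. apply Rmult_lt_0_compat; lra.
  assert ((x + t) ^ 2 <= 2 * (x ^ 2 + t ^ 2)) by (generalize (pow2_ge_0 (x - t)); nra). nra.
Qed.

Lemma pole_pair_sum_bound (u : CC) M : 1 <= fst u -> 2 * Rabs (snd u) <= fst u ->
  Cmod (csum (pole_pair u) M) <= 8.
Proof.
  intros Hx Hy. eapply Rle_trans; [apply csum_mod_le|].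
  eapply Rle_trans; [apply (rsum_le _ (fun m => 8 * fst u * (/ (fst u + INR m) - / (fst u + INR (S m))))); intros; now apply pole_pair_bound|].
  rewrite rsum_scal. set (x := fst u) in *.
  assert (E : rsum (fun k => / (x + INR k) - / (x + INR (S k))) M = / x - / (x + INR M)).
  { induction M. simpl. rewrite Rplus_0_r. ring. cbn [rsum]. rewrite IHM. ring. }
  rewrite E. assert (0 < / (x + INR M)) by (apply Rinv_0_lt_compat; generalize (pos_INR M); lra).
  assert (x * / x = 1) by (apply Rinv_r; lra). nra.
Qed.

(** [Tannery_ev] runs over j, with the symmetric range |m| <= M of partial fractions as the
    parameter. For fixed M the sum over j is a finite combination of Beta series; as M grows, each
    term tends to c_j (1/(e^{u_j} - 1) + 1/2), and the constants 1/2 drop out because the c_j sum to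
    0. *)
Lemma T2_formula L s : 0 < L -> fst s < 0 -> ~ pole_set L s ->
  Clim (fun M => Gamma (1 - s) / (4 * L)%R * (T2 L s 0 + csum (fun k => T2 L s (Z.of_nat (S k)) + T2 L s (- Z.of_nat (S k))) M))%C
   (SL L s).
Proof.
  intros HL Hs Hp. assert (H4L : RtoC (4 * L) <> 0%C) by (apply RtoC_neq_0; lra).
  set (u := bexp L s).
  assert (Hu : forall j, cexp (u j) <> 1%C) by (intros j E; apply Hp; now apply bexp_pole with j).
  assert (Hz : forall m (k : nat), (zm L s m + INR k)%C <> 0%C) by (intros; now apply zm_not_pole).
  assert (HT : forall m, Clim (csum (fun j => bcoef s j / (zm L s m + INR j))%C) (Gamma (1 - s) * T2 L s m)%C).
  { intros m. apply Clim_eq with (CSer (fun j => bcoef s j / (zm L s m + INR j))%C).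
    apply CSer_correct. now apply beta_terms_summable. rewrite beta_series by auto. rewrite T2_zm. unfold Cdiv; ring. }
  assert (Hinv : forall j m, (/ (u j - im (2 * PI * IZR m)))%C = (/ (4 * L)%R * / (zm L s m + INR j))%C).
  { intros j m. unfold u. rewrite bexp_zm by lra. field. split; auto. }
  assert (Hinv0 : forall j, (/ u j)%C = (/ (4 * L)%R * / (zm L s 0 + INR j))%C).
  { intros j. rewrite <- Hinv. f_equal. rewrite Rmult_0_r. apply C_eq; simpl; ring. }
  assert (Hpair : forall j m, pole_pair (u j) m = (/ (4 * L)%R * (/ (zm L s (Z.of_nat (S m)) + INR j) + / (zm L s (- Z.of_nat (S m)) + INR j)))%C).
  { intros j m. rewrite Cmult_plus_distr_l, <- !Hinv. unfold pole_pair. rewrite opp_IZR, <- INR_IZR_INZ, Cplus_comm. f_equal. f_equal.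
    apply C_eq; simpl; ring. }
  assert (H2L : 0 < 2 * L) by lra.
  (* The imaginary part of u_j does not depend on j, so from [J] on the exponent lies in the sector
     of [pole_pair_sum_bound]. The majorant 9 |c_j| is 8 from there plus 1 for 1/u_j. *)
  destruct (exists_INR_ge ((1 + 2 * Rabs (2 * L * snd s)) / (2 * L) + Rabs (fst s))) as [J HJ].
  destruct (Tannery_ev (fun M j => bcoef s j * (/ u j + csum (pole_pair (u j)) M))%C
    (fun j => bcoef s j * (/ (cexp (u j) - 1) + 1 / 2))%C
    (fun M => Gamma (1 - s) / (4 * L)%R * (T2 L s 0 + csum (fun k => T2 L s (Z.of_nat (S k)) + T2 L s (- Z.of_nat (S k))) M))%C
    (fun j => 9 * Cmod (bcoef s j)) J) as [T1 _].
  - intros M j Hj. rewrite Cmod_mult, Rmult_comm. apply Rmult_le_compat_r. apply Cmod_ge_0.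
    assert (Hx : 1 + 2 * Rabs (snd (u j)) <= fst (u j)).
    { unfold u. rewrite fst_bexp, snd_bexp. apply le_INR in Hj.
      assert (Q : (1 + 2 * Rabs (2 * L * snd s)) / (2 * L) <= fst s + 2 * INR j).
      { generalize (Rabs_le_between (fst s) (Rabs (fst s))) (pos_INR J). intros [Q _] _. specialize (Q (Rle_refl _)).
        generalize (pos_INR j). lra. }
      apply Rmult_le_compat_l with (r := 2 * L) in Q; [|lra]. eapply Rle_trans; [|exact Q]. right. field. lra. }
    generalize (Rabs_pos (snd (u j))); intros Hy.
    eapply Rle_trans; [apply Cmod_triangle|].
    assert (Q1 := pole_pair_sum_bound (u j) M ltac:(lra) ltac:(lra)).
    assert (Q2 : Cmod (/ u j) <= / 1).
    { apply Cmod_inv_le; [lra|]. generalize (Cmod_fst_le (u j)) (Rle_abs (fst (u j))). lra. }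
    lra.
  - apply ex_series_scalR. now apply bcoef_summable.
  - intros j. apply Clim_scal. apply Clim_eq with (/ u j + (/ (cexp (u j) - 1) + 1 / 2 - / u j))%C; [|ring].
    apply Clim_plus. apply Clim_const. now apply coth_partial_fractions.
  - intros M.
    apply Clim_ext with (fun n => / (4 * L)%R * (csum (fun j => bcoef s j / (zm L s 0 + INR j)) n
      + csum (fun k => csum (fun j => bcoef s j / (zm L s (Z.of_nat (S k)) + INR j)) n + csum (fun j => bcoef s j / (zm L s (- Z.of_nat (S k)) + INR j)) n) M))%C.
    + intros n. rewrite (csum_ext (fun k => _ + _)%C (fun k => csum (fun j => bcoef s j / (zm L s (Z.of_nat (S k)) + INR j) + bcoef s j / (zm L s (- Z.of_nat (S k)) + INR j)) n)%C) by (intros; now rewrite csum_plus).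
      rewrite csum_swap, <- csum_plus, <- csum_scal. apply csum_ext. intros j _.
      rewrite Hinv0. unfold Cdiv.
      rewrite (csum_ext (pole_pair (u j)) (fun m => / (4 * L)%R * (/ (zm L s (Z.of_nat (S m)) + INR j) + / (zm L s (- Z.of_nat (S m)) + INR j)))%C) by (intros; apply Hpair).
      rewrite csum_scal. rewrite (csum_ext (fun k => bcoef s j * _ + bcoef s j * _)%C (fun k => bcoef s j * (/ (zm L s (Z.of_nat (S k)) + INR j) + / (zm L s (- Z.of_nat (S k)) + INR j)))%C) by (intros; ring).
      rewrite csum_scal. ring.
    + apply Clim_eq with (/ (4 * L)%R * (Gamma (1 - s) * T2 L s 0 + csum (fun k => Gamma (1 - s) * T2 L s (Z.of_nat (S k)) + Gamma (1 - s) * T2 L s (- Z.of_nat (S k))) M))%C.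
      * apply Clim_scal. apply Clim_plus. apply HT.
        apply (Clim_csum (fun k n => csum (fun j => bcoef s j / (zm L s (Z.of_nat (S k)) + INR j)) n + csum (fun j => bcoef s j / (zm L s (- Z.of_nat (S k)) + INR j)) n)%C
          (fun k => Gamma (1 - s) * T2 L s (Z.of_nat (S k)) + Gamma (1 - s) * T2 L s (- Z.of_nat (S k)))%C).
        intros k _. apply Clim_plus; apply HT.
      * rewrite (csum_ext (fun k => _ + _)%C (fun k => Gamma (1 - s) * (T2 L s (Z.of_nat (S k)) + T2 L s (- Z.of_nat (S k))))%C) by (intros; ring).
        rewrite csum_scal. unfold Cdiv. ring.
  - apply Clim_eq with (1 := T1). apply CSer_unique.
    apply Clim_ext with (fun n => csum (Sterm L s) n + 1 / 2 * csum (bcoef s) n)%C.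
    + intros n. rewrite <- csum_scal, <- csum_plus. apply csum_ext. intros j _. unfold Sterm. fold (u j). unfold Cdiv. ring.
    + apply Clim_eq with (SL L s + 1 / 2 * 0)%C; [|ring]. apply Clim_plus.
      apply CSer_correct. now apply ex_series_Sterm. apply Clim_scal. rewrite <- (bcoef_sum_zero s Hs).
      apply CSer_correct. now apply bcoef_summable.
Qed.

(** * Asymptotics of the Gamma quotient *)

Definition sgnR (y : R) : R := if Rlt_dec 0 y then 1 else -1.

(* The branch of log (x - i y), smooth in [x] on the whole line for [y <> 0]. *)
Definition hlog (y x : R) : CC := (ln (x ^ 2 + y ^ 2) / 2, - (sgnR y * (PI / 2)) + atan (x / y)).

Lemma hlog_der (y x : R) : y <> 0 -> Cder (hlog y) x (/ (x - im y))%C.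
Proof.
  intros Hy. assert (Hp : 0 < x ^ 2 + y ^ 2) by nra. split; unfold hlog; cbn [fst snd].
  - auto_derive. simpl in Hp. lra. unfold Cinv, Cminus, Cplus, Copp, im, RtoC; cbn [fst snd]. field. repeat split; nra.
  - assert (Hd : is_derive (fun x => x / y) x (/ y)) by (auto_derive; auto; field; auto).
    assert (Ha : is_derive atan (x / y) (/ (1 + (x / y) ^ 2))).
    { apply is_derive_Reals. apply derivable_pt_lim_atan. }
    assert (Hc := is_derive_compR atan (fun x => x / y) x _ _ Ha Hd).
    eapply is_derive_eqR. apply @is_derive_plus. apply @is_derive_const. apply Hc.
    unfold plus, zero; simpl. field. repeat split; auto; nra.
Qed.

Lemma Cmod_im_part_le (c y : R) : Rabs y <= Cmod (c - im y).
Proof. eapply Rle_trans; [|apply Cmod_snd_le]. simpl. rewrite <- (Rabs_Ropp y). right. f_equal. ring. Qed.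

(** The midpoint rule for 1/(x - iy) on the unit interval about c. With t the half-length, the
    derivative of the error is 2t^2 / (v (v^2 - t^2)), at most (8/3) t^2 / |v|^3; integrating up to
    t = 1/2 gives even 1/9 in place of 1. *)
Lemma hlog_step (y c : R) : 1 <= Rabs y ->
  let v := (c - im y)%C in
  Cmod (hlog y (c + / 2) - hlog y (c - / 2) - / v) <= / Cmod v ^ 3.
Proof.
  intros Hy v. assert (Hy0 : y <> 0) by (intros E; rewrite E, Rabs_R0 in Hy; lra).
  assert (Hv : 1 <= Cmod v) by (apply Rle_trans with (1 := Hy); apply Cmod_im_part_le).
  set (V := Cmod v) in *.
  assert (Hsh : forall t : R, (c + t - im y)%C <> 0%C /\ (v + t)%C <> 0%C /\ (v - t)%C <> 0%C).
  { intros t. assert (H : forall x : R, (x - im y)%C <> 0%C).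
    { intros x. apply Cmod_gt_0. generalize (Cmod_im_part_le x y). lra. }
    unfold v. split; [|split].
    - rewrite <- RtoC_plus. apply H.
    - replace (c - im y + t)%C with (RtoC (c + t) - im y)%C by (rewrite RtoC_plus; ring). apply H.
    - replace (c - im y - t)%C with (RtoC (c - t) - im y)%C by (rewrite RtoC_minus; ring). apply H. }
  assert (Hv0 : v <> 0%C) by (apply Cmod_gt_0; fold V; lra).
  assert (M := Cmvt (fun t => hlog y (c + t) - hlog y (c - t) - t * (2 / v))%C
    (fun t => / (v + t) + / (v - t) - 2 / v)%C (fun t => 8/9 * / V ^ 3 * t ^ 3) (fun t => INR 3 * (8/9 * / V ^ 3) * t ^ 2) 0 (/ 2) ltac:(lra)).
  cbv beta in M.
  assert (HV3 : 0 < / V ^ 3) by (apply Rinv_0_lt_compat, pow_lt; lra).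
  match type of M with _ -> _ -> _ -> Cmod ?X <= _ => assert (EX : X = (hlog y (c + / 2) - hlog y (c - / 2) - / v)%C) end.
  { rewrite Rplus_0_r, Rminus_0_r. rewrite RtoC_inv by lra. field. auto. }
  rewrite EX in M. eapply Rle_trans; [apply M|].
  4: { set (i := / V ^ 3) in *. simpl. lra. }
  - intros t Ht.
    assert (D1 : Cder (fun t => hlog y (c + t)) t (/ (v + t))%C).
    { destruct (hlog_der y (c + t) Hy0) as [A B].
      replace (/ (v + t))%C with (/ (RtoC (c + t) - im y))%C by (f_equal; unfold v; rewrite RtoC_plus; ring).
      assert (HD : is_derive (fun t => c + t) t 1) by (auto_derive; auto; ring).
      split; eapply is_derive_eqR.
      apply (is_derive_compR (fun x => fst (hlog y x)) (fun t => c + t) t _ _ A HD). bring.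
      apply (is_derive_compR (fun x => snd (hlog y x)) (fun t => c + t) t _ _ B HD). bring. }
    assert (D2 : Cder (fun t => hlog y (c - t)) t (- / (v - t))%C).
    { destruct (hlog_der y (c - t) Hy0) as [A B].
      replace (/ (v - t))%C with (/ (RtoC (c - t) - im y))%C by (f_equal; unfold v; rewrite RtoC_minus; ring).
      assert (HD : is_derive (fun t => c - t) t (-1)) by (auto_derive; auto; ring).
      split; eapply is_derive_eqR.
      apply (is_derive_compR (fun x => fst (hlog y x)) (fun t => c - t) t _ _ A HD). cbn [fst Copp]. bring.
      apply (is_derive_compR (fun x => snd (hlog y x)) (fun t => c - t) t _ _ B HD). cbn [snd Copp]. bring. }
    eapply Cder_eq. apply Cder_minus. apply Cder_minus. apply D1. apply D2. apply Cder_line. bring.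
  - intros t Ht. apply is_derive_pow_const.
  - intros t Ht. destruct (Hsh t) as [_ [S1 S2]].
    assert (Hden : 3/4 * V ^ 2 <= Cmod (v * v - t * t)).
    { generalize (Cmod_triangle_sub (v * v) (t * t)). rewrite !Cmod_mult, Cmod_R, (Rabs_pos_eq t) by lra. fold V. nra. }
    assert (Hd0 : (v * v - t * t)%C <> 0%C) by (apply Cmod_gt_0; nra).
    replace (/ (v + t) + / (v - t) - 2 / v)%C with (2 * t * t * / v * / (v * v - t * t))%C by (field; repeat split; auto).
    rewrite !Cmod_mult, !Cmod_inv by auto. fold V. rewrite !Cmod_R, (Rabs_pos_eq t), (Rabs_pos_eq 2) by lra.
    apply Rle_trans with (2 * t * t * / V * / (3/4 * V ^ 2)).
    + apply Rmult_le_compat_l. apply Rmult_le_pos. nra. left; apply Rinv_0_lt_compat; lra. apply Rinv_le_contravar; nra.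
    + right. simpl INR. field. lra.
Qed.

(* Here (v+a)/(v-a) and exp(-2a/v) have the same expansion up to second order in 1/v. *)
Lemma gamma_factor_bound (v a E1 : CC) (A : R) : 1 <= A -> Cmod a <= A -> 8 * A <= Cmod v -> Cmod E1 <= / Cmod v ^ 3 ->
  Cmod ((v + a) / (v - a) * cexp (- (2) * a * (/ v + E1)) - 1) <= 78 * A ^ 3 * / Cmod v ^ 3.
Proof.
  intros HA Ha Hv HE1. set (V := Cmod v) in *. assert (HV : 0 < V) by lra.
  assert (Hv0 : v <> 0%C) by (apply Cmod_gt_0; fold V; lra).
  set (w := (2 * a / v)%C). assert (Hiv : 0 < / V) by now apply Rinv_0_lt_compat.
  assert (Hw : Cmod w <= 2 * A * / V).
  { unfold w. rewrite Cmod_div, Cmod_mult, Cmod_R, Rabs_pos_eq by (auto; lra). fold V. apply Rmult_le_compat_r; lra. }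
  assert (HAV : A * / V <= / 8).
  { apply Rmult_le_reg_r with V; auto. rewrite Rmult_assoc, Rinv_l by lra. lra. }
  assert (Hw4 : Cmod w <= / 4) by lra. generalize (Cmod_ge_0 w); intros Hw0.
  assert (H1w : / 2 <= Cmod (1 - w / 2)).
  { generalize (Cmod_one_minus_ge (w / 2)). rewrite Cmod_div, (Cmod_R 2), (Rabs_pos_eq 2) by (try lra; apply RtoC_neq_0; lra). lra. }
  assert (H1w0 : (1 - w / 2)%C <> 0%C) by (apply Cmod_gt_0; lra).
  assert (Hva : (v - a)%C <> 0%C).
  { apply Cmod_gt_0. generalize (Cmod_triangle_sub v a). fold V. lra. }
  set (E2 := (cexp (- w) - 1 - - w - (- w) * (- w) / 2)%C).
  assert (HE2 : Cmod E2 <= / 2 * Cmod w ^ 3).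
  { unfold E2. generalize (cexp_sub2 (- w)). rewrite Cmod_opp. intros Q. eapply Rle_trans; [apply Q; lra|lra]. }
  set (E3 := (w * w * w / 4 * / (1 - w / 2))%C).
  assert (HE3 : Cmod E3 <= / 2 * Cmod w ^ 3).
  { unfold E3. rewrite Cmod_mult, Cmod_div, !Cmod_mult, Cmod_R, Rabs_pos_eq by (try lra; apply RtoC_neq_0; lra).
    assert (Q := Cmod_inv_le _ (/ 2) ltac:(lra) H1w). rewrite Rinv_inv in Q.
    replace (/ 2 * Cmod w ^ 3) with (Cmod w * Cmod w * Cmod w / 4 * 2) by field.
    apply Rmult_le_compat_l; auto. apply Rmult_le_pos; [|lra]. apply Rmult_le_pos; auto. nra. }
  set (P := ((1 + w + w * w / 2 + E3) * (1 - w + w * w / 2 + E2))%C).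
  assert (Hfac : ((v + a) / (v - a))%C = (1 + w + w * w / 2 + E3)%C).
  { unfold E3. 
    assert (Hq : (1 - w / 2)%C = ((v - a) / v)%C) by (unfold w; field; auto).
    rewrite Hq. unfold w. field. auto. }
  assert (Hexp : cexp (- w) = (1 - w + w * w / 2 + E2)%C) by (unfold E2; field).
  set (x := Cmod w) in *.
  assert (Hx3 : x ^ 3 <= / 4 * x ^ 2) by (simpl; nra). assert (Hx2 : x ^ 2 <= / 16) by (simpl; nra).
  assert (Hww : Cmod (w * w / 2) = x ^ 2 / 2).
  { rewrite Cmod_div, Cmod_mult, (Cmod_R 2), (Rabs_pos_eq 2) by (try lra; apply RtoC_neq_0; lra). fold x. simpl. field. }
  assert (B1 : Cmod (1 + w + w * w / 2 + E3) <= 2).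
  { eapply Rle_trans; [apply Cmod_triangle|]. eapply Rle_trans; [apply Rplus_le_compat_r, Cmod_triangle|].
    eapply Rle_trans; [apply Rplus_le_compat_r, Rplus_le_compat_r, Cmod_triangle|]. rewrite Hww, Cmod_1. fold x. lra. }
  assert (B2 : Cmod (1 - w + w * w / 2) <= 2).
  { eapply Rle_trans; [apply Cmod_triangle|]. eapply Rle_trans; [apply Rplus_le_compat_r, Cmod_triangle_minus|].
    rewrite Hww, Cmod_1. fold x. lra. }
  assert (HP : Cmod (P - 1) <= 3 * x ^ 3).
  { unfold P. replace (_ - 1)%C with (w * w / 2 * (w * w / 2) + E2 * (1 + w + w * w / 2 + E3) + E3 * (1 - w + w * w / 2))%C by field.
    eapply Rle_trans; [apply Cmod_triangle|]. eapply Rle_trans; [apply Rplus_le_compat_r, Cmod_triangle|].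
    rewrite (Cmod_mult (w * w / 2)), (Cmod_mult E2), (Cmod_mult E3), Hww.
    assert (T1 : Cmod E2 * Cmod (1 + w + w * w / 2 + E3) <= / 2 * x ^ 3 * 2) by (apply Rmult_le_compat; auto using Cmod_ge_0).
    assert (T2 : Cmod E3 * Cmod (1 - w + w * w / 2) <= / 2 * x ^ 3 * 2) by (apply Rmult_le_compat; auto using Cmod_ge_0).
    assert (T3 : x ^ 2 / 2 * (x ^ 2 / 2) <= x ^ 3) by (replace (x ^ 2 / 2 * (x ^ 2 / 2)) with (x ^ 3 * (x / 4)) by field; assert (0 <= x ^ 3) by (apply pow_le; auto); nra).
    lra. }
  set (h := (- (2) * a * E1)%C).
  assert (HV3 : 0 < / V ^ 3) by (apply Rinv_0_lt_compat, pow_lt; auto).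
  assert (Hh : Cmod h <= 2 * A * / V ^ 3).
  { unfold h. rewrite !Cmod_mult, Cmod_opp, Cmod_R, Rabs_pos_eq by lra. apply Rmult_le_compat; auto using Cmod_ge_0.
    generalize (Cmod_ge_0 a); lra. lra. }
  assert (Hh1 : Cmod h <= 1).
  { eapply Rle_trans; [exact Hh|]. rewrite <- pow_inv. replace (2 * A * (/ V) ^ 3) with (2 * (A * / V) * (/ V * / V)) by ring.
    assert (/ V <= / 8) by (apply Rinv_le_contravar; lra). assert (/ V * / V <= 1) by nra.
    assert (0 <= A * / V) by nra. nra. }
  rewrite Hfac. replace (- (2) * a * (/ v + E1))%C with (- w + h)%C by (unfold w, h; field; auto).
  rewrite cexp_plus, Hexp, Cmult_assoc. fold P.
  replace (P * cexp h - 1)%C with ((P - 1) * cexp h + (cexp h - 1))%C by ring.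
  eapply Rle_trans; [apply Cmod_triangle|]. rewrite Cmod_mult.
  assert (Q1 := cexp_sub1 h Hh1). assert (Q2 := cexp_bound h 1 Hh1 ltac:(lra)). rewrite Cmult_1_l in Q2.
  (* 78 = 72 + 6: the first part is 9 x^3 with x <= 2A/V, the second is 3 |h| with |h| <= 2A/V^3 and
     A <= A^3. *)
  assert (Hx3' : x ^ 3 <= 8 * A ^ 3 * / V ^ 3).
  { apply Rle_trans with ((2 * A * / V) ^ 3). apply pow_incr; auto. right. field. lra. }
  assert (T : Cmod (P - 1) * Cmod (cexp h) <= 3 * x ^ 3 * 3) by (apply Rmult_le_compat; auto using Cmod_ge_0).
  assert (A <= A ^ 3) by (simpl; nra). nra.
Qed.

(** Gamma(s/2 - iy) / Gamma(1 - s/2 - iy), written with the entire function [rgamma]: poles of the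
    lower Gamma are then mere zeros, and holomorphy fails only where the upper one has a pole. *)
Definition gamma_quot (s : CC) (y : R) : CC := (rgamma (1 - s / 2 - im y) / rgamma (s / 2 - im y))%C.

(* [exp ((1 - s) * hlog y 0)] is (-iy)^{1-s}, so [rho] compares the Gamma quotient with its leading term. *)
Definition rho (s : CC) (y : R) : CC := (gamma_quot s y * cexp ((1 - s) * hlog y 0))%C.

(** The constant in [hlog] is the one that makes the argument tend to 0 at +infinity for either sign
    of y. The reflection atan(1/x) = pi/2 - atan x turns the argument into -atan(y/n). *)
Lemma hlog_INR_lim y : y <> 0 -> Clim (fun n => hlog y (INR n) - ln (INR n))%C 0.
Proof.
  intros Hy. apply Clim_components. simpl. split.
  - apply is_lim_seq_ext_loc with (fun n => ln (1 + (y / INR n) ^ 2) / 2).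
    + exists 1%nat. intros n Hn. assert (H0 : 0 < INR n) by (apply (lt_INR 0); lia).
      replace (INR n * (INR n * 1) + y * (y * 1)) with (INR n * INR n * (1 + (y / INR n) ^ 2)) by (field; lra).
      assert (H1 : 0 < 1 + (y / INR n) ^ 2) by (generalize (pow2_ge_0 (y / INR n)); lra).
      rewrite (ln_mult (INR n * INR n)), (ln_mult (INR n) (INR n)) by (auto; now apply Rmult_lt_0_compat). field.
    + replace 0 with (ln (1 + 0 ^ 2) / 2). 2:{ replace (1 + 0 ^ 2) with 1 by ring. rewrite ln_1. field. }
      apply is_lim_seq_mult'; [|apply is_lim_seq_const].
      apply is_lim_seq_continuous. 
      * apply continuity_pt_filterlim. apply (ex_derive_continuous ln). exists (/ (1 + 0 ^ 2)). apply is_derive_Reals. apply derivable_pt_lim_ln; simpl; lra.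
      * apply is_lim_seq_plus'. apply is_lim_seq_const. simpl.
        apply is_lim_seq_mult'. apply is_lim_seq_inv_INR. apply is_lim_seq_mult'. apply is_lim_seq_inv_INR. apply is_lim_seq_const.
  - apply is_lim_seq_ext_loc with (fun n => - atan (y / INR n)).
    + exists 1%nat. intros n Hn. assert (H0 : 0 < INR n) by (apply (lt_INR 0); lia).
      unfold sgnR. destruct (Rlt_dec 0 y) as [Hp|Hp].
      * replace (y / INR n) with (/ (INR n / y)) by (field; lra).
        rewrite atan_inv by (apply Rdiv_lt_0_compat; lra). ring.
      * replace (y / INR n) with (- (/ (INR n / - y))) by (field; lra).
        rewrite atan_opp, atan_inv by (apply Rdiv_lt_0_compat; lra).
        replace (INR n / - y) with (- (INR n / y)) by (field; lra). rewrite atan_opp. ring.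
    + replace 0 with (- atan 0) by (rewrite atan_0; ring). apply (is_lim_seq_opp _ (atan 0)).
      apply is_lim_seq_continuous. apply derivable_continuous_pt, derivable_pt_atan. apply is_lim_seq_inv_INR.
Qed.

(** Comparison with a telescoping sum: (k + y)(k + 1 + y) is at most twice (k + 1/2)^2 + y^2. *)
Lemma half_shift_sum_bound y n : 0 < y -> rsum (fun k => / ((INR k + / 2) ^ 2 + y ^ 2)) n <= 2 / y.
Proof.
  intros Hy. apply Rle_trans with (rsum (fun k => 2 * (/ (INR k + y) - / (INR (S k) + y))) n).
  - apply rsum_le. intros k _. rewrite S_INR. generalize (pos_INR k); intros Hk. set (x := INR k) in *.
    replace (2 * (/ (x + y) - / (x + 1 + y))) with (/ ((x + y) * (x + 1 + y) / 2)) by (field; lra).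
    apply Rinv_le_contravar. apply Rdiv_lt_0_compat; [|lra]. apply Rmult_lt_0_compat; lra.
    generalize (pow2_ge_0 (x + / 2 - y)). nra.
  - rewrite rsum_scal.
    assert (E : rsum (fun k => / (INR k + y) - / (INR (S k) + y)) n = / y - / (INR n + y)).
    { induction n. simpl. rewrite Rplus_0_l. ring. cbn [rsum]. rewrite IHn. ring. }
    rewrite E. assert (0 < / (INR n + y)) by (apply Rinv_0_lt_compat; generalize (pos_INR n); lra). unfold Rdiv. lra.
Qed.

Lemma exp_sub1_le B : 0 <= B <= 1 -> exp B - 1 <= 3 * B.
Proof.
  intros HB. assert (E : exp B <= 3).
  { apply Rle_trans with (2 := exp_1_le_3). destruct (Req_dec B 1) as [->|H]; [lra|left; apply exp_increasing; lra]. }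
  generalize (exp_ineq1_le (- B)). rewrite exp_Ropp. intros Q.
  assert (P := exp_pos B). apply Rmult_le_compat_l with (r := exp B) in Q; [|lra]. rewrite Rinv_r in Q by lra. nra.
Qed.

(** [rho s y] is an infinite product starting from 1. Its k-th factor compares (v+a)/(v-a) with the
    increment of [hlog] over one unit, so it is 1 + O(|v_k|^{-3}) by [hlog_step] and
    [gamma_factor_bound]. Since |v_k|^{-3} <= |v_k|^{-2} / |y|, [half_shift_sum_bound] sums the
    errors to O(y^{-2}). *)
Lemma rho_bound (A : R) : 1 <= A -> exists Y0 K, 1 <= Y0 /\ 0 <= K /\
  forall (s : CC) (y : R), Cmod (1 - s) <= 2 * A -> Y0 <= Rabs y -> Cmod (rho s y - 1) <= K * / y ^ 2.
Proof.
  intros HA. set (K := 78 * A ^ 3). assert (HK : 78 <= K) by (unfold K; assert (1 <= A ^ 3) by (apply pow_R1_Rle; auto); lra).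
  (* The threshold gives 8A <= |v| for [gamma_factor_bound] and 2K / y^2 <= 1 for [exp_sub1_le]; 6K
     is 3 times the bound 2K on the sum. *)
  exists (8 * A + 2 * K), (6 * K). split; [lra|split; [lra|]]. intros s y Hs Hy.
  assert (Hy0 : y <> 0) by (intros E; rewrite E, Rabs_R0 in Hy; lra).
  set (a := ((1 - s) / 2)%C). assert (Ha : Cmod a <= A).
  { unfold a. rewrite Cmod_div, (Cmod_R 2), Rabs_pos_eq by (try lra; apply RtoC_neq_0; lra). lra. }
  set (v := fun k => (RtoC (INR k + / 2) - im y)%C).
  assert (Hv : forall k, Rabs y <= Cmod (v k)) by (intros; apply Cmod_im_part_le).
  set (D := fun k => (hlog y (INR (S k)) - hlog y (INR k))%C).
  set (x := fun n => (poch (1 - s / 2 - im y) n / poch (s / 2 - im y) n * cexp (- (2) * a * (hlog y (INR n) - hlog y 0)))%C).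
  set (e := fun k => ((v k + a) / (v k - a) * cexp (- (2) * a * (/ v k + (D k - / v k))) - 1)%C).
  assert (Hva : forall k, (v k - a)%C <> 0%C).
  { intros k. apply Cmod_gt_0. generalize (Cmod_triangle_sub (v k) a) (Hv k). lra. }
  assert (Evp : forall k, (v k + a)%C = (1 - s / 2 - im y + INR k)%C).
  { intros k. unfold v, a. rewrite RtoC_plus, RtoC_inv by lra. field. }
  assert (Evm : forall k, (v k - a)%C = (s / 2 - im y + INR k)%C).
  { intros k. unfold v, a. rewrite RtoC_plus, RtoC_inv by lra. field. }
  assert (Hz : forall k : nat, (s / 2 - im y + INR k)%C <> 0%C) by (intros k; rewrite <- Evm; auto).
  assert (Hx : forall n, x (S n) = (x n * (1 + e n))%C).
  { intros n. unfold x, e. simpl poch. rewrite Evp, Evm. set (X1 := poch _ n). set (X2 := poch _ n).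
    assert (HX2 : X2 <> 0%C) by (apply poch_neq_0; auto).
    replace (- (2) * a * (hlog y (INR (S n)) - hlog y 0))%C with (- (2) * a * (hlog y (INR n) - hlog y 0) + - (2) * a * (/ v n + (D n - / v n)))%C by (unfold D; ring).
    rewrite cexp_plus. assert (Hd := Hz n). set (d := (s / 2 - im y + INR n)%C) in *. set (d1 := (1 - s / 2 - im y + INR n)%C). field. auto. }
  set (b := fun k => K * / Rabs y * / ((INR k + / 2) ^ 2 + y ^ 2)).
  assert (Hyp : 0 < Rabs y) by lra.
  assert (Hb : forall n, Cmod (e n) <= b n).
  { intros n. unfold e. eapply Rle_trans; [apply (gamma_factor_bound (v n) a (D n - / v n) A); auto|].
    - specialize (Hv n). lra.
    - assert (Q := hlog_step y (INR n + / 2) ltac:(lra)). cbv zeta in Q. unfold D.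
      replace (INR n + / 2 + / 2) with (INR (S n)) in Q by (rewrite S_INR; field). replace (INR n + / 2 - / 2) with (INR n) in Q by ring.
      exact Q.
    - fold K. unfold b. rewrite Rmult_assoc. apply Rmult_le_compat_l; [lra|].
      assert (Ev : (INR n + / 2) ^ 2 + y ^ 2 = Cmod (v n) ^ 2).
      { rewrite Cmod2_alt. unfold v, Re, Im. simpl. ring. }
      rewrite Ev. rewrite <- Rinv_mult. apply Rinv_le_contravar.
      + specialize (Hv n). apply Rmult_lt_0_compat; auto. apply pow_lt; lra.
      + specialize (Hv n). simpl. apply Rmult_le_compat_r; auto. nra. }
  assert (Hb0 : forall k, 0 <= b k) by (intros k; eapply Rle_trans; [apply Cmod_ge_0|apply Hb]).
  assert (Hy2 : Rabs y * Rabs y = y ^ 2) by (rewrite <- (pow2_abs y); ring).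
  assert (Hsum : forall n, rsum b n <= 2 * K * / y ^ 2).
  { intros n. unfold b. rewrite rsum_scal. rewrite <- Hy2.
    replace (2 * K * / (Rabs y * Rabs y)) with (K * / Rabs y * (2 / Rabs y)) by (field; lra).
    apply Rmult_le_compat_l. apply Rmult_le_pos; [lra|left; now apply Rinv_0_lt_compat].
    assert (Q := half_shift_sum_bound (Rabs y) n Hyp). rewrite pow2_abs in Q. rewrite Hy2; exact Q. }
  assert (Eb : ex_series b) by (apply ex_series_of_bounded with (2 * K * / y ^ 2); auto).
  destruct (inf_prod x e b Hx Hb Eb) as [l [L1 [L2 _]]].
  assert (Ex0 : x O = 1%C).
  { unfold x. simpl poch. simpl INR. replace (- (2) * a * (hlog y 0 - hlog y 0))%C with (RtoC 0) by ring. rewrite cexp_0. field. }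
  rewrite Ex0, Cmod_1, Rmult_1_l in L2.
  assert (El : l = rho s y).
  { apply Clim_unique with (1 := Clim_incr _ _ 1 L1).
    apply Clim_ext_loc with (fun n => gauss_seq (1 - s / 2 - im y) n * / gauss_seq (s / 2 - im y) n
      * cexp ((s - 1) * (hlog y (INR (n + 1)) - ln (INR (n + 1)))) * (cpow (INR (n + 1)) (s - 1) * / cpow (INR (n + 1 - 1)) (s - 1))
      * cexp ((1 - s) * hlog y 0))%C.
    - exists 1%nat. intros n Hn. rewrite Nat.add_sub, Nat.add_1_r.
      assert (HP : poch (s / 2 - im y) (S n) <> 0%C) by (apply poch_neq_0; auto).
      unfold x, gauss_seq. set (P1 := poch _ (S n)). set (P2 := poch _ (S n)) in *.
      assert (C1 : cpow (INR n) (1 - s / 2 - im y) = (cpow (INR n) (s / 2 - im y) / cpow (INR n) (s - 1))%C).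
      { rewrite <- cpow_minus. f_equal. field. }
      rewrite C1.
      assert (C2 : cexp (- (2) * a * (hlog y (INR (S n)) - hlog y 0)) = (cexp ((s - 1) * (hlog y (INR (S n)) - ln (INR (S n)))) * cpow (INR (S n)) (s - 1) * cexp ((1 - s) * hlog y 0))%C).
      { unfold cpow. rewrite <- !cexp_plus. f_equal. unfold a. field. }
      rewrite C2.
      assert (N1 := cpow_neq_0 (INR n) (s / 2 - im y)). assert (N2 := cpow_neq_0 (INR n) (s - 1)).
      field. repeat split; auto using RfactC.
    - unfold rho, gamma_quot. apply Clim_eq with (rgamma (1 - s / 2 - im y) * / rgamma (s / 2 - im y) * 1 * 1 * cexp ((1 - s) * hlog y 0))%C; [|unfold Cdiv; ring].
      apply Clim_mult; [|apply Clim_const]. apply Clim_mult. apply Clim_mult. apply Clim_mult.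
      + apply gauss_lim.
      + apply Clim_inv. now apply rgamma_neq_0. apply gauss_lim.
      + apply Clim_eq with (cexp 0); [|apply cexp_0]. apply (hol_continuous cexp). apply hol_cexp_id. apply Clim_eq with ((s - 1) * 0)%C; [|ring].
        apply Clim_scal. apply (Clim_incr (fun n => hlog y (INR n) - ln (INR n))%C _ 1). now apply hlog_INR_lim.
      + apply (Clim_incr (fun n => cpow (INR n) (s - 1) * / cpow (INR (n - 1)) (s - 1))%C _ 1), cpow_ratio_lim. }
  rewrite <- El. eapply Rle_trans; [exact L2|].
  assert (HS : Series b <= 2 * K * / y ^ 2).
  { assert (Q := ex_series_Series_lim b Eb).
    apply (is_lim_seq_le (rsum b) (fun _ => 2 * K * / y ^ 2) (Series b) (2 * K * / y ^ 2)); auto using is_lim_seq_const. }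
  assert (HS0 : 0 <= Series b) by (apply (rsum_le_Series b 0 Hb0 Eb)).
  assert (Hsmall : 2 * K * / y ^ 2 <= 1).
  { apply Rmult_le_reg_r with (y ^ 2). rewrite <- Hy2; nra. rewrite Rmult_assoc, Rinv_l by (rewrite <- Hy2; nra). rewrite <- Hy2. nra. }
  eapply Rle_trans; [apply exp_sub1_le; lra|]. lra.
Qed.

(** * The regularized series *)

Lemma Cinv_0 : (/ 0)%C = RtoC 0.
Proof. apply C_eq; unfold Cinv; simpl; unfold Rdiv; rewrite ?Ropp_0, Rmult_0_l; ring. Qed.

Lemma Cinv_involutive (z : CC) : (/ / z)%C = z.
Proof.
  destruct (Ceq_dec z 0) as [->|H]; [now rewrite !Cinv_0|field; auto].
Qed.

(** Unconditional, because the inverse of 0 is 0; at a pole of Gamma(b) both sides are 0, as they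
    should be. *)
Lemma Gamma_quotient (a b : CC) : (Gamma a / Gamma b)%C = (rgamma b / rgamma a)%C.
Proof. unfold Gamma, Cdiv. rewrite Cinv_involutive. ring. Qed.

(* Up to the factor Gamma(1-s), the m-th term of the functional equation of zeta. *)
Definition zeta_dual (s : CC) (m : Z) : CC :=
  (cexp (Ci * (PI / 2)%R * (1 - s) * sgnZ m) / cpow (2 * PI * IZR (Z.abs m)) (1 - s))%C.

Lemma abs_IZR_pos m : m <> 0%Z -> 1 <= IZR (Z.abs m).
Proof. intros Hm. apply IZR_le. lia. Qed.

Lemma ym_abs L m : 0 < L -> Rabs (ym L m) = 2 * PI * IZR (Z.abs m) * / (4 * L).
Proof.
  intros HL. unfold ym, Rdiv. rewrite !Rabs_mult, Rabs_inv, Rabs_Zabs. generalize PI_RGT_0; intros.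
  rewrite (Rabs_pos_eq PI), (Rabs_pos_eq (2 * L)) by lra. field. lra.
Qed.

Lemma sgnR_ym L m : 0 < L -> m <> 0%Z -> sgnR (ym L m) = sgnZ m.
Proof.
  intros HL Hm. unfold sgnR, sgnZ. generalize PI_RGT_0; intros HP.
  destruct (Z.ltb_spec 0 m) as [Hz|Hz]; destruct (Rlt_dec 0 (ym L m)) as [Hy|Hy]; auto; exfalso.
  - apply Hy. unfold ym. apply Rdiv_lt_0_compat; [|lra]. apply Rmult_lt_0_compat; auto. now apply IZR_lt.
  - assert (H1 : IZR m <= -1) by (apply IZR_le; lia). apply (Rlt_not_le _ _ Hy). unfold ym.
    apply Rmult_le_reg_r with (2 * L); [lra|]. unfold Rdiv. rewrite Rmult_assoc, Rinv_l by lra. nra.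
Qed.

(** Since |y_m| = 2 pi |m| / (4L), the leading term (-i y_m)^{s-1} splits into (4L)^{1-s} and a
    factor free of L. This splitting is the source of the independence of L. *)
Lemma gamma_quot_zeta_dual_rho L s m : 0 < L -> m <> 0%Z ->
  gamma_quot s (ym L m) = ((4 * L)%R * / cpow (4 * L) s * zeta_dual s m * rho s (ym L m))%C.
Proof.
  intros HL Hm. set (y := ym L m). assert (H1 := abs_IZR_pos m Hm). generalize PI_RGT_0; intros HP.
  assert (Hb : 0 < 2 * PI * IZR (Z.abs m)) by nra.
  assert (Hi : 0 < / (4 * L)) by (apply Rinv_0_lt_compat; lra).
  assert (Hya : Rabs y = 2 * PI * IZR (Z.abs m) * / (4 * L)) by now apply ym_abs.
  assert (Hy : y <> 0).
  { intros E. rewrite E, Rabs_R0 in Hya. nra. }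
  assert (Hh : hlog y 0 = (ln (Rabs y) - Ci * (PI / 2)%R * sgnZ m)%C).
  { assert (Es : sgnR y = sgnZ m) by now apply sgnR_ym. unfold hlog. rewrite Es. apply C_eq; simpl.
    - replace (0 * (0 * 1) + y * (y * 1)) with (Rabs y * Rabs y) by (rewrite <- Rabs_mult, Rabs_pos_eq by nra; ring).
      rewrite ln_mult by (apply Rabs_pos_lt; auto). field.
    - unfold Rdiv. rewrite Rmult_0_l, atan_0. field. }
  unfold rho. rewrite Hh.
  replace ((1 - s) * (ln (Rabs y) - Ci * (PI / 2)%R * sgnZ m))%C with (ln (Rabs y) * (1 - s) - Ci * (PI / 2)%R * (1 - s) * sgnZ m)%C by ring.
  rewrite cexp_minus. change (cexp (ln (Rabs y) * (1 - s))) with (cpow (Rabs y) (1 - s)).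
  rewrite Hya, (cpow_mult_base (2 * PI * IZR (Z.abs m)) (/ (4 * L))), cpow_inv_base by (auto; lra). unfold zeta_dual.
  rewrite (cpow_minus (4 * L)), cpow_1 by lra.
  assert (N1 := cpow_neq_0 (4 * L) s). assert (N2 := cpow_neq_0 (2 * PI * IZR (Z.abs m)) (1 - s)).
  set (e := cexp _). assert (He : e <> 0%C) by apply cexp_neq_0.
  assert (H4 : RtoC (4 * L) <> 0%C) by (apply RtoC_neq_0; lra).
  unfold y. fold y. field. auto.
Qed.

Lemma T2_gamma_quot L s m : T2 L s m = gamma_quot s (ym L m).
Proof. unfold T2. rewrite Gamma_quotient, !Ci_im. reflexivity. Qed.

Lemma Gamma_neq_0 (z : CC) : (forall k : nat, (z + INR k)%C <> 0%C) -> Gamma z <> 0%C.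
Proof.
  intros H. unfold Gamma. intros E. apply (rgamma_neq_0 z H). rewrite <- (Cinv_involutive (rgamma z)), E. apply Cinv_0.
Qed.

Lemma re_pos_shift_neq_0 (z : CC) : 0 < fst z -> forall k : nat, (z + INR k)%C <> 0%C.
Proof. intros H k E. assert (E1 := f_equal fst E). simpl in E1. generalize (pos_INR k). lra. Qed.

Lemma gterm_gamma_quot L s m : 0 < L -> fst s < 2 -> gterm L s m = (Gamma (1 - s) * gamma_quot s (ym L m) * / (4 * L)%R)%C.
Proof.
  intros HL Hs. unfold gterm. rewrite !Ci_im. fold (ym L m). set (y := ym L m).
  assert (HG : Gamma (1 - s / 2 - im y) <> 0%C).
  { apply Gamma_neq_0, re_pos_shift_neq_0. simpl. lra. }
  assert (HL0 : RtoC L <> 0%C) by (apply RtoC_neq_0; lra).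
  unfold gamma_quot. rewrite <- Gamma_quotient. rewrite RtoC_mult. field. auto.
Qed.

Definition gamma_error (L : R) (s : CC) (m : Z) : CC := (zeta_dual s m * (rho s (ym L m) - 1))%C.

Lemma T1_gamma_error L s m : 0 < L -> fst s < 2 -> m <> 0%Z ->
  T1 L s m = (Gamma (1 - s) * / cpow (4 * L) s * gamma_error L s m)%C.
Proof.
  intros HL Hs Hm. unfold T1. rewrite gterm_gamma_quot, gamma_quot_zeta_dual_rho by auto. unfold gamma_error, zeta_dual.
  assert (H4 : RtoC (4 * L) <> 0%C) by (apply RtoC_neq_0; lra).
  assert (N1 := cpow_neq_0 (4 * L) s). assert (N2 := cpow_neq_0 (2 * PI * IZR (Z.abs m)) (1 - s)).
  field. auto.
Qed.

Lemma Cmod_zeta_dual (s : CC) m A : Cmod (1 - s) <= A ->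
  Cmod (zeta_dual s m) <= exp (PI / 2 * A) * Rpower (2 * PI * IZR (Z.abs m)) (fst s - 1).
Proof.
  intros HA. generalize PI_RGT_0; intros HP. unfold zeta_dual. rewrite Cmod_div by apply cpow_neq_0.
  rewrite Cmod_cpow, Cmod_cexp. unfold Rdiv at 1.
  replace (fst s - 1) with (- fst (1 - s)%C) by (simpl; ring). rewrite Rpower_Ropp.
  apply Rmult_le_compat_r. left; apply Rinv_0_lt_compat, Rpower_pos.
  assert (HH : fst (Ci * (PI / 2)%R * (1 - s) * sgnZ m)%C <= PI / 2 * A).
  { replace (fst (Ci * (PI / 2)%R * (1 - s) * sgnZ m)%C) with (PI / 2 * (- snd (1 - s)%C * sgnZ m)) by (simpl; ring).
    apply Rmult_le_compat_l; [lra|]. generalize (Cmod_snd_le (1 - s)). intros Q.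
    assert (Q2 : Rabs (snd (1 - s)%C) <= A) by lra. apply Rabs_le_between in Q2.
    unfold sgnZ. destruct (0 <? m)%Z; lra. }
  destruct HH as [HH|HH]. left; now apply exp_increasing. rewrite HH; lra.
Qed.

Definition gamma_error_pair (L : R) (s : CC) (k : nat) : CC := (gamma_error L s (Z.of_nat (S k)) + gamma_error L s (- Z.of_nat (S k)))%C.

Definition gamma_error_sum (L : R) (s : CC) : CC := CSer (gamma_error_pair L s).

Lemma Zabs_S_bounds k : IZR (Z.abs (Z.of_nat (S k))) = INR (S k) /\ IZR (Z.abs (- Z.of_nat (S k))) = INR (S k).
Proof. rewrite Z.abs_opp, Z.abs_eq, <- INR_IZR_INZ by lia. auto. Qed.

(** The leading term is O(|m|^{sig-1}) and [rho] - 1 is O(y^{-2}) with y = pi m / (2L), hence the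
    exponent 3 - sig and the factor L^2. The exponent gives summability for Re s < 2; the factor
    makes the error vanish as L tends to 0, for which [Y0] and [C0] have to be chosen before [L]. *)
Lemma gamma_error_bound (A sig : R) : 1 <= A -> exists Y0 C0, 1 <= Y0 /\ 0 <= C0 /\
  forall (s : CC) (L : R) (k : nat) (m : Z), 0 < L -> Cmod (1 - s) <= 2 * A -> fst s <= sig -> IZR (Z.abs m) = INR (S k) ->
   Y0 <= PI * INR (S k) / (2 * L) ->
   Cmod (gamma_error L s m) <= C0 * L ^ 2 * Rpower (INR (S k)) (- (3 - sig)).
Proof.
  intros HA. destruct (rho_bound A HA) as [Y0 [K [HY0 [HK HR]]]]. generalize PI_RGT_0; intros HP. destruct PI_bounds as [P1 P2].
  exists Y0, (exp (PI / 2 * (2 * A)) * Rpower (2 * PI) (sig - 1) * (K * 4 / PI ^ 2)).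
  assert (HE := exp_pos (PI / 2 * (2 * A))). assert (HPp := Rpower_pos (2 * PI) (sig - 1)).
  assert (HPI2 : 0 < PI ^ 2) by (apply pow_lt; auto).
  split; [auto|split].
  { apply Rmult_le_pos; [nra|]. apply Rmult_le_pos; [lra|left; now apply Rinv_0_lt_compat]. }
  intros s L k m HL Hs Hsig Hm HY. unfold gamma_error. rewrite Cmod_mult.
  assert (HSk := INR_S_pos k). assert (HSk1 : 1 <= INR (S k)) by (apply (le_INR 1); lia).
  assert (Hya : Rabs (ym L m) = PI * INR (S k) / (2 * L)) by (rewrite ym_abs, Hm by auto; field; lra).
  assert (Q1 := Cmod_zeta_dual s m (2 * A) Hs). rewrite Hm in Q1.
  assert (Q2 := HR s (ym L m) Hs ltac:(lra)).
  assert (Hy2 : ym L m ^ 2 = (PI * INR (S k) / (2 * L)) ^ 2) by (rewrite <- Hya; symmetry; apply pow2_abs).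
  rewrite Hy2 in Q2.
  assert (Q3 : Rpower (2 * PI * INR (S k)) (fst s - 1) <= Rpower (2 * PI) (sig - 1) * Rpower (INR (S k)) (sig - 1)).
  { rewrite Rpower_mult_distr by lra. apply Rle_Rpower; [nra|lra]. }
  assert (Q4 : Rpower (INR (S k)) (- (3 - sig)) = Rpower (INR (S k)) (sig - 1) * / INR (S k) ^ 2).
  { replace (- (3 - sig)) with ((sig - 1) + - (2)) by ring. rewrite Rpower_plus, Rpower_Ropp. f_equal. f_equal.
    replace 2 with (INR 2) by (simpl; lra). now apply Rpower_pow. }
  rewrite Q4.
  replace (exp (PI / 2 * (2 * A)) * Rpower (2 * PI) (sig - 1) * (K * 4 / PI ^ 2) * L ^ 2 * (Rpower (INR (S k)) (sig - 1) * / INR (S k) ^ 2))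
    with (exp (PI / 2 * (2 * A)) * (Rpower (2 * PI) (sig - 1) * Rpower (INR (S k)) (sig - 1)) * (K * / (PI * INR (S k) / (2 * L)) ^ 2)) by (field; lra).
  apply Rmult_le_compat; auto using Cmod_ge_0. eapply Rle_trans; [exact Q1|]. apply Rmult_le_compat_l; lra.
Qed.

Lemma gamma_error_pair_bound (A sig : R) : 1 <= A -> exists Y0 C0, 1 <= Y0 /\ 0 <= C0 /\
  forall (s : CC) (L : R) (k : nat), 0 < L -> Cmod (1 - s) <= 2 * A -> fst s <= sig ->
   Y0 <= PI * INR (S k) / (2 * L) ->
   Cmod (gamma_error L s (Z.of_nat (S k))) + Cmod (gamma_error L s (- Z.of_nat (S k))) <= C0 * L ^ 2 * Rpower (INR (S k)) (- (3 - sig)).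
Proof.
  intros HA. destruct (gamma_error_bound A sig HA) as [Y0 [C0 [H1 [H2 H3]]]]. exists Y0, (2 * C0).
  split; [auto|split; [lra|]]. intros s L k HL Hs Hsig HY. destruct (Zabs_S_bounds k) as [Z1 Z2].
  generalize (H3 s L k _ HL Hs Hsig Z1 HY) (H3 s L k _ HL Hs Hsig Z2 HY). lra.
Qed.

Lemma large_index Y0 L : 0 < L -> exists J, forall k, (J <= k)%nat -> Y0 <= PI * INR (S k) / (2 * L).
Proof.
  intros HL. destruct (exists_INR_ge (Y0 * (2 * L))) as [J HJ]. exists J. intros k Hk.
  apply Rmult_le_reg_r with (2 * L); [lra|]. unfold Rdiv. rewrite (Rmult_assoc (PI * _)), Rinv_l by lra.
  apply le_INR in Hk. rewrite S_INR. generalize PI_bounds (pos_INR k); intros [P1 _] Q. nra.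
Qed.

Lemma gamma_error_summable L s : 0 < L -> fst s < 2 ->
  ex_series (fun k => Cmod (gamma_error L s (Z.of_nat (S k))) + Cmod (gamma_error L s (- Z.of_nat (S k)))).
Proof.
  intros HL Hs. destruct (gamma_error_pair_bound (Cmod (1 - s) + 1) (fst s)) as [Y0 [C0 [H1 [H2 H3]]]].
  { generalize (Cmod_ge_0 (1 - s)); lra. }
  destruct (large_index Y0 L HL) as [J HJ]. apply ex_series_shift with J.
  apply ex_series_le_nonneg with (fun k => C0 * L ^ 2 * Rpower (INR (S (J + k))) (- (3 - fst s))).
  - intros k. split. apply Rplus_le_le_0_compat; apply Cmod_ge_0. apply H3; auto. generalize (Cmod_ge_0 (1 - s)); lra. lra. apply HJ; lia.
  - apply (ex_series_incr_n (fun k => C0 * L ^ 2 * Rpower (INR (S k)) (- (3 - fst s))) J).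
    apply ex_series_scalR, ex_series_Rpower. lra.
Qed.

Lemma gamma_error_pair_summable L s : 0 < L -> fst s < 2 -> ex_series (fun k => Cmod (gamma_error_pair L s k)).
Proof.
  intros HL Hs. apply ex_series_Cmod_le with (2 := gamma_error_summable L s HL Hs). intros k. apply Cmod_triangle.
Qed.

Lemma hol_zeta_dual m a : hol (fun s => zeta_dual s m) a.
Proof.
  unfold zeta_dual. apply hol_div. 
  - apply hol_cexp. apply hol_mult; [|apply hol_const]. apply hol_mult. apply hol_const. apply hol_minus. apply hol_const. apply hol_id.
  - apply hol_cpow. apply hol_minus. apply hol_const. apply hol_id.
  - apply cpow_neq_0.
Qed.

Lemma hol_half_id a : hol (fun s => s / 2)%C a.
Proof. apply hol_mult. apply hol_id. apply hol_const. Qed.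

Lemma hol_gamma_quot y a : (forall k : nat, (a / 2 - im y + INR k)%C <> 0%C) -> hol (fun s => gamma_quot s y) a.
Proof.
  intros H. unfold gamma_quot. apply hol_div.
  - apply hol_rgamma. apply hol_minus. apply hol_minus. apply hol_const. apply hol_half_id. apply hol_const.
  - apply hol_rgamma. apply hol_minus. apply hol_half_id. apply hol_const.
  - now apply rgamma_neq_0.
Qed.

Lemma hol_gamma_error L m a : 0 < L -> ~ pole_set L a -> hol (fun s => gamma_error L s m) a.
Proof.
  intros HL Ha. unfold gamma_error. apply hol_mult. apply hol_zeta_dual. apply hol_minus; [|apply hol_const].
  unfold rho. apply hol_mult. apply hol_gamma_quot. now apply zm_not_pole.
  apply hol_cexp. apply hol_mult; [|apply hol_const]. apply hol_minus. apply hol_const. apply hol_id.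
Qed.

Lemma pole_bexp L s : 0 < L -> pole_set L s -> exists j, cexp (bexp L s j) = 1%C.
Proof.
  intros HL [m [k ->]]. exists k. rewrite <- (cexp_2PI_Z m). f_equal. apply C_eq.
  rewrite fst_bexp. simpl. ring. rewrite snd_bexp. simpl. field. lra.
Qed.

Lemma pole_set_open L a : 0 < L -> ~ pole_set L a -> exists r, 0 < r /\ r <= 1 /\ forall w, Cmod (w - a) < r -> ~ pole_set L w.
Proof.
  intros HL Ha. destruct (Spart_near (fun _ => true) L a HL) as [r [J [Hr [Hr1 [HN _]]]]].
  { intros j _ E. apply Ha. now apply bexp_pole with j. }
  exists r. split; [auto|split; [auto|]]. intros w Hw Hp. destruct (pole_bexp L w HL Hp) as [j Hj]. exact (HN j w Hw eq_refl Hj).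
Qed.

Lemma hol_gamma_error_sum L a : 0 < L -> fst a < 2 -> ~ pole_set L a -> hol (gamma_error_sum L) a.
Proof.
  intros HL Ha Hp. destruct (pole_set_open L a HL Hp) as [r [Hr [Hr1 Hpr]]].
  (* [sig] is halfway between Re a and 2: it bounds Re w on the smaller disc and keeps the exponent
     3 - sig above 1. *)
  set (sig := (fst a + 2) / 2). set (r2 := Rmin r ((2 - fst a) / 2)).
  assert (Hr2 : 0 < r2) by (apply Rmin_glb_lt; lra).
  destruct (gamma_error_pair_bound (Cmod (1 - a) + 1) sig) as [Y0 [C0 [H1 [H2 H3]]]].
  { generalize (Cmod_ge_0 (1 - a)); lra. }
  destruct (large_index Y0 L HL) as [J HJ].
  apply (hol_series_ev (fun k s => gamma_error_pair L s k)) with (b := fun k => C0 * L ^ 2 * Rpower (INR (S k)) (- (3 - sig))) (R0 := r2) (J := J); auto.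
  - intros k w Hw. assert (A1 := Rlt_le_trans _ _ _ Hw (Rmin_l _ _)). unfold gamma_error_pair. apply hol_plus; apply hol_gamma_error; auto.
  - intros k w Hk Hw. assert (A1 := Rlt_le_trans _ _ _ Hw (Rmin_l _ _)). assert (A2 := Rlt_le_trans _ _ _ Hw (Rmin_r _ _)).
    eapply Rle_trans; [apply Cmod_triangle|]. apply H3; auto.
    + replace (1 - w)%C with ((1 - a) - (w - a))%C by ring. generalize (Cmod_triangle_minus (1 - a) (w - a)) (Cmod_ge_0 (1 - a)). lra.
    + generalize (Cmod_fst_le (w - a)) (Rle_abs (fst (w - a)%C)). simpl. unfold sig. lra.
  - apply ex_series_scalR, ex_series_Rpower. unfold sig; lra.
Qed.

(* The formula for Re s < 2 solved for zeta(s); the point is that the result does not depend on [L]. *)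
Definition zeta_via_SL (L : R) (s : CC) : CC :=
  (cpow (4 * L) s * SL L s - cpow (4 * L) s * Gamma (1 - s) * gamma_quot s 0 * / (4 * L)%R - Gamma (1 - s) * gamma_error_sum L s)%C.

Lemma one_minus_shift_neq_0 (s : CC) : fst s < 2 -> s <> 1%C -> forall k : nat, (1 - s + INR k)%C <> 0%C.
Proof.
  intros Hs H1 k E. assert (E1 : s = (1 + INR k)%C) by (replace s with (1 - (1 - s + INR k) + INR k)%C by ring; rewrite E; ring).
  assert (E2 := f_equal fst E1). simpl in E2. destruct k as [|k].
  - apply H1. rewrite E1. simpl. ring.
  - assert (1 <= INR (S k)) by (apply (le_INR 1); lia). lra.
Qed.

Lemma hol_Gamma_1m (a : CC) : fst a < 2 -> a <> 1%C -> hol (fun s => Gamma (1 - s)) a.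
Proof.
  intros Ha H1. apply hol_Gamma. apply hol_minus. apply hol_const. apply hol_id. now apply one_minus_shift_neq_0.
Qed.

Lemma im_0 : im 0 = RtoC 0.
Proof. reflexivity. Qed.

Lemma ym_0 L : ym L 0 = 0.
Proof. unfold ym, Rdiv. ring. Qed.

Lemma hol_zeta_via_SL L (a : CC) : 0 < L -> fst a < 2 -> a <> 1%C -> ~ pole_set L a -> hol (zeta_via_SL L) a.
Proof.
  intros HL Ha H1 Hp. unfold zeta_via_SL. apply hol_minus. apply hol_minus.
  - apply hol_mult. apply hol_cpow, hol_id. now apply hol_SL.
  - apply hol_mult; [|apply hol_const]. apply hol_mult. apply hol_mult. apply hol_cpow, hol_id. now apply hol_Gamma_1m.
    apply hol_gamma_quot. intros k. generalize (zm_not_pole L a 0 HL Hp k). unfold zm. now rewrite ym_0.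
  - apply hol_mult. now apply hol_Gamma_1m. now apply hol_gamma_error_sum.
Qed.

Definition zeta_dual_pair (s : CC) (k : nat) : CC := (zeta_dual s (Z.of_nat (S k)) + zeta_dual s (- Z.of_nat (S k)))%C.

(** For Re s < 0 this is the right side of the functional equation, 2^s pi^{s-1} sin(pi s/2)
    Gamma(1-s) zeta(1-s): the two exponentials of a pair add up to 2 sin(pi s/2). *)
Definition zeta_minus (s : CC) : CC := (Gamma (1 - s) * CSer (zeta_dual_pair s))%C.

Lemma zeta_dual_pair_bound (s : CC) k A sig : Cmod (1 - s) <= A -> fst s <= sig ->
  Cmod (zeta_dual_pair s k) <= 2 * (exp (PI / 2 * A) * Rpower (2 * PI) (sig - 1)) * Rpower (INR (S k)) (- (1 - sig)).
Proof.
  intros HA Hs. destruct (Zabs_S_bounds k) as [Z1 Z2]. assert (HSk1 : 1 <= INR (S k)) by (apply (le_INR 1); lia).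
  destruct PI_bounds as [P1 P2].
  assert (Q1 := Cmod_zeta_dual s (Z.of_nat (S k)) A HA). assert (Q2 := Cmod_zeta_dual s (- Z.of_nat (S k)) A HA). rewrite Z1 in Q1. rewrite Z2 in Q2.
  assert (Q3 : Rpower (2 * PI * INR (S k)) (fst s - 1) <= Rpower (2 * PI) (sig - 1) * Rpower (INR (S k)) (sig - 1)).
  { rewrite Rpower_mult_distr by lra. apply Rle_Rpower; [nra|lra]. }
  replace (- (1 - sig)) with (sig - 1) by ring. eapply Rle_trans; [apply Cmod_triangle|].
  assert (HE := exp_pos (PI / 2 * A)). nra.
Qed.

Lemma zeta_dual_pair_summable s : fst s < 0 -> ex_series (fun k => Cmod (zeta_dual_pair s k)).
Proof.
  intros Hs. eapply ex_series_Cmod_le. intros k. apply (zeta_dual_pair_bound s k (Cmod (1 - s)) (fst s)); lra.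
  apply ex_series_scalR, ex_series_Rpower. lra.
Qed.

Lemma hol_zeta_minus a : fst a < 0 -> hol zeta_minus a.
Proof.
  intros Ha. unfold zeta_minus. apply hol_mult.
  - apply hol_Gamma_1m. lra. intros E. rewrite E in Ha. simpl in Ha. lra.
  - apply (hol_series (fun k s => zeta_dual_pair s k)) with (R0 := - fst a / 2)
     (b := fun k => 2 * (exp (PI / 2 * (Cmod (1 - a) + - fst a / 2)) * Rpower (2 * PI) (fst a / 2 - 1)) * Rpower (INR (S k)) (- (1 - fst a / 2))).
    + lra.
    + intros k w _. unfold zeta_dual_pair. apply hol_plus; apply hol_zeta_dual.
    + intros k w Hw. apply zeta_dual_pair_bound.
      * replace (1 - w)%C with ((1 - a) - (w - a))%C by ring. generalize (Cmod_triangle_minus (1 - a) (w - a)). lra.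
      * generalize (Cmod_fst_le (w - a)) (Rle_abs (fst (w - a)%C)). simpl. lra.
    + apply ex_series_scalR, ex_series_Rpower. lra.
Qed.

(** In [T2_formula] every term with m <> 0 splits into its leading part and its error. The errors
    and the term m = 0 are exactly what [zeta_via_SL] subtracts, and (4L)^s cancels the power of L
    in what is left. *)
Lemma zeta_via_SL_zeta_minus L s : 0 < L -> fst s < 0 -> ~ pole_set L s -> zeta_via_SL L s = zeta_minus s.
Proof.
  intros HL Hs Hp. assert (H4 : RtoC (4 * L) <> 0%C) by (apply RtoC_neq_0; lra).
  assert (N1 := cpow_neq_0 (4 * L) s).
  assert (T := T2_formula L s HL Hs Hp).
  assert (LD := CSer_correct _ (gamma_error_pair_summable L s HL ltac:(lra))).
  assert (LE := CSer_correct _ (zeta_dual_pair_summable s Hs)).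
  assert (T' := Clim_unique _ _ (Gamma (1 - s) / (4 * L)%R * (gamma_quot s 0 + (4 * L)%R * / cpow (4 * L) s * (CSer (zeta_dual_pair s) + CSer (gamma_error_pair L s))))%C T).
  unfold zeta_via_SL, zeta_minus. rewrite T'.
  - unfold gamma_error_sum. field. auto.
  - apply Clim_scal. rewrite T2_gamma_quot, ym_0. apply Clim_plus. apply Clim_const.
    apply Clim_ext with (fun n => (4 * L)%R * / cpow (4 * L) s * (csum (zeta_dual_pair s) n + csum (gamma_error_pair L s) n))%C.
    + intros n. rewrite <- csum_plus, <- csum_scal. apply csum_ext. intros k _.
      rewrite !T2_gamma_quot, !gamma_quot_zeta_dual_rho by (auto; lia). unfold zeta_dual_pair, gamma_error_pair, gamma_error. ring.
    + apply Clim_scal. now apply Clim_plus.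
Qed.

Definition zeta_series (s : CC) : CC := CSer (fun k => cpow (INR (S k)) (- s)).

(** Of the three parts, the first tends to the zeta series. The term m = 0 carries (4L/(n+1))^{s-1},
    which vanishes because Re s > 1, and the error sum is O((L/(n+1))^2). *)
Lemma zeta_via_SL_to_zeta L s : 0 < L -> 1 < fst s -> fst s < 2 -> Clim (fun n => zeta_via_SL (L / INR (S n)) s) (zeta_series s).
Proof.
  intros HL H1 H2. unfold zeta_via_SL.
  apply Clim_eq with (zeta_series s - Gamma (1 - s) * gamma_quot s 0 * 0 - Gamma (1 - s) * 0)%C; [|ring].
  apply Clim_minus. apply Clim_minus.
  - now apply SL_to_zeta.
  - apply Clim_ext with (fun n => Gamma (1 - s) * gamma_quot s 0 * (cpow (4 * (L / INR (S n))) s * / (4 * (L / INR (S n)))%R))%C. intros; ring.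
    apply Clim_scal. apply Clim_squeeze with (fun n => Rpower (4 * L) (fst s - 1) * Rpower (INR (S n)) (1 - fst s)).
    + exists O. intros n _. replace (_ - 0)%C with (cpow (4 * (L / INR (S n))) s * / (4 * (L / INR (S n)))%R)%C by ring.
      assert (HSn := INR_S_pos n). assert (HLn : 0 < 4 * (L / INR (S n))) by (apply Rmult_lt_0_compat; [lra|]; apply Rdiv_lt_0_compat; auto).
      rewrite <- (cpow_1 (4 * (L / INR (S n)))) by auto.
      change (cpow (4 * (L / INR (S n))) s * / cpow (4 * (L / INR (S n))) 1)%C with (cpow (4 * (L / INR (S n))) s / cpow (4 * (L / INR (S n))) 1)%C.
      rewrite <- cpow_minus, Cmod_cpow. right. 
      replace (fst (s - 1)%C) with (fst s - 1) by (simpl; ring).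
      replace (4 * (L / INR (S n))) with (4 * L * / INR (S n)) by (field; lra).
      rewrite <- Rpower_mult_distr by (try lra; now apply Rinv_0_lt_compat). f_equal.
      unfold Rpower. rewrite ln_Rinv by auto. f_equal. ring.
    + replace (Finite 0) with (Finite (Rpower (4 * L) (fst s - 1) * 0)) by (f_equal; ring). apply is_lim_seq_mult'. apply is_lim_seq_const.
      apply (is_lim_seq_incr_1 (fun n => Rpower (INR n) (1 - fst s))). apply Rpower_INR_lim. lra.
  - apply Clim_scal.
    destruct (gamma_error_pair_bound (Cmod (1 - s) + 1) (fst s)) as [Y0 [C0 [B1 [B2 B3]]]].
    { generalize (Cmod_ge_0 (1 - s)); lra. }
    set (b := fun k => Rpower (INR (S k)) (- (3 - fst s))).
    assert (Eb : ex_series b) by (apply ex_series_Rpower; lra).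
    apply Clim_squeeze with (fun n => C0 * L ^ 2 * Series b * (1 / INR (S n) * (1 / INR (S n)))).
    + destruct (large_index Y0 L HL) as [J HJ]. exists J. intros n Hn. 
      assert (HSn := INR_S_pos n). assert (HLn : 0 < L / INR (S n)) by (apply Rdiv_lt_0_compat; auto).
      replace (gamma_error_sum (L / INR (S n)) s - 0)%C with (gamma_error_sum (L / INR (S n)) s) by ring.
      apply Clim_le with (2 := CSer_correct _ (gamma_error_pair_summable (L / INR (S n)) s HLn H2)). exists O. intros K _.
      replace (C0 * L ^ 2 * Series b * (1 / INR (S n) * (1 / INR (S n)))) with (C0 * (L / INR (S n)) ^ 2 * Series b) by (field; lra).
      rewrite <- Series_scal_l. apply csum_le_Series; [|now apply ex_series_scalR].
      intros k. eapply Rle_trans; [apply Cmod_triangle|]. apply B3; auto. generalize (Cmod_ge_0 (1 - s)); lra. lra.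
      apply Rle_trans with (1 := HJ n Hn).
      replace (PI * INR (S k) / (2 * (L / INR (S n)))) with (PI * INR (S n) / (2 * L) * INR (S k)) by (field; lra).
      assert (HSk1 : 1 <= INR (S k)) by (apply (le_INR 1); lia). specialize (HJ n Hn). nra.
    + replace (Finite 0) with (Finite (C0 * L ^ 2 * Series b * (0 * 0))) by (f_equal; ring).
      apply is_lim_seq_mult'. apply is_lim_seq_const.
      apply is_lim_seq_mult'; apply (is_lim_seq_incr_1 (fun n => 1 / INR n)); apply is_lim_seq_inv_INR.
Qed.

(** * The zeta function and the formula for Re s < 2 *)

Lemma Cder_cpow (z : CC) (x : R) : 0 < x -> Cder (fun x => cpow x z) x (z * cpow x (z - 1))%C.
Proof.
  intros Hx. unfold cpow at 1. eapply Cder_eq. apply Cder_cexp. apply Cder_mult; [|apply Cder_const].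
  apply Cder_R. apply is_derive_Reals. apply derivable_pt_lim_ln; auto.
  eqbeta. change (cexp (ln x * z)) with (cpow x z). rewrite cpow_minus, cpow_1, RtoC_inv by lra. 
  assert (RtoC x <> 0%C) by (apply RtoC_neq_0; lra). field. auto.
Qed.

Lemma Cder_shift (f : R -> CC) (c t : R) (l : CC) : Cder f (c + t)%R l -> Cder (fun t => f (c + t)%R) t l.
Proof.
  intros [A B]. assert (HD : is_derive (fun t => c + t) t 1) by (auto_derive; auto; ring).
  split; eapply is_derive_eqR.
  apply (is_derive_compR (fun x => fst (f x)) (fun t => c + t) t _ _ A HD). bring.
  apply (is_derive_compR (fun x => snd (f x)) (fun t => c + t) t _ _ B HD). bring.
Qed.

(** Trapezoidal rule minus integral for x^{-s} on the interval from k+1 to k+2. *)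
Definition trap_err (s : CC) (k : nat) : CC :=
  ((cpow (INR (S k)) (- s) + cpow (INR (S (S k))) (- s)) / 2
    - (cpow (INR (S k)) (1 - s) - cpow (INR (S (S k))) (1 - s)) / (s - 1))%C.

(* Two integrations of the second derivative of x^{-s} bound the error of the trapezoidal rule on a unit interval. *)
Lemma trap_err_bound (s : CC) k : -1 < fst s -> s <> 1%C ->
  Cmod (trap_err s k) <= Cmod s * Cmod (s + 1) / 12 * Rpower (INR (S k)) (- (fst s + 2)).
Proof.
  intros Hs H1. assert (Hs1 : (s - 1)%C <> 0%C) by (intros E; apply H1; replace s with (s - 1 + 1)%C by ring; rewrite E; ring).
  set (c := INR (S k)). assert (Hc : 0 < c) by apply INR_S_pos.
  set (f := fun x => cpow x (- s)). set (M := Cmod s * Cmod (s + 1) * Rpower c (- (fst s + 2))).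
  assert (HM : 0 <= M) by (unfold M; apply Rmult_le_pos; [apply Rmult_le_pos; apply Cmod_ge_0|left; apply Rpower_pos]).
  set (f1 := fun x => (- s * cpow x (- s - 1))%C). set (f2 := fun x => (- s * ((- s - 1) * cpow x (- s - 1 - 1)))%C).
  assert (D0 : forall t, 0 <= t -> Cder (fun t => f (c + t)%R) t (f1 (c + t)%R)).
  { intros t Ht. apply (Cder_shift f). apply Cder_cpow. lra. }
  assert (D1 : forall t, 0 <= t -> Cder (fun t => f1 (c + t)%R) t (f2 (c + t)%R)).
  { intros t Ht. apply (Cder_shift f1). apply Cder_scal. apply Cder_cpow. lra. }
  assert (DI : forall t, 0 <= t -> Cder (fun t => cpow (c + t) (1 - s)) t ((1 - s) * f (c + t)%R)%C).
  { intros t Ht. apply (Cder_shift (fun x => cpow x (1 - s))). eapply Cder_eq. apply Cder_cpow. lra.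
    unfold f. replace (1 - s - 1)%C with (- s)%C by ring. reflexivity. }
  set (P1 := fun t => (f c - f (c + t)%R + t * f1 (c + t)%R)%C).
  assert (B1 : forall t, 0 <= t <= 1 -> Cmod (P1 t) <= / 2 * M * t ^ 2).
  { intros t Ht.
    assert (K := Cmvt P1 (fun t => t * f2 (c + t)%R)%C (fun t => / 2 * M * t ^ 2) (fun t => INR 2 * (/ 2 * M) * t ^ 1) 0 t (proj1 Ht)).
    assert (E : P1 0 = 0%C) by (unfold P1; rewrite Rplus_0_r; ring). rewrite E in K.
    replace (P1 t - 0)%C with (P1 t) in K by ring. eapply Rle_trans; [apply K|simpl; lra].
    - intros u Hu. unfold P1. eapply Cder_eq. apply Cder_plus. apply Cder_minus. apply Cder_const. apply D0; lra.
      apply Cder_mult. apply Cder_R. apply @is_derive_id. apply D1; lra. unfold one; simpl. bring.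
    - intros u Hu. apply is_derive_pow_const.
    - intros u Hu. rewrite Cmod_mult, Cmod_R, Rabs_pos_eq by lra. replace (INR 2 * (/ 2 * M) * u ^ 1) with (u * M) by (simpl; field).
      apply Rmult_le_compat_l; [lra|]. unfold f2, M. rewrite !Cmod_mult, Cmod_opp, Cmod_cpow.
      replace (- s - 1)%C with (- (s + 1))%C by ring. rewrite Cmod_opp, Rmult_assoc.
      apply Rmult_le_compat_l. apply Cmod_ge_0. apply Rmult_le_compat_l. apply Cmod_ge_0.
      replace (fst (- (s + 1) - 1)%C) with (- (fst s + 2)) by (simpl; ring). apply Rpower_le_base_neg; lra. }
  set (P0 := fun t : R => (/ 2 * (t * (f c + f (c + t)%R)) - / (s - 1) * (cpow c (1 - s) - cpow (c + t) (1 - s)))%C).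
  assert (K := Cmvt P0 (fun t => / 2 * P1 t)%C (fun t => / 12 * M * t ^ 3) (fun t => INR 3 * (/ 12 * M) * t ^ 2) 0 1 ltac:(lra)).
  assert (E0 : P0 0 = 0%C) by (unfold P0; rewrite Rplus_0_r; ring).
  assert (E1 : P0 1 = trap_err s k).
  { unfold P0, trap_err, f. fold c. replace (INR (S (S k))) with (c + 1) by (unfold c; rewrite !S_INR; ring). field. auto. }
  rewrite E0, E1 in K. replace (trap_err s k - 0)%C with (trap_err s k) in K by ring.
  eapply Rle_trans; [apply K|].
  - intros u Hu. unfold P0. eapply Cder_eq. apply Cder_minus. apply Cder_scal. apply Cder_mult. apply Cder_R. apply @is_derive_id.
    apply Cder_plus. apply Cder_const. apply D0; lra. apply Cder_scal. apply Cder_minus. apply Cder_const. apply DI; lra.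
    unfold one; simpl. unfold P1. eqbeta. field. auto.
  - intros u Hu. apply is_derive_pow_const.
  - intros u Hu. rewrite Cmod_mult, <- RtoC_inv, Cmod_R, Rabs_pos_eq by lra.
    specialize (B1 u Hu). simpl INR. lra.
  - right. unfold M. field.
Qed.

(** 1/(s-1) is the integral of x^{-s} from 1 to infinity, and 1/2 is the half of the first term that
    the trapezoids miss. The errors are O(k^{-Re s - 2}), so the formula reaches Re s > -1 and
    overlaps the half-plane of [zeta_minus]. *)
Definition zeta_trapezoid (s : CC) : CC := (1 / (s - 1) + 1 / 2 + CSer (trap_err s))%C.

Lemma hol_zeta_trapezoid (a : CC) : -1 < fst a -> a <> 1%C -> hol zeta_trapezoid a.
Proof.
  intros Ha H1. assert (Ha1 : (a - 1)%C <> 0%C) by (intros E; apply H1; replace a with (a - 1 + 1)%C by ring; rewrite E; ring).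
  assert (Hd : 0 < Cmod (a - 1)) by now apply Cmod_gt_0.
  set (r := Rmin (Rmin 1 ((fst a + 1) / 2)) (Cmod (a - 1))).
  assert (Hr : 0 < r) by (apply Rmin_glb_lt; auto; apply Rmin_glb_lt; lra).
  assert (HR : forall w, Cmod (w - a) < r -> Cmod (w - a) < 1 /\ (fst a - 1) / 2 < fst w /\ w <> 1%C).
  { intros w Hw. assert (A1 := Rlt_le_trans _ _ _ Hw (Rmin_l _ _)). assert (A2 := Rlt_le_trans _ _ _ Hw (Rmin_r _ _)).
    assert (A3 := Rlt_le_trans _ _ _ A1 (Rmin_l _ _)). assert (A4 := Rlt_le_trans _ _ _ A1 (Rmin_r _ _)).
    split; [auto|split].
    - generalize (Cmod_fst_le (w - a)) (Rabs_le_between (fst (w - a)%C) (Cmod (w - a))). simpl. intros Q1 [Q2 _]. specialize (Q2 Q1). lra.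
    - intros E. rewrite E, Cmod_minus_sym in A2. lra. }
  unfold zeta_trapezoid. apply hol_plus. apply hol_plus; [|apply hol_const].
  - apply hol_div. apply hol_const. apply hol_minus. apply hol_id. apply hol_const. auto.
  - set (A := Cmod a + 1).
    apply (hol_series (fun k s => trap_err s k)) with (R0 := r) (b := fun k => A * (A + 1) / 12 * Rpower (INR (S k)) (- ((fst a - 1) / 2 + 2))); auto.
    + intros k w Hw. destruct (HR w Hw) as [_ [_ W1]]. unfold trap_err.
      assert (hol (fun s => - s)%C w) by apply hol_opp, hol_id.
      assert (hol (fun s => 1 - s)%C w) by (apply hol_minus; [apply hol_const|apply hol_id]).
      apply hol_minus.
      * apply hol_mult; [|apply hol_const]. apply hol_plus; apply hol_cpow; auto.
      * apply hol_div. apply hol_minus; apply hol_cpow; auto. apply hol_minus. apply hol_id. apply hol_const.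
        intros E; apply W1. replace w with (w - 1 + 1)%C by ring. rewrite E; ring.
    + intros k w Hw. destruct (HR w Hw) as [W0 [W2 W1]]. eapply Rle_trans; [apply trap_err_bound; auto; lra|].
      assert (HwA : Cmod w <= A) by (generalize (Cmod_triangle_sub w a); unfold A; lra).
      assert (HwA1 : Cmod (w + 1) <= A + 1) by (eapply Rle_trans; [apply Cmod_triangle|]; rewrite Cmod_1; lra).
      generalize (Cmod_ge_0 w) (Cmod_ge_0 (w + 1)); intros.
      apply Rmult_le_compat. unfold Rdiv; nra. left; apply Rpower_pos. unfold Rdiv; nra.
      assert (HSk1 : 1 <= INR (S k)) by (apply (le_INR 1); lia).
      destruct (Req_dec (INR (S k)) 1) as [E1|E1]. rewrite E1. unfold Rpower. rewrite ln_1, !Rmult_0_r. lra.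
      apply Rle_Rpower; lra.
    + apply ex_series_scalR, ex_series_Rpower. lra.
Qed.

Lemma zeta_series_summable (s : CC) : 1 < fst s -> ex_series (fun k => Cmod (cpow (INR (S k)) (- s))).
Proof.
  intros Hs. apply ex_series_Cmod_le with (fun k => Rpower (INR (S k)) (- fst s)); [|now apply ex_series_Rpower].
  intros k. rewrite Cmod_cpow. simpl. lra.
Qed.

Lemma zeta_trapezoid_dirichlet (s : CC) : 1 < fst s -> zeta_trapezoid s = zeta_series s.
Proof.
  intros Hs. assert (Hs1 : (s - 1)%C <> 0%C) by (intros E; assert (E1 := f_equal fst E); simpl in E1; lra).
  assert (HZ : Clim (csum (fun k => cpow (INR (S k)) (- s))) (zeta_series s)) by (apply CSer_correct; now apply zeta_series_summable).
  assert (HT : forall K, csum (trap_err s) K = (csum (fun k => cpow (INR (S k)) (- s)) K - / 2 + / 2 * cpow (INR (S K)) (- s)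
     - / (s - 1) + / (s - 1) * cpow (INR (S K)) (1 - s))%C).
  { induction K.
    - simpl csum. simpl INR. unfold cpow. rewrite ln_1, !Cmult_0_l, cexp_0. ring.
    - cbn [csum]. rewrite IHK. unfold trap_err. field. auto. }
  assert (HC : Clim (csum (trap_err s)) (zeta_series s - / 2 + / 2 * 0 - / (s - 1) + / (s - 1) * 0)%C).
  { assert (Hlim : forall z : CC, fst z < 0 -> Clim (fun K => cpow (INR (S K)) z) 0).
    { intros z Hz. apply Clim_squeeze with (fun K => Rpower (INR (S K)) (fst z)).
      exists O; intros n _. replace (cpow (INR (S n)) z - 0)%C with (cpow (INR (S n)) z) by ring. rewrite Cmod_cpow. lra.
      apply (is_lim_seq_incr_1 (fun n => Rpower (INR n) (fst z))). now apply Rpower_INR_lim. }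
    apply Clim_ext with (2 := Clim_plus _ _ _ _ (Clim_minus _ _ _ _ (Clim_plus _ _ _ _ (Clim_minus _ _ _ _ HZ (Clim_const (/ 2)%C))
      (Clim_scal (/ 2)%C _ _ (Hlim (- s)%C ltac:(simpl; lra)))) (Clim_const (/ (s - 1))%C)) (Clim_scal (/ (s - 1))%C _ _ (Hlim (1 - s)%C ltac:(simpl; lra)))).
    intros K. symmetry. apply HT. }
  unfold zeta_trapezoid. rewrite (CSer_unique _ _ HC). field. auto.
Qed.

Definition in_strip (L : R) (s : CC) : Prop := -1 < fst s < 2 /\ s <> 1%C /\ ~ pole_set L s.

Lemma pole_set_strip_re L (s : CC) : -1 < fst s < 2 -> pole_set L s -> fst s = 0.
Proof.
  intros Hs [m [k ->]]. simpl in *. destruct k as [|k]; [simpl; ring|].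
  assert (1 <= INR (S k)) by (apply (le_INR 1); lia). lra.
Qed.

Definition base_height (L : R) : R := PI / (2 * L).

Lemma pole_set_height L (s : CC) : 0 < L -> pole_set L s -> base_height L <= Rabs (snd s - base_height L).
Proof.
  intros HL [m [k ->]]. unfold base_height. simpl. generalize PI_RGT_0; intros HP.
  assert (H0 : 0 < PI / (2 * L)) by (apply Rdiv_lt_0_compat; lra).
  replace (IZR m * PI / L - PI / (2 * L)) with ((2 * IZR m - 1) * (PI / (2 * L))) by (field; lra).
  rewrite Rabs_mult, (Rabs_pos_eq (PI / (2 * L))) by lra.
  assert (H1 : 1 <= Rabs (2 * IZR m - 1)).
  { replace (2 * IZR m - 1) with (IZR (2 * m - 1)) by (rewrite minus_IZR, mult_IZR; ring).
    rewrite Rabs_Zabs. apply IZR_le. lia. }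
  nra.
Qed.

Lemma tube_bounds (w c : CC) d : Cmod (w - c) < d -> Rabs (fst w - fst c) < d /\ Rabs (snd w - snd c) < d.
Proof.
  intros H. split; eapply Rle_lt_trans; [apply (Cmod_fst_le (w - c))|exact H|apply (Cmod_snd_le (w - c))|exact H].
Qed.

(** An L-shaped route leads from the initial disc to [s]: first along the safe height, then
    vertically at the abscissa of [s]. The second leg is why Re s = 0 and Re s = 1 are excluded. *)
Lemma strip_identity_generic L P x1 r (s : CC) : 0 < L -> -1 < x1 < 2 -> 0 < r ->
  (forall z, in_strip L z -> hol P z) ->
  (forall z, Cmod (z - (x1, base_height L)) < r -> P z = 0%C) ->
  -1 < fst s < 2 -> fst s <> 0 -> fst s <> 1 -> P s = 0%C.
Proof.
  intros HL Hx1 Hr HP Hz Hs Hs0 Hs1. set (t0 := base_height L) in *. set (x0 := fst s) in *.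
  assert (Ht0 : 0 < t0) by (unfold t0, base_height; apply Rdiv_lt_0_compat; generalize PI_RGT_0; lra).
  set (m := Rmin (Rmin (1 + x1) (2 - x1)) (Rmin (1 + x0) (2 - x0))).
  assert (Hm : 0 < m) by (repeat apply Rmin_glb_lt; lra).
  assert (M1 : m <= 1 + x1) by (eapply Rle_trans; [apply Rmin_l|apply Rmin_l]).
  assert (M2 : m <= 2 - x1) by (eapply Rle_trans; [apply Rmin_l|apply Rmin_r]).
  assert (M3 : m <= 1 + x0) by (eapply Rle_trans; [apply Rmin_r|apply Rmin_l]).
  assert (M4 : m <= 2 - x0) by (eapply Rle_trans; [apply Rmin_r|apply Rmin_r]).
  set (d1 := Rmin t0 m). assert (Hd1 : 0 < d1) by (apply Rmin_glb_lt; auto).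
  assert (D1 : d1 <= t0) by apply Rmin_l. assert (D2 : d1 <= m) by apply Rmin_r.
  (* Horizontal leg: a tube of radius at most [t0] stays strictly between the heights 0 and 2 t0,
     hence off the point 1 and off the poles. *)
  assert (HH : forall w : CC, Cmod (w - ((x1, t0) + (x0 - x1, 0)%R)) < d1 / 2 -> P w = 0%C).
  { apply (hol_identity_segment P (x1, t0) (x0 - x1, 0) d1 r Hd1 Hr); auto.
    intros t w Ht Hw. apply HP. apply tube_bounds in Hw as [W1 W2]. simpl in W1, W2.
    apply Rabs_def2 in W1.
    assert (W3 : Rabs (snd w - t0) < t0).
    { replace (snd w - t0) with (snd w - (t0 + (t * 0 + 0 * (x0 - x1)))) by ring. lra. }
    split; [|split].
    - assert (-1 < fst w) by nra. assert (fst w < 2) by nra. lra.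
    - intros E. rewrite E in W3. simpl in W3. apply Rabs_def2 in W3. lra.
    - intros Hp. apply pole_set_height in Hp; auto. fold t0 in Hp. lra. }
  set (d2 := Rmin (Rmin (Rabs x0) (Rabs (x0 - 1))) (Rmin (1 + x0) (2 - x0))).
  assert (Hd2 : 0 < d2).
  { repeat apply Rmin_glb_lt; try lra; apply Rabs_pos_lt; lra. }
  assert (N1 : d2 <= Rabs x0) by (eapply Rle_trans; [apply Rmin_l|apply Rmin_l]).
  assert (N2 : d2 <= Rabs (x0 - 1)) by (eapply Rle_trans; [apply Rmin_l|apply Rmin_r]).
  assert (N3 : d2 <= 1 + x0) by (eapply Rle_trans; [apply Rmin_r|apply Rmin_l]).
  assert (N4 : d2 <= 2 - x0) by (eapply Rle_trans; [apply Rmin_r|apply Rmin_r]).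
  set (v := (0, snd s - t0) : CC).
  assert (Ep : ((x1, t0) + (x0 - x1, 0)%R)%C = ((x0, t0) : CC)) by (apply C_eq; simpl; ring).
  (* Vertical leg: within the strip all poles have real part 0, so the distances of Re s to 0 and to
     1 bound the radius of the tube. *)
  assert (HV : forall w : CC, Cmod (w - ((x0, t0) + v)) < d2 / 2 -> P w = 0%C).
  { apply (hol_identity_segment P (x0, t0) v d2 (d1 / 2)); auto. lra.
    - intros t w Ht Hw. apply HP. apply tube_bounds in Hw as [W1 _]. simpl in W1.
      replace (x0 + (t * 0 - 0 * (snd s - t0))) with x0 in W1 by ring.
      split; [|split].
      + apply Rabs_def2 in W1. lra.
      + intros E. rewrite E in W1. simpl in W1. rewrite Rabs_minus_sym in W1. lra.
      + intros Hp. apply pole_set_strip_re in Hp. rewrite Hp in W1. rewrite Rabs_minus_sym, Rminus_0_r in W1. lra.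
        apply Rabs_def2 in W1. lra.
    - intros w Hw. apply HH. now rewrite Ep. }
  apply HV. replace (s - ((x0, t0) + v))%C with (RtoC 0). rewrite Cmod_0; lra. unfold v, x0. apply C_eq; simpl; ring.
Qed.

(* The zero set of [P] is propagated along the height pi/(2L), which avoids the poles at the even multiples of it. *)
Lemma strip_identity L P x1 r (s : CC) : 0 < L -> -1 < x1 < 2 -> 0 < r ->
  (forall z, in_strip L z -> hol P z) ->
  (forall z, Cmod (z - (x1, base_height L)) < r -> P z = 0%C) ->
  in_strip L s -> P s = 0%C.
Proof.
  intros HL Hx1 Hr HP Hz Hs. assert (HG := fun s => strip_identity_generic L P x1 r s HL Hx1 Hr HP Hz).
  assert (Hhol := HP s Hs). destruct Hs as [Hs _].
  (* The exceptional abscissas 0 and 1 are reached by continuity from the right. For n beyond the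
     threshold, 1/n is smaller than 2 - Re s and than each nonzero distance of Re s to 0 and 1, so
     Re u_n is generic. *)
  set (u := fun n : nat => (s + / INR n)%C).
  assert (Hu : Clim u s).
  { apply Clim_eq with (s + 0)%C; [|ring]. apply Clim_plus. apply Clim_const. apply Clim_inv_INR. }
  assert (L1 := hol_continuous P s u Hhol Hu). apply Clim_unique with (1 := L1).
  apply Clim_ext_loc with (fun _ => RtoC 0); [|apply Clim_const].
  destruct (exists_INR_ge (1 + 1 / (2 - fst s) + (if Req_EM_T (fst s) 0 then 0 else 1 / Rabs (fst s)) + (if Req_EM_T (fst s) 1 then 0 else 1 / Rabs (fst s - 1)))) as [N HN].
  exists (S (S N)). intros n Hn. symmetry.
  assert (H2 : 0 < 1 / (2 - fst s)) by (apply Rdiv_lt_0_compat; lra).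
  assert (H3 : 0 <= (if Req_EM_T (fst s) 0 then 0 else 1 / Rabs (fst s))).
  { destruct (Req_EM_T (fst s) 0); [lra|]. left; apply Rdiv_lt_0_compat; [lra|]. now apply Rabs_pos_lt. }
  assert (H4 : 0 <= (if Req_EM_T (fst s) 1 then 0 else 1 / Rabs (fst s - 1))).
  { destruct (Req_EM_T (fst s) 1); [lra|]. left; apply Rdiv_lt_0_compat; [lra|]. apply Rabs_pos_lt; lra. }
  assert (Hn1 : INR N + 1 < INR n) by (rewrite <- S_INR; apply lt_INR; lia).
  set (x := INR n) in *. assert (Hx : 2 < x) by lra.
  assert (Hxi : 0 < / x < 1 / 2).
  { split. apply Rinv_0_lt_compat; lra. unfold Rdiv. rewrite Rmult_1_l. apply Rinv_lt_contravar; lra. }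
  assert (Hfu : fst (u n) = fst s + / x).
  { unfold u. fold x. rewrite <- RtoC_inv by lra. reflexivity. }
  assert (Hsmall : forall y, 0 < y -> 1 / y < x -> / x < y).
  { intros y Hy Hyx. rewrite <- (Rinv_inv y). apply Rinv_lt_contravar. apply Rmult_lt_0_compat; [now apply Rinv_0_lt_compat|lra].
    unfold Rdiv in Hyx. lra. }
  apply HG; rewrite Hfu.
  - assert (/ x < 2 - fst s) by (apply Hsmall; lra). lra.
  - destruct (Req_EM_T (fst s) 0) as [E|E]; [lra|]. intros E2.
    assert (/ x < Rabs (fst s)) by (apply Hsmall; [now apply Rabs_pos_lt|lra]).
    replace (fst s) with (- / x) in H by lra. rewrite Rabs_Ropp, Rabs_pos_eq in H; lra.
  - destruct (Req_EM_T (fst s) 1) as [E|E]; [lra|]. intros E2.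
    assert (/ x < Rabs (fst s - 1)) by (apply Hsmall; [apply Rabs_pos_lt; lra|lra]).
    replace (fst s - 1) with (- / x) in H by lra. rewrite Rabs_Ropp, Rabs_pos_eq in H; lra.
Qed.

(** Dividing L by an integer multiplies the spacing pi/L of the poles by it. For a general smaller
    scale this inclusion fails, which is why the scales L/n are used. *)
Lemma pole_set_div L n s : 0 < L -> pole_set (L / INR (S n)) s -> pole_set L s.
Proof.
  intros HL [m [k ->]]. exists (m * Z.of_nat (S n))%Z, k. f_equal. rewrite mult_IZR, <- INR_IZR_INZ.
  assert (H := INR_S_pos n). field. lra.
Qed.

(** On the disc of radius 1/2 about abscissa -1/2 the real part is negative, so both sides equal
    [zeta_minus]; the identity theorem spreads the equality over the strip. *)
Lemma zeta_via_SL_div L n s : 0 < L -> in_strip L s -> zeta_via_SL L s = zeta_via_SL (L / INR (S n)) s.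
Proof.
  intros HL Hs. assert (HLn : 0 < L / INR (S n)) by (apply Rdiv_lt_0_compat; auto using INR_S_pos).
  assert (E : (zeta_via_SL L s - zeta_via_SL (L / INR (S n)) s)%C = 0%C).
  { apply (strip_identity L (fun z => zeta_via_SL L z - zeta_via_SL (L / INR (S n)) z)%C (- (1 / 2)) (1 / 2)); auto; try lra.
    - intros z [Z1 [Z2 Z3]]. apply hol_minus; apply hol_zeta_via_SL; auto; try lra. intros Hp. apply Z3. now apply pole_set_div with n.
    - intros z Hz. apply tube_bounds in Hz as [Hz _]. simpl in Hz. apply Rabs_def2 in Hz.
      rewrite !zeta_via_SL_zeta_minus; auto; try lra. ring.
      intros Hp. apply pole_set_strip_re in Hp; lra. intros Hp. apply pole_set_strip_re in Hp; lra. }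
  replace (zeta_via_SL L s) with (zeta_via_SL L s - zeta_via_SL (L / INR (S n)) s + zeta_via_SL (L / INR (S n)) s)%C by ring. rewrite E. ring.
Qed.

(** By [zeta_via_SL_div] the sequence in [zeta_via_SL_to_zeta] is constant, so its only value is its
    limit. *)
Lemma zeta_via_SL_zeta_series L s : 0 < L -> 1 < fst s < 2 -> zeta_via_SL L s = zeta_series s.
Proof.
  intros HL Hs. apply Clim_unique with (2 := zeta_via_SL_to_zeta L s HL (proj1 Hs) (proj2 Hs)).
  apply Clim_ext with (fun _ => zeta_via_SL L s); [|apply Clim_const]. intros n. apply zeta_via_SL_div; auto.
  split; [lra|split].
  - intros E. rewrite E in Hs. simpl in Hs. lra.
  - intros Hp. apply pole_set_strip_re in Hp; lra.
Qed.

Lemma zeta_via_SL_zeta_trapezoid L s : 0 < L -> in_strip L s -> zeta_via_SL L s = zeta_trapezoid s.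
Proof.
  intros HL Hs. assert (E : (zeta_via_SL L s - zeta_trapezoid s)%C = 0%C).
  { apply (strip_identity L (fun z => zeta_via_SL L z - zeta_trapezoid z)%C (3 / 2) (1 / 2)); auto; try lra.
    - intros z [Z1 [Z2 Z3]]. apply hol_minus. apply hol_zeta_via_SL; auto; lra. apply hol_zeta_trapezoid; auto; lra.
    - intros z Hz. apply tube_bounds in Hz as [Hz _]. simpl in Hz. apply Rabs_def2 in Hz.
      rewrite zeta_via_SL_zeta_series, zeta_trapezoid_dirichlet; auto; try lra. ring. }
  replace (zeta_via_SL L s) with (zeta_via_SL L s - zeta_trapezoid s + zeta_trapezoid s)%C by ring. rewrite E. ring.
Qed.

(** The functional equation of zeta on this strip. Neither side involves L, and the scale 1 is an
    arbitrary choice. *)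
Lemma zeta_minus_zeta_trapezoid s : -1 < fst s < 0 -> zeta_minus s = zeta_trapezoid s.
Proof.
  intros Hs. assert (Hp : ~ pole_set 1 s) by (intros Hp; apply pole_set_strip_re in Hp; lra).
  rewrite <- (zeta_via_SL_zeta_minus 1 s); auto; try lra. apply zeta_via_SL_zeta_trapezoid; [lra|]. split; [lra|split; auto].
  intros E. rewrite E in Hs. simpl in Hs. lra.
Qed.

(** The cut may lie anywhere inside -1 < Re s < 0, where the two pieces agree; at -1/2 every point
    has a disc on which a single piece describes the function. *)
Definition zeta (s : CC) : CC := if Rlt_dec (fst s) (- (1 / 2)) then zeta_minus s else zeta_trapezoid s.

Lemma hol_zeta (a : CC) : a <> 1%C -> hol zeta a.
Proof.
  intros Ha. destruct (Rlt_dec (fst a) (- (1 / 2))) as [H|H].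
  - apply hol_ext_loc with zeta_minus; [|apply hol_zeta_minus; lra].
    exists (- (1 / 2) - fst a). split; [lra|]. intros z Hz. unfold zeta. destruct (Rlt_dec (fst z) (- (1 / 2))) as [Hz2|Hz2]; auto.
    exfalso. apply tube_bounds in Hz as [Hz _]. apply Rabs_def2 in Hz. lra.
  - apply hol_ext_loc with zeta_trapezoid; [|apply hol_zeta_trapezoid; auto; lra].
    exists (1 / 2). split; [lra|]. intros z Hz. unfold zeta. destruct (Rlt_dec (fst z) (- (1 / 2))) as [Hz2|Hz2]; auto.
    symmetry. apply zeta_minus_zeta_trapezoid. apply tube_bounds in Hz as [Hz _]. apply Rabs_def2 in Hz. lra.
Qed.

Lemma zeta_is_riemann_zeta : is_riemann_zeta zeta.
Proof.
  split.
  - intros s Hs. now apply hol_holo_at, hol_zeta.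
  - intros s Hs. change (1 < fst s) in Hs. apply cseries_to_Clim. unfold zeta. destruct (Rlt_dec (fst s) (- (1 / 2))); [lra|].
    rewrite zeta_trapezoid_dirichlet by auto. apply CSer_correct. now apply zeta_series_summable.
Qed.

Lemma zeta_via_SL_zeta L (s : CC) : 0 < L -> fst s < 2 -> s <> 1%C -> ~ pole_set L s -> zeta_via_SL L s = zeta s.
Proof.
  intros HL Hs H1 Hp. unfold zeta. destruct (Rlt_dec (fst s) (- (1 / 2))).
  - apply zeta_via_SL_zeta_minus; auto; lra.
  - apply zeta_via_SL_zeta_trapezoid; auto. split; [lra|split; auto].
Qed.

Lemma qD_pos D : (0 < D)%Z -> 0 < qD D.
Proof. intros HD. apply IZR_lt in HD. unfold qD. destruct (_ =? _)%Z; lra. Qed.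

Lemma T1_pair_sum L s : 0 < L -> fst s < 2 ->
  Clim (csum (fun k => T1 L s (Z.of_nat (S k)) + T1 L s (- Z.of_nat (S k)))%C) (Gamma (1 - s) * / cpow (4 * L) s * gamma_error_sum L s)%C.
Proof.
  intros HL Hs. apply Clim_ext with (fun n => Gamma (1 - s) * / cpow (4 * L) s * csum (gamma_error_pair L s) n)%C.
  - intros n. rewrite <- csum_scal. apply csum_ext. intros k _. rewrite !T1_gamma_error by (auto; lia). unfold gamma_error_pair. ring.
  - apply Clim_scal. apply CSer_correct. now apply gamma_error_pair_summable.
Qed.

Lemma T1_summable L s : 0 < L -> fst s < 2 ->
  ex_series (fun k => Cmod (T1 L s (Z.of_nat (S k))) + Cmod (T1 L s (- Z.of_nat (S k)))).
Proof.
  intros HL Hs. set (c := (Gamma (1 - s) * / cpow (4 * L) s)%C).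
  apply ex_series_ext with (fun k => Cmod c * (Cmod (gamma_error L s (Z.of_nat (S k))) + Cmod (gamma_error L s (- Z.of_nat (S k))))).
  - intros k. rewrite !T1_gamma_error by (auto; lia). fold c. rewrite !(Cmod_mult c). bring.
  - apply ex_series_scalR. now apply gamma_error_summable.
Qed.

Theorem mainTheorem8 (D : Z) (eps epsb : R)
  (HD : (0 < D)%Z) (HDsq : squarefree D)
  (Heps : fundamental_unit D eps)
  (Hconj : OD_conj D eps epsb)
  (Hnorm : eps * epsb = -1) :
  let L := ln eps in
  let q := qD D in
  exists (ZD : CC -> CC) (zeta : CC -> CC),
    is_riemann_zeta zeta /\
    (* meromorphic on C, holomorphic off the pole set *)
    (forall s : CC, ~ pole_set L s -> holo_at ZD s) /\
    (* Z agrees with the Dirichlet series sum_{n>=1} F_D(2n)^{-s}, convergent for Re s > 0 *)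
    (forall s : CC, 0 < Re s ->
       cseries_to (fun k => cpow (FD D eps epsb (2 * S k)) (Copp s)) (ZD s)) /\
    (* formula for Re s < 2 (in particular 1 < Re s < 2), with absolute convergence *)
    (forall s : CC, Re s < 2 -> s <> RtoC 1 -> ~ pole_set L s ->
       ex_series (fun k => Cmod (T1 L s (Z.of_nat (S k))) + Cmod (T1 L s (- Z.of_nat (S k)))) /\
       exists Sm : CC,
         cseries_to (fun k => Cplus (T1 L s (Z.of_nat (S k))) (T1 L s (- Z.of_nat (S k)))) Sm /\
         ZD s = Cplus (Cplus
                 (Cdiv (Cmult (cpow q (Cdiv s (RtoC 2))) (zeta s)) (cpow (4 * L) s))
                 (Cdiv (Cmult (Cmult (cpow q (Cdiv s (RtoC 2))) (Gamma (Cminus (RtoC 1) s)))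
                              (Gamma (Cdiv s (RtoC 2))))
                       (Cmult (Cmult (RtoC 4) (Gamma (Cminus (RtoC 1) (Cdiv s (RtoC 2)))))
                              (RtoC L))))
               (Cmult (cpow q (Cdiv s (RtoC 2))) Sm)) /\
    (* formula for Re s < 0 *)
    (forall s : CC, Re s < 0 -> ~ pole_set L s ->
       exists Sm : CC,
         cseries_to (fun k => Cplus (T2 L s (Z.of_nat (S k))) (T2 L s (- Z.of_nat (S k)))) Sm /\
         ZD s = Cmult (Cdiv (Cmult (cpow q (Cdiv s (RtoC 2))) (Gamma (Cminus (RtoC 1) s)))
                           (RtoC (4 * L)))
                     (Cplus (T2 L s 0) Sm)) /\
    (* simple poles at pi i m / log eps - 2k *)
    (forall s : CC, pole_set L s -> simple_pole ZD s).
Proof.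
  intros L q.
  assert (Heps1 : 1 < eps) by apply Heps.
  assert (HL : 0 < L) by (unfold L; rewrite <- ln_1; apply ln_increasing; lra).
  assert (Hq : 0 < q) by now apply qD_pos.
  exists (fun s => cpow q (s / 2) * SL L s)%C, zeta.
  split; [exact zeta_is_riemann_zeta|split; [|split; [|split; [|split]]]].
  - intros s Hs. apply hol_holo_at, hol_mult. apply hol_cpow, hol_half_id. now apply hol_SL.
  - intros s Hs. change (0 < fst s) in Hs. apply cseries_to_Clim.
    apply Clim_ext with (fun n => cpow q (s / 2) * csum (sinh_term L s) n)%C.
    + intros n. rewrite <- csum_scal. apply csum_ext. intros k _. symmetry. now apply FD_term.
    + apply Clim_scal. now apply SL_dirichlet.
  - intros s Hs H1 Hp. change (fst s < 2) in Hs. split; [now apply T1_summable|].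
    exists (Gamma (1 - s) * / cpow (4 * L) s * gamma_error_sum L s)%C. split.
    + apply cseries_to_Clim. now apply T1_pair_sum.
    (* The formula is the equality of [zeta_via_SL] and zeta, solved for [SL L s]. *)
    + rewrite <- (zeta_via_SL_zeta L s HL Hs H1 Hp). unfold zeta_via_SL.
      assert (N1 := cpow_neq_0 (4 * L) s).
      assert (HL0 : RtoC L <> 0%C) by (apply RtoC_neq_0; lra).
      assert (HG : Gamma (1 - s / 2) <> 0%C) by (apply Gamma_neq_0, re_pos_shift_neq_0; simpl; lra).
      assert (Ephi : gamma_quot s 0 = (Gamma (s / 2) / Gamma (1 - s / 2))%C).
      { rewrite Gamma_quotient. unfold gamma_quot. rewrite im_0. f_equal; f_equal; ring. }
      rewrite Ephi, RtoC_mult. field. auto.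
  - intros s Hs Hp. change (fst s < 0) in Hs.
    assert (HG : Gamma (1 - s) <> 0%C) by (apply Gamma_neq_0, re_pos_shift_neq_0; simpl; lra).
    assert (H4 : RtoC (4 * L) <> 0%C) by (apply RtoC_neq_0; lra).
    (* The witness is obtained by solving the asserted formula for the sum over m <> 0; Gamma(1-s)
       is nonzero because Re(1-s) > 0. *)
    exists ((4 * L)%R / Gamma (1 - s) * SL L s - T2 L s 0)%C. split.
    + apply cseries_to_Clim.
      apply Clim_ext with (fun n => (4 * L)%R / Gamma (1 - s) * (Gamma (1 - s) / (4 * L)%R *
        (T2 L s 0 + csum (fun k => T2 L s (Z.of_nat (S k)) + T2 L s (- Z.of_nat (S k))) n)) - T2 L s 0)%C.
      * intros n. field. auto.
      * apply Clim_minus; [|apply Clim_const]. apply Clim_scal. now apply T2_formula.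
    + field. auto.
  - intros s Hs. apply simple_pole_SL; auto.
    + intros z. apply hol_cpow, hol_half_id.
    + apply cpow_neq_0.
Qed.
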